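(* Let $p$ be an odd prime, $S$ a finite $p$-group of sectional rank $3$ and $\mathcal{F}$ a saturated fusion system on $S$. Let $E_1$ and $E_2$ be distinct $\mathcal{F}$-essential subgroups of $S$ that are $\mathcal{F}$-characteristic in $S$, and set $T=\mathrm{core}_{\mathcal{F}}(E_1,E_2)$. Then either $S/T\cong p^{1+2}_+$ or $S/T$ is isomorphic to a Sylow $p$-subgroup of $\mathrm{Sp}_4(p)$.
   Context: Rank: minimal size of a generating set; a $p$-group has sectional rank $k$ if all its subgroups have rank at most $k$ and $k$ is minimal. For $P\le S$, $\mathrm{Aut}_{\mathcal{F}}(P)=\mathrm{Hom}_{\mathcal{F}}(P,P)$, $\mathrm{Out}_{\mathcal{F}}(P)=\mathrm{Aut}_{\mathcal{F}}(P)/\mathrm{Inn}(P)$, $P^{\mathcal{F}}=\{P\alpha:\alpha\in\mathrm{Hom}_{\mathcal{F}}(P,S)\}$. $E\le S$ is $\mathcal{F}$-essential if $C_S(P)\le P$ and $|N_S(E)|\ge|N_S(P)|$ for all $P\in E^{\mathcal{F}}$, and $\mathrm{Out}_{\mathcal{F}}(E)$ has a strongly $p$-embedded subgroup. $E$ is $\mathcal{F}$-characteristic in $S$ if normalized by $\mathrm{Aut}_{\mathcal{F}}(S)$. Here $\mathrm{core}_{\mathcal{F}}(E_1,E_2)$ is the largest subgroup of $E_1\cap E_2$ normalized by $\mathrm{Aut}_{\mathcal{F}}(E_1)$, $\mathrm{Aut}_{\mathcal{F}}(E_2)$ and $\mathrm{Aut}_{\mathcal{F}}(S)$. $p^{1+2}_+$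 is the extraspecial group of order $p^3$ and exponent $p$. *)

(* Defs.v *)
From HB Require Import structures.
From mathcomp Require Import all_boot all_order all_algebra all_fingroup all_solvable.
Set Implicit Arguments. Unset Strict Implicit. Unset Printing Implicit Defensive.
Import GRing.Theory.
From Stdlib Require Import ClassicalEpsilon.
Local Open Scope group_scope.

Definition pbool (P : Prop) : bool :=
  if excluded_middle_informative P then true else false.
Lemma pboolP (P : Prop) : reflect P (pbool P).
Proof. by rewrite /pbool; case: excluded_middle_informative => h; constructor. Qed.

(* A (candidate) fusion system on S is encoded as a predicate
   F : {set gT} -> (gT -> gT) -> Prop, where  F P phi  means that the
   restriction of phi to P is a morphism in Hom_F(P, S).
   Hom_F(P,Q) = { phi | F P phi /\ phi @: P \subset Q }. *)

Section Fusion.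
Variables (gT : finGroupType) (S : {group gT}).
Variable F : {set gT} -> (gT -> gT) -> Prop.

Definition morph_on (P : {set gT}) (phi : gT -> gT) : Prop :=
  {in P &, {morph phi : x y / x * y}}.
Definition inj_on (P : {set gT}) (phi : gT -> gT) : Prop :=
  {in P &, injective phi}.

Definition fusion_system : Prop :=
  [/\
      (forall (P : {set gT}) (phi : gT -> gT), F P phi ->
         [/\ group_set P, P \subset S, morph_on P phi,
             inj_on P phi & phi @: P \subset S]),
      (forall (P : {set gT}) (phi psi : gT -> gT), {in P, phi =1 psi} -> F P phi -> F P psi),
      (forall (P : {group gT}) g, P \subset S -> g \in S -> F P (fun x => x ^ g))
    & (forall (P : {set gT}) (Q : {group gT}) (phi : gT -> gT), F P phi -> Q \subset P -> F Q phi) /\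
      (forall (P : {set gT}) (phi psi : gT -> gT), F P phi -> F (phi @: P) psi -> F P (psi \o phi)) /\
      (forall (P : {set gT}) (phi : gT -> gT), F P phi ->
         exists psi : gT -> gT, F (phi @: P) psi /\ {in P, forall x, psi (phi x) = x})].

Definition Fconj (P Q : {set gT}) : Prop := exists phi : gT -> gT, F P phi /\ Q = phi @: P.

(* Aut_F(P), Aut_S(P) and Inn(P), as groups of permutations of gT supported on P *)
Definition AutF (P : {set gT}) : {set {perm gT}} :=
  [set a in Aut P | pbool (F P (fun x => a x))].
Definition AutS (P : {set gT}) : {set {perm gT}} :=
  [set a in Aut P | [exists g in 'N_S(P), [forall x in P, a x == x ^ g]]].
Definition Inn (P : {set gT}) : {set {perm gT}} :=
  [set a in Aut P | [exists g in P, [forall x in P, a x == x ^ g]]].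

Definition OutF (P : {set gT}) := (AutF P / Inn P)%g.

Definition fully_normalized (P : {set gT}) : Prop :=
  forall Q : {set gT}, Fconj P Q -> #|'N_S(Q)| <= #|'N_S(P)|.

Definition fully_automized (p : nat) (P : {set gT}) : bool :=
  p.-Sylow(AutF P) (AutS P).

Definition Nphi (P : {set gT}) (phi : gT -> gT) : {set gT} :=
  [set g in 'N_S(P) |
     [exists h in 'N_S(phi @: P), [forall x in P, phi (x ^ g) == phi x ^ h]]].

Definition receptive (Q : {set gT}) : Prop :=
  forall (P : {set gT}) (phi : gT -> gT), F P phi -> phi @: P = Q ->
    exists phibar : gT -> gT, F (Nphi P phi) phibar /\ {in P, phibar =1 phi}.

(* Saturation (Aschbacher-Kessar-Oliver, Def. I.2.2): every subgroup of S is
   F-conjugate to a fully automized, receptive subgroup. *)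
Definition saturated (p : nat) : Prop :=
  fusion_system /\
  forall P : {group gT}, P \subset S ->
    exists Q : {set gT}, Fconj P Q /\ fully_automized p Q /\ receptive Q.

End Fusion.

Definition strongly_p_embedded (p : nat) (aT : finGroupType) (H G : {set aT}) : bool :=
  [&& H \proper G, p %| #|H| &
      [forall x in G :\: H, ~~ (p %| #|H :&: H :^ x|)]].

Definition has_strongly_p_embedded (p : nat) (aT : finGroupType) (G : {set aT}) : Prop :=
  exists H : {group aT}, strongly_p_embedded p H G.

Section Essential.
Variables (gT : finGroupType) (S : {group gT}).
Variable F : {set gT} -> (gT -> gT) -> Prop.

Definition essential (p : nat) (E : {group gT}) : Prop :=
  [/\ E \subset S,
      (forall P : {set gT}, Fconj F E P -> 'C_S(P) \subset P),
      fully_normalized S F E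
    & has_strongly_p_embedded p (OutF F E)].

Definition F_characteristic (E : {set gT}) : Prop :=
  forall a, a \in AutF F S -> [set a x | x in E] = E.

Definition normalized_by_AutF (P T : {set gT}) : Prop :=
  forall a, a \in AutF F P -> [set a x | x in T] \subset T.

Definition core_pred (E1 E2 T : {set gT}) : Prop :=
  [/\ T \subset E1 :&: E2, normalized_by_AutF E1 T,
      normalized_by_AutF E2 T & normalized_by_AutF S T].

Definition is_core (E1 E2 : {set gT}) (T : {group gT}) : Prop :=
  core_pred E1 E2 T /\
  forall T' : {group gT}, core_pred E1 E2 T' -> T' \subset T.
End Essential.

Definition sectional_rank (gT : finGroupType) (S : {group gT}) (k : nat) : Prop :=
  (forall H : {group gT}, H \subset S -> 'm(H) <= k) /\
  (exists H : {group gT}, H \subset S /\ 'm(H) = k).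

(* The symplectic group Sp_4(p) with respect to the standard form
   J = [[0, I_2], [-I_2, 0]]. *)
Definition Jform (p : nat) : 'M['F_p]_4 :=
  \matrix_(i < 4, j < 4)
    (if j == (i + 2)%N :> nat then 1 else if i == (j + 2)%N :> nat then -1 else 0)%R.

Definition Sp4 (p : nat) : {set {'GL_4['F_p]}} :=
  [set g : {'GL_4['F_p]} | (GLval g *m Jform p *m (GLval g)^T == Jform p)%R].

(* Main.v *)
Require Import Defs.
From HB Require Import structures.
From mathcomp Require Import all_boot all_order all_algebra all_fingroup all_solvable.
From mathcomp Require Import mxabelem finfield zify ring.
Set Implicit Arguments. Unset Strict Implicit. Unset Printing Implicit Defensive.

(** Since [E] is F-characteristic, saturation makes [Aut_S(E)] a Sylow subgroup of [Aut_F(E)] and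
lets every element normalising it extend to [S].  The rank bound gives [|E : Phi(E)| <= p ^ 3], and
the strongly embedded subgroup forces [|S : E| = p]: two transvections in different blocks generate
a copy of SL_2, whose central involution splits [E / Phi(E)] and lifts to an automorphism [t] of [S]
acting by signs; without transvections [E / Phi(E)] is irreducible and [S] is uniserial on it.
Hence [S = E1 E2], with [D] the intersection of [E1] and [E2].  Comparing the signs of [t] on both
sides of a commutator [[x, y]] with [x] in [E1] and [y] in [E2] determines, for each pair of types,
how [Phi(E1)] and [Phi(E2)] interact: either the core has index [p ^ 3] and the quotient is
extraspecial of exponent [p], or the core is [Phi(E2)] and the quotient is [C_p^3] extended by a
Jordan block of size three, which is also the structure of a Sylow subgroup of [Sp_4(p)], or there
is a contradiction.  When both sides are irreducible of rank three, the contradiction comes from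
the lower exponent-[p] central series: it identifies [Phi(Ei)] with the elements of [Ei] of
order dividing a fixed power of [p], which makes [Phi(E1)] and [Phi(E2)] comparable. *)

(** * p-groups *)

(** No list of linear groups with a strongly [p]-embedded subgroup is used. Conjugates of such a
    subgroup, called blocks, partition the elements of order [p] modulo inner automorphisms, and
    commuting elements share a block. Two transvections in different blocks give [p + 1]
    transvections in distinct blocks, one for each line of the plane they span. Any further
    transvection is linked to some of these and has to respect that plane, which is therefore
    invariant; this is where the splitting comes from. The involution found on [E / Phi(E)] is a
    priori local to one essential subgroup. Its commutators with [Aut_S(E)] are inner, so it
    normalises [Aut_S(E)] and can be lifted to [S], where it acts on both essential subgroups at
    once. As [p] is odd, no nontrivial section is both centralised and inverted by the lift. Two
    irreducible sides offer no such lift, which is why power maps replace signs there. The rank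
    bound is then needed for [D] and for the Frattini subgroups [Phi(Ei)], not only for the
    essential subgroups themselves. *)

Section PGroupSections.
Local Open Scope group_scope.
Variables (p : nat) (gT : finGroupType).
Hypothesis p_pr : prime p.
Implicit Types S A B E K X Y : {group gT}.

Lemma pgroup_indexP A B : p.-group B -> A \subset B -> #|B : A| <= p ->
  #|B : A| = 1%N \/ #|B : A| = p.
Proof.
move=> pB sAB; have : p.-nat #|B : A| by apply: pnat_dvd (dvdn_indexg _ _) pB.
case/p_natP=> [[|[|k]]] -> h; [by left | by right; rewrite expn1|].
have : p ^ k.+2 <= p ^ 1 by rewrite expn1.
by rewrite leq_exp2l ?prime_gt1.
Qed.

Lemma pgroup_index_gt A B : p.-group B -> A \proper B -> p <= #|B : A|.
Proof.
move=> pB /andP[sAB nBA]; rewrite leqNgt; apply: contra nBA => lt.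
have [e|e] := pgroup_indexP pB sAB (ltnW lt).
  by rewrite -indexg_eq1 e.
by rewrite e ltnn in lt.
Qed.

(** A factor of order at most [p] between normal subgroups of a [p]-group is central. Most
    commutator bounds below are instances. *)
Lemma pgroup_comm_index S A B : p.-group S -> A <| S -> B <| S -> A \subset B ->
  #|B : A| <= p -> [~: B, S] \subset A.
Proof.
move=> pS /andP[sAS nAS] /andP[sBS nBS] sAB iBA.
have nAB := subset_trans sBS nAS.
rewrite -quotient_cents2 //; apply/commG1P.
have [e|] := eqVneq (B / A) 1; first by rewrite e comm1G.
move=> BA1; have pSA : p.-group (S / A) by apply: quotient_pgroup.
have := nil_comm_properl (pgroup_nil pSA) (quotientS A sBS) BA1 (A := S / A).
rewrite subsetI subxx quotient_norms // => /(_ isT).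
move=> pR; apply: card1_trivg.
have [e|e] := pgroup_indexP (pgroupS sBS pS) sAB iBA.
  by case/eqP: BA1; apply: card1_trivg; rewrite card_quotient.
have := cardSg (proper_sub pR); have := proper_card pR; rewrite /= card_quotient // e.
by case/primeP: p_pr => _ pp lt /pp /orP[/eqP // | /eqP ep]; rewrite ep ltnn in lt.
Qed.

Lemma pgroup_flag S A B r n : p.-group S -> A <| S -> B <| S -> A \subset B ->
  #|B : A| = (p ^ n)%N -> r <= n ->
  exists Q : {group gT}, [/\ Q <| S, A \subset Q, Q \subset B & #|Q : A| = (p ^ r)%N].
Proof.
move=> pS nAS nBS sAB iBA le_rn; have [sAS nA] := andP nAS; have [sBS nB] := andP nBS.
have [|||Qb [sQB nQS cQ]] := @normal_pgroup p _ r (S / A)%G (B / A)%G.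
- exact: quotient_pgroup.
- exact: quotient_normal.
- by rewrite /= card_quotient ?(subset_trans sBS) // iBA pfactorK.
have [Q defQ sAQ nQ] := inv_quotientN nAS nQS.
exists Q; split=> //.
  rewrite -(quotientSGK _ sAB) ?(subset_trans (normal_sub nQ)) //.
  by move: sQB; rewrite /= defQ.
by rewrite -card_quotient ?(subset_trans (normal_sub nQ)) // -cQ defQ.
Qed.

(** For [e] in [E] outside [X2], all commutators [[e, s]] lie in [X2], so [e] has at most [p]
    conjugates modulo [X1]. Its centraliser modulo [X1] also centralises [X2 / X1], hence all of
    [E / X1], and so lies in [K]. *)
Lemma index_centralizer_p2 S K E X2 X1 : p.-group S -> K \subset S -> X1 \subset K ->
  E <| S -> X2 <| S -> X1 <| S -> X1 \subset X2 -> X2 \subset E ->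
  #|E : X2| = p -> #|X2 : X1| = p ->
  (forall s, s \in S -> {in E, forall e, [~ e, s] \in X1} -> s \in K) ->
  #|S : K| <= p.
Proof.
move=> pS sKS s1K nES n2S n1S s12 s2E iE2 i21 hE.
have [sES nE] := andP nES; have [s2S n2] := andP n2S; have [s1S n1] := andP n1S.
have s1E := subset_trans s12 s2E.
have [e Ee n2e] : exists2 e, e \in E & e \notin X2.
  apply/subsetPn; rewrite -indexg_eq1 iE2.
  by apply: contraTneq p_pr => ->.
have Se := subsetP sES _ Ee; have n1e := subsetP n1 _ Se.
pose eb := coset X1 e.
have iC : #|S / X1 : 'C_(S / X1)[eb]| <= p.
  rewrite index_cent1 -i21 -card_quotient ?(subset_trans s2S) //.
  rewrite -(card_lcoset (X2 / X1) eb); apply: subset_leq_card.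
  apply/subsetP=> _ /imsetP[_ /morphimP[s n1s Ss ->] ->].
  have eR : e ^ s = e * [~ e, s] by rewrite commgEl mulKVg.
  have X2R : [~ e, s] \in X2.
    apply: (subsetP (pgroup_comm_index pS n2S nES s2E _)); first by rewrite iE2.
    by rewrite mem_commg.
  rewrite -morphJ // eR morphM // ?(subsetP n1) ?(subsetP s2S) //.
  by rewrite mem_lcoset mulKg mem_quotient.
have sCE : 'C_(S / X1)[eb] \subset K / X1.
  apply/subsetP=> _ /setIP[/morphimP[s n1s Ss ->] /cent1P ces].
  apply: mem_quotient; apply: hE => // x Ex.
  have sX2R : [~: X2, S] \subset X1 by apply: pgroup_comm_index; rewrite ?i21.
  have n1x : x \in 'N(X1) by rewrite (subsetP n1) ?(subsetP sES).
  have defE : <<[set e]>> <*> X2 = E.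
    have sE' : <[e]> <*> X2 \subset E by rewrite join_subG cycle_subG Ee.
    apply/eqP; rewrite eqEsubset sE' /=.
    have := Lagrange_index sE' (joing_subr <[e]> X2); rewrite iE2 => pE.
    have: #|E : <[e]> <*> X2| %| p by rewrite -pE dvdn_mulr.
    case/primeP: p_pr => _ pp /pp /orP[|/eqP ep]; first by rewrite indexg_eq1.
    move: pE; rewrite ep => /eqP; rewrite -{2}[p]muln1 eqn_pmul2l ?prime_gt0 //.
    rewrite indexg_eq1 join_subG cycle_subG => /andP[X2e _].
    by rewrite X2e in n2e.
  have : coset X1 x \in 'C[coset X1 s].
    have : E / X1 \subset 'C[coset X1 s].
      rewrite -defE quotientY ?cycle_subG ?(subset_trans s2S) // join_subG.
      rewrite quotient_gen ?sub1set // gen_subG quotient_set1 // sub1set.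
      rewrite (sameP cent1P commgP) (sameP commgP cent1P) cent1C; apply/andP; split.
        exact/cent1P.
      apply/subsetP=> _ /morphimP[y n1y X2y ->].
      have /coset_id : [~ y, s] \in X1 by rewrite (subsetP sX2R) // mem_commg.
      by rewrite morphR //= => /eqP/commgP cys; apply/cent1P; apply: commute_sym.
    by move/subsetP; apply; rewrite mem_quotient.
  by move/cent1P/commgP; rewrite -morphR // => /eqP/coset_idr; apply; rewrite groupR.
have: #|S / X1 : K / X1| <= p.
  apply: leq_trans iC; rewrite -(Lagrange_index _ sCE) ?quotientS //.
  by rewrite leq_pmulr // indexg_gt0.
rewrite index_quotient_eq //.
by apply: subset_trans s1K; apply: subsetIr.
Qed.

Lemma prime_index_gen A B x y : A <| B -> #|B : A| = p ->
  x \in B -> x \notin A -> y \in B -> exists k, y * x ^- k \in A.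
Proof.
move=> nAB iBA Bx nAx By; have [sAB nA] := andP nAB.
have Nx := subsetP nA _ Bx; have Ny := subsetP nA _ By.
have oq : #|B / A| = p by rewrite card_quotient.
have defq : <[coset A x]> = B / A.
  apply/eqP; rewrite eqEcard cycle_subG mem_quotient //= oq -orderE.
  have : #[coset A x] %| p by rewrite -oq order_dvdG ?mem_quotient.
  case/primeP: p_pr => _ pp /pp /orP[|/eqP->//]; rewrite order_eq1 => /eqP/coset_idr.
  by move=> /(_ Nx) Ax; rewrite Ax in nAx.
have : coset A y \in <[coset A x]> by rewrite defq mem_quotient.
case/cycleP=> k yk; exists k; apply: coset_idr; first by rewrite groupM ?groupV ?groupX.
by rewrite morphM ?groupV ?groupX // morphV ?groupX // morphX //= yk mulgV.
Qed.

Lemma abelem_over_Phi E X Y : p.-group E -> X \subset E -> Y <| X ->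
  'Phi(E) \subset Y -> p.-abelem (X / Y).
Proof.
move=> pE sXE nYX sPY; have pX := pgroupS sXE pE; have nY := normal_norm nYX.
rewrite -trivg_Phi ?quotient_pgroup // -(quotient_Phi pX nY) -subG1 quotient_sub1.
  exact: subset_trans (PhiS pE sXE) sPY.
by apply: subset_trans (Phi_sub X) nY.
Qed.

End PGroupSections.

(** * Transvections *)

Section RankOne.
Import GRing.Theory.
Local Open Scope ring_scope.
Variables (K : fieldType) (n : nat).
Implicit Types (f g : 'cV[K]_n) (q r : 'rV[K]_n).

(** Matrices act on row vectors from the right, so [1 + f *m q] sends [v] to [v + dot v f *: q]: the
    row [q] spans the centre of a transvection and the column [f] is the functional whose kernel is
    its axis. *)
Definition dot q f : K := (q *m f) 0 0.

Lemma dotE q f : q *m f = (dot q f)%:M.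
Proof. exact: mx11_scalar. Qed.

Lemma dotDl q r f : dot (q + r) f = dot q f + dot r f.
Proof. by rewrite /dot mulmxDl mxE. Qed.
Lemma dotDr q f g : dot q (f + g) = dot q f + dot q g.
Proof. by rewrite /dot mulmxDr mxE. Qed.
Lemma dotZl a q f : dot (a *: q) f = a * dot q f.
Proof. by rewrite /dot -scalemxAl mxE. Qed.
Lemma dotZr a q f : dot q (a *: f) = a * dot q f.
Proof. by rewrite /dot -scalemxAr mxE. Qed.
Lemma dotA q f (M : 'M_n) : dot (q *m M) f = dot q (M *m f).
Proof. by rewrite /dot mulmxA. Qed.

Lemma row_rank1 v f q : v *m (f *m q) = dot v f *: q.
Proof. by rewrite mulmxA dotE mul_scalar_mx. Qed.
Lemma rank1_col f q g : f *m q *m g = dot q g *: f.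
Proof. by rewrite -mulmxA dotE mul_mx_scalar. Qed.
Lemma mul_rank1 f q g r : f *m q *m (g *m r) = dot q g *: (f *m r).
Proof. by rewrite mulmxA rank1_col scalemxAl. Qed.

Lemma rank1_neq0 f q : f != 0 -> q != 0 -> f *m q != 0.
Proof.
move=> f0 q0; apply: contraNneq f0 => fq0; apply/eqP.
have /rV0Pn[j qj] := q0; apply/colP=> i.
have := congr1 (fun M : 'M_n => M i j) fq0; rewrite !mxE big_ord1 => /eqP.
by rewrite mulf_eq0 (negPf qj) orbF => /eqP.
Qed.

Lemma exp_transvection f q k :
  dot q f = 0 -> iter k (mulmx (1%:M + f *m q)) 1%:M = 1%:M + k%:R *: (f *m q).
Proof.
move=> qf0; elim: k => [|k IH] /=; first by rewrite scale0r addr0.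
rewrite {}IH mulmxDl mul1mx mulmxDr mulmx1 -scalemxAr mul_rank1 qf0 scale0r.
by rewrite scaler0 addr0 -addrA -{2}[f *m q]scale1r -scalerDl -natr1.
Qed.

Lemma rank1_factor (M : 'M[K]_n) : (\rank M <= 1)%N ->
  exists (d : 'cV[K]_n) (c : 'rV[K]_n), M = d *m c.
Proof.
move: (col_base M) (row_base M) (mulmx_base M); case: (\rank M) => [|[|//]] C R CR _.
  by exists 0, 0; rewrite -CR (flatmx0 R) !mulmx0.
by exists C, R.
Qed.

Section Opposite.
Variables (f f' : 'cV[K]_n) (q q' : 'rV[K]_n).
Hypotheses (qf : dot q f = 0) (qf' : dot q' f' = 0).
Hypotheses (a0 : dot q f' != 0) (b0 : dot q' f != 0).

(** The projection onto the plane of [q] and [q'] along the common kernel of [f] and [f']. Since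
    [dot q f] and [dot q' f'] vanish, the rescaled functionals [f'] and [f] are the coordinates dual
    to [q] and [q']. *)
Definition opp_proj : 'M[K]_n :=
  (dot q f')^-1 *: (f' *m q) + (dot q' f)^-1 *: (f *m q').
Local Notation P := opp_proj.

Lemma row_opp_proj v :
  v *m P = ((dot q f')^-1 * dot v f') *: q + ((dot q' f)^-1 * dot v f) *: q'.
Proof. by rewrite mulmxDr -!scalemxAr !row_rank1 !scalerA. Qed.

Lemma opp_proj_col g :
  P *m g = ((dot q f')^-1 * dot q g) *: f' + ((dot q' f)^-1 * dot q' g) *: f.
Proof. by rewrite mulmxDl -!scalemxAl !rank1_col !scalerA. Qed.

Lemma opp_proj_q : q *m P = q.
Proof. by rewrite row_opp_proj qf mulr0 scale0r addr0 mulVf // scale1r. Qed.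
Lemma opp_proj_q' : q' *m P = q'.
Proof. by rewrite row_opp_proj qf' mulr0 scale0r add0r mulVf // scale1r. Qed.
Lemma opp_proj_f : P *m f = f.
Proof. by rewrite opp_proj_col qf mulr0 scale0r add0r mulVf // scale1r. Qed.
Lemma opp_proj_f' : P *m f' = f'.
Proof. by rewrite opp_proj_col qf' mulr0 scale0r addr0 mulVf // scale1r. Qed.

Lemma opp_proj_idem : P *m P = P.
Proof.
by rewrite {1}/opp_proj mulmxDl -!scalemxAl -!mulmxA opp_proj_q opp_proj_q'.
Qed.

(* The standard word of SL_2 squares to -1 on the plane spanned by q and q'. *)
Lemma opp_involution :
  let u := 1%:M + (dot q' f)^-1 *: (f *m q) in
  let v := 1%:M - (dot q f')^-1 *: (f' *m q') in
  (u *m v *m u) *m (u *m v *m u) = 1%:M - P *+ 2.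
Proof.
move=> u v.
pose N := (dot q' f)^-1 *: (f *m q) - (dot q f')^-1 *: (f' *m q').
have uvu : u *m v *m u = (1%:M - P) + N.
  rewrite /u /v !(mulmxDl, mulmxDr, mulmxN, mulNmx, mul1mx, mulmx1).
  rewrite -?(scalemxAl, scalemxAr) !scalerA ?mul_rank1.
  rewrite -!scalemxAl !mul_rank1 qf /N /opp_proj.
  move: (f *m q) (f' *m q') (f *m q') (f' *m q) => X Y Z W.
  by apply/matrixP=> i j; rewrite !mxE; field; rewrite a0 b0.
have NP : N *m P = N.
  by rewrite /N mulmxBl -!scalemxAl -!mulmxA opp_proj_q opp_proj_q'.
have PN : P *m N = N.
  by rewrite /N mulmxBr -!scalemxAr !mulmxA opp_proj_f opp_proj_f'.
have NN : N *m N = - P.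
  rewrite {1}/N mulmxBl !mulmxBr -?(scalemxAl, scalemxAr) !mul_rank1 qf qf'.
  rewrite /opp_proj; move: (f *m q) (f' *m q') (f *m q') (f' *m q) => X Y Z W.
  by apply/matrixP=> i j; rewrite !mxE; field; rewrite a0 b0.
rewrite {}uvu; move: NP PN NN opp_proj_idem; move: N P => M Q MQ QM MM QQ.
rewrite !(mulmxDl, mulmxDr, mulmxN, mulNmx, mul1mx, mulmx1) MQ QM MM QQ.
by apply/matrixP=> i j; rewrite !mxE; ring.
Qed.

(** The rows [q] and [q'] are independent because [f'] and [f] separate them, so the idempotent has
    rank at least two. *)
Lemma opp_proj_corank : (n <= 3)%N -> (\rank (1%:M - P)%R <= 1)%N.
Proof.
move=> n3; have fr : row_free (col_mx q q').
  apply: inj_row_free => v; rewrite -[v]hsubmxK mul_row_col.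
  rewrite [lsubmx v]mx11_scalar [rsubmx v]mx11_scalar !mul_scalar_mx.
  move: (lsubmx v 0 0) (rsubmx v 0 0) => x y e.
  have /eqP := congr1 (dot^~ f') e; rewrite dotDl !dotZl qf' mulr0 addr0.
  rewrite {2}/dot mul0mx mxE mulf_eq0 (negPf a0) orbF => /eqP x0.
  have /eqP := congr1 (dot^~ f) e; rewrite dotDl !dotZl qf mulr0 add0r.
  rewrite {2}/dot mul0mx mxE mulf_eq0 (negPf b0) orbF => /eqP y0.
  by rewrite x0 y0 !raddf0 row_mx0.
have P2 : (2 <= \rank P)%N.
  apply: (@leq_trans (\rank (col_mx q q'))); first by move/eqP: fr => ->.
  apply: mxrankS; have -> : col_mx q q' = col_mx q q' *m P.
    by rewrite mul_col_mx opp_proj_q opp_proj_q'.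
  exact: submxMl.
have : (\rank (1%:M - P)%R + \rank P <= n)%N.
  by apply: mulmx0_rank_max; rewrite mulmxBl mul1mx opp_proj_idem subrr.
move=> /leq_trans/(_ n3); rewrite -ltnS => h.
by rewrite -ltnS -(ltn_add2r 2); apply: leq_ltn_trans h; rewrite leq_add2l.
Qed.

End Opposite.

(** Conjugating the first transvection by a power of the second shears its column and row in this
    way. The span of the rows and the span of the columns do not change, and they determine the
    projection. *)
Lemma opp_proj_shear f f' q q' k : dot q' f' = 0 -> dot q f' != 0 -> dot q' f != 0 ->
  opp_proj (f - (k * dot q' f) *: f') f' (q + (k * dot q f') *: q') q' =
  opp_proj f f' q q'.
Proof.
move=> qf' a0 b0; rewrite /opp_proj !dotDl !dotDr -scaleNr !dotZl !dotZr qf' !mulr0 !addr0.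
rewrite mulmxDr mulmxDl -scalemxAl -scalemxAr.
move: (f *m q') (f' *m q') (f' *m q) => X Y Z.
by apply/matrixP=> i j; rewrite !mxE; field; rewrite a0 b0.
Qed.

Lemma shear_dot_row f f' q' r : dot q' f != 0 -> dot r f' != 0 ->
  dot r (f - (dot r f / (dot q' f * dot r f') * dot q' f) *: f') = 0.
Proof.
move=> b0 e; rewrite dotDr -scaleNr dotZr.
by move: (dot r f) (dot r f') (dot q' f) e b0 => x y z y0 z0; field; rewrite y0 z0.
Qed.

Lemma shear_dot_col f' q q' g : dot q f' != 0 -> dot q' g != 0 ->
  dot (q + (- dot q g / (dot q f' * dot q' g) * dot q f') *: q') g = 0.
Proof.
move=> a0 e; rewrite dotDl dotZl.
by move: (dot q g) (dot q' g) (dot q f') e a0 => x y z y0 z0; field; rewrite y0 z0.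
Qed.

End RankOne.

(** * Blocks: the conjugates of a strongly embedded subgroup *)

Section Blocks.
Import GRing.Theory.
Local Open Scope group_scope.
Variables (p : nat) (aT : finGroupType) (A H : {group aT}) (n : nat).
Variable rho : aT -> 'M['F_p]_n.
Hypothesis p_pr : prime p.
Hypothesis rhoM : {in A &, forall x y, rho (x * y) = (rho x *m rho y)%R}.
Hypothesis rho1 : rho 1 = 1%:M%R.
Hypothesis sHA : H \subset A.
Hypothesis pHA : H \proper A.
Hypothesis kerH : {in A, forall x, rho x = 1%:M%R -> x \in H}.
Hypothesis embedded : forall x y, x \in H -> y \in A -> rho (x ^+ p) = 1%:M%R ->
  rho x <> 1%:M%R -> x ^ y \in H -> y \in H.
Hypothesis covered : forall x, x \in A -> rho (x ^+ p) = 1%:M%R ->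
  rho x <> 1%:M%R -> exists2 h, h \in A & x \in H :^ h.

(** The image under [rho] has order exactly [p]. Everything is read through [rho] so that a kernel
    is allowed; in the application to [E / Phi(E)] it is [Inn(E)]. *)
Definition punip x := [/\ x \in A, rho (x ^+ p) = 1%:M%R & rho x <> 1%:M%R].

Lemma rhoV x : x \in A -> (rho x *m rho x^-1 = 1%:M)%R.
Proof. by move=> Ax; rewrite -rhoM ?groupV // mulgV. Qed.
Lemma rhoVl x : x \in A -> (rho x^-1 *m rho x = 1%:M)%R.
Proof. by move=> Ax; rewrite -rhoM ?groupV // mulVg. Qed.

Lemma rhoX x k : x \in A -> rho (x ^+ k) = iter k (mulmx (rho x)) 1%:M%R.
Proof.
by move=> Ax; elim: k => [|k IH] //=; rewrite expgS rhoM ?groupX ?IH.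
Qed.

Lemma rhoJ x y : x \in A -> y \in A ->
  rho (x ^ y) = (rho y^-1 *m rho x *m rho y)%R.
Proof. by move=> Ax Ay; rewrite conjgE !rhoM ?groupM ?groupV // mulmxA. Qed.

Lemma rhoJ1 x y : x \in A -> y \in A -> rho x = 1%:M%R -> rho (x ^ y) = 1%:M%R.
Proof. by move=> Ax Ay x1; rewrite rhoJ // x1 mulmx1 rhoVl. Qed.

Lemma punipJ x y : punip x -> y \in A -> punip (x ^ y).
Proof.
case=> Ax xp x1 Ay; split; first by rewrite groupJ.
  by rewrite -conjXg rhoJ1 ?groupX.
move=> xy1; case: x1; rewrite -(conjgK y x).
by rewrite (rhoJ1 _ _ xy1) ?groupJ ?groupV.
Qed.

Lemma block_conj x y h : punip x -> h \in A -> y \in A ->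
  x \in H :^ h -> x ^ y \in H :^ h -> y \in H :^ h.
Proof.
move=> ux Ah Ay; rewrite !mem_conjg => Hx Hxy.
have [Axh xp x1] : punip (x ^ h^-1) by apply: punipJ; rewrite ?groupV.
apply: (embedded Hx) => //; first by rewrite groupJ ?groupV.
by rewrite -conjJg.
Qed.

(** Both [x] and its conjugate by [h^-1 * k] lie in [H :^ k], so strong embedding puts the
    conjugating element there too. Blocks thus partition the elements satisfying [punip]. *)
Lemma block_uniq x h k : punip x -> h \in A -> k \in A ->
  x \in H :^ h -> x \in H :^ k -> H :^ h = H :^ k.
Proof.
move=> ux Ah Ak xh xk; have Ahk : h^-1 * k \in A by rewrite groupM ?groupV.
have xhk : x ^ (h^-1 * k) \in H :^ k.
  by rewrite conjgM memJ_conjg -mem_conjg.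
have ux' : punip (x ^ (h^-1 * k)) by apply: punipJ.
have Ahk' : (h^-1 * k)^-1 \in A by rewrite groupV.
have := block_conj ux' Ak Ahk' xhk; rewrite conjgK => /(_ xk).
rewrite groupV mem_conjg conjgE invgK !mulgA mulgK => Hkh.
have ->: H :^ k = H :^ (k * h^-1 * h) by rewrite mulgKV.
by rewrite conjsgM (conjGid Hkh).
Qed.

Definition same_block x y := exists h, [/\ h \in A, x \in H :^ h & y \in H :^ h].

Lemma block_trans x y h : punip x -> h \in A -> x \in H :^ h ->
  same_block x y -> y \in H :^ h.
Proof.
move=> ux Ah xh [k [Ak xk yk]]; by rewrite (block_uniq ux Ah Ak xh xk).
Qed.

Lemma same_block_sym x y : same_block x y -> same_block y x.
Proof. by case=> h [Ah xh yh]; exists h. Qed.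

Lemma same_block_trans y x z : punip y ->
  same_block x y -> same_block y z -> same_block x z.
Proof.
move=> uy [h [Ah xh yh]] yz; exists h; split=> //; exact: block_trans yz.
Qed.

Lemma same_block_conj x y : punip x -> y \in A ->
  same_block x (x ^ y) -> same_block x y.
Proof.
by move=> ux Ay [h [Ah xh xyh]]; exists h; split=> //; apply: block_conj xyh.
Qed.

(** [x ^ y] differs from [x] by an element of the kernel of [rho], which lies in every conjugate of
    [H]; strong embedding then puts [y] in the block of [x]. *)
Lemma same_block_commute x y : punip x -> y \in A ->
  (rho x *m rho y = rho y *m rho x)%R -> same_block x y.
Proof.
move=> ux Ay cxy; apply: same_block_conj => //.
have [Ax xp x1] := ux; have [h Ah xh] := covered Ax xp x1; exists h; split=> //.
have ->: x ^ y = x * [~ x, y] by rewrite commgEl mulKVg.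
rewrite groupM //= mem_conjg kerH ?groupJ ?groupR ?groupV //.
have AR : [~ x, y] \in A by rewrite groupR.
rewrite rhoJ1 ?groupV // commgEl rhoM ?groupJ ?groupV // rhoJ //.
by rewrite -(mulmxA (rho y^-1)) cxy (mulmxA (rho y^-1)) rhoVl // mul1mx rhoVl.
Qed.

Local Open Scope ring_scope.

Definition tv x (f : 'cV['F_p]_n) (q : 'rV['F_p]_n) :=
  [/\ x \in A, rho x = 1%:M + f *m q, dot q f = 0, f != 0 & q != 0].

Lemma tvX x f q k : tv x f q -> rho (x ^+ k)%g = 1%:M + k%:R *: (f *m q).
Proof. by case=> Ax xE qf _ _; rewrite rhoX // xE exp_transvection. Qed.

Lemma tv_punip x f q : tv x f q -> punip x.
Proof.
move=> tx; have [Ax xE qf f0 q0] := tx; split=> //.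
  by rewrite (tvX _ tx) pchar_Fp_0 ?scale0r ?addr0.
rewrite xE => /eqP; rewrite -subr_eq0 addrC addKr => /eqP fq.
by have := rank1_neq0 f0 q0; rewrite fq eqxx.
Qed.

Lemma tvJ x y f q : tv x f q -> y \in A ->
  tv (x ^ y)%g (rho y^-1%g *m f) (q *m rho y).
Proof.
move=> [Ax xE qf f0 q0] Ay; split; first by rewrite groupJ.
- by rewrite rhoJ // xE mulmxDr mulmx1 mulmxDl rhoVl // !mulmxA.
- by rewrite dotA mulmxA rhoV // mul1mx.
- by apply: contraNneq f0 => f0; rewrite -[f]mul1mx -(rhoV Ay) -mulmxA f0 mulmx0.
- by apply: contraNneq q0 => q0; rewrite -[q]mulmx1 -(rhoV Ay) mulmxA q0 mul0mx.
Qed.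

(* Non-opposite transvections lie in a common block: they commute, or their
   commutator is a transvection which commutes with both. *)
Lemma tv_same_half x y f q g r : tv x f q -> tv y g r -> dot q g = 0 ->
  same_block x y.
Proof.
move=> tx ty qg; have [Ax xE qf f0 q0] := tx; have [Ay yE rg g0 r0] := ty.
have ux := tv_punip tx; have uy := tv_punip ty.
have xyE : rho x *m rho y = 1%:M + f *m q + g *m r.
  rewrite xE yE mulmxDl mul1mx mulmxDr mulmx1 mul_rank1 qg scale0r addr0.
  by rewrite addrAC.
have yxE : rho y *m rho x = 1%:M + f *m q + g *m r + dot r f *: (g *m q).
  rewrite xE yE mulmxDl mul1mx mulmxDr mulmx1 mul_rank1.
  by rewrite addrA.
have [rf|rf] := eqVneq (dot r f) 0.
  by apply: same_block_commute => //; rewrite xyE yxE rf scale0r addr0.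
pose c := (y * x * (x * y)^-1)%g.
have Ac : c \in A by rewrite !(groupM, groupV).
have cE : rho c = 1%:M + (dot r f *: g) *m q.
  have -> : rho c = rho c *m (rho (x * y)%g *m rho (x * y)^-1%g).
    by rewrite rhoV ?mulmx1 // groupM.
  have -> : rho c *m (rho (x * y)%g *m rho (x * y)^-1%g) =
            rho (y * x)%g *m rho (x * y)^-1%g.
    by rewrite mulmxA -(rhoM Ac) ?groupM // /c mulgKV.
  rewrite (rhoM Ay Ax) yxE.
  suff -> : 1%:M + f *m q + g *m r + dot r f *: (g *m q) =
            (1%:M + (dot r f *: g) *m q) *m rho (x * y)%g.
    by rewrite -mulmxA rhoV ?mulmx1 // groupM.
  rewrite rhoM // xyE mulmxDl mul1mx -!scalemxAl !mulmxDr mulmx1 !mul_rank1.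
  by rewrite qf qg !scale0r !addr0.
have tc : tv c (dot r f *: g) q.
  by split=> //; rewrite ?dotZr ?qg ?mulr0 // scaler_eq0 negb_or rf.
have uc := tv_punip tc.
have xc : same_block x c.
  apply: same_block_commute => //; rewrite xE cE !mulmxDl !mulmxDr !mul1mx !mulmx1.
  by rewrite !mul_rank1 !dotZr qg qf mulr0 !scale0r !addr0 addrAC.
have cy : same_block c y.
  apply: same_block_commute => //; rewrite yE cE !mulmxDl !mulmxDr !mul1mx !mulmx1.
  by rewrite !mul_rank1 !dotZr qg rg mulr0 !scale0r !addr0 addrAC.
exact: same_block_trans xc cy.
Qed.

Lemma tv_same x y f q g r : tv x f q -> tv y g r ->
  dot q g = 0 \/ dot r f = 0 -> same_block x y.
Proof.
move=> tx ty [qg|rf]; first exact: (tv_same_half tx ty qg).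
by apply: same_block_sym; exact: (tv_same_half ty tx rf).
Qed.

Lemma natr_Fp (a : 'F_p) : exists k, k%:R = a.
Proof. by exists (val a); rewrite natr_Zp. Qed.

Lemma tvX_inv x f q k : tv x f q -> rho (x ^- k)%g = 1%:M - k%:R *: (f *m q).
Proof.
move=> tx; have [Ax xE qf f0 q0] := tx.
have Axk : (x ^+ k)%g \in A by rewrite groupX.
have E : (1%:M - k%:R *: (f *m q)) *m rho (x ^+ k)%g = 1%:M.
  rewrite (tvX _ tx) mulmxDr mulmx1 mulmxDl mul1mx mulNmx -scalemxAl -scalemxAr.
  by rewrite mul_rank1 qf scale0r !scaler0 subr0 subrK.
by rewrite -[LHS]mul1mx -{1}E -mulmxA rhoV // mulmx1.
Qed.

Lemma tv_opp x y f q g r : tv x f q -> tv y g r -> ~ same_block x y ->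
  dot q g != 0 /\ dot r f != 0.
Proof.
move=> tx ty nxy; split; apply/eqP=> e; apply: nxy; apply: tv_same tx ty _.
  by left.
by right.
Qed.

Section Pair.
Variables (t t' : aT) (f f' : 'cV['F_p]_n) (q q' : 'rV['F_p]_n).
Hypotheses (tt : tv t f q) (tt' : tv t' f' q') (ntt' : ~ same_block t t').
Local Notation P := (opp_proj f f' q q').
Variables (d : 'cV['F_p]_n) (c : 'rV['F_p]_n).
Hypothesis corank1 : 1%:M - P = d *m c.

Let a0 : dot q f' != 0. Proof. by case: (tv_opp tt tt' ntt'). Qed.
Let b0 : dot q' f != 0. Proof. by case: (tv_opp tt tt' ntt'). Qed.
Let qf : dot q f = 0. Proof. by case: tt. Qed.
Let qf' : dot q' f' = 0. Proof. by case: tt'. Qed.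

(** If the row or the column of [s] were not fixed by the projection, the product of [s] with a
    suitable power of [t] would be a transvection that is opposite to neither [t] nor [t'], and
    would link their blocks. *)
Lemma tv_commuting s g r : tv s g r -> dot r f = 0 -> dot q g = 0 ->
  r *m P = r /\ P *m g = g.
Proof.
move=> ts rf qg; have [As sE rg g0 r0] := ts; have [At tE _ f0 q0] := tt.
pose al := (dot q f')^-1 * dot r f'.
have rP : r *m P = al *: q by rewrite row_opp_proj // rf mulr0 scale0r addr0.
have rE : r = al *: q + dot r d *: c.
  by rewrite -{1}[r]mulmx1 -[1%:M](subrK P) corank1 addrC mulmxDr row_rank1 rP.
have gE : g = P *m g + dot c g *: d.
  by rewrite -{1}[g]mul1mx -[1%:M](subrK P) corank1 addrC mulmxDl rank1_col.
have cfd h : P *m h = h -> d != 0 -> dot c h = 0.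
  move=> Ph d0; apply/eqP; have := congr1 (fun M => M *m h) corank1.
  rewrite mulmxBl mul1mx Ph subrr rank1_col => /esym/eqP.
  by rewrite scaler_eq0 (negPf d0) orbF.
have Pg : P *m g = ((dot q' f)^-1 * dot q' g) *: f.
  by rewrite opp_proj_col // qg mulr0 scale0r add0r.
have [gac|] := eqVneq (dot r d *: c) 0; last first.
  rewrite scaler_eq0 negb_or => /andP[ga0 c0].
  have d0 : d != 0 by apply: contraNneq ga0 => ->; rewrite /dot mulmx0 mxE.
  have cf : dot c f = 0 by apply: cfd => //; rewrite opp_proj_f.
  have cf' : dot c f' = 0 by apply: cfd => //; rewrite opp_proj_f'.
  have cg : dot c g = 0.
    move: rg; rewrite rE dotDl !dotZl qg mulr0 add0r => /eqP.
    by rewrite mulf_eq0 (negPf ga0) => /eqP.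
  move: gE; rewrite cg scale0r addr0 Pg => gE.
  set mu := _ * _ in gE.
  have mu0 : mu != 0 by apply: contraNneq g0 => mu0; rewrite gE mu0 scale0r.
  (* This exponent cancels the [q] component of the row and leaves a multiple of [c], which is
     orthogonal to both [f] and [f']. *)
  have [k kE] := natr_Fp (- (mu * al)).
  have tx : tv (s * t ^+ k)%g f ((mu * dot r d) *: c).
    split; rewrite ?groupM ?groupX //.
    - rewrite rhoM ?groupX // sE (tvX _ tt) gE kE.
      rewrite mulmxDl mul1mx mulmxDr mulmx1 -!scalemxAl -!scalemxAr mul_rank1 rf.
      rewrite scale0r !scaler0 addr0 -addrA; congr (_ + _).
      have -> : f *m r = al *: (f *m q) + dot r d *: (f *m c).
        by rewrite {1}rE mulmxDr -!scalemxAr.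
      by rewrite scalerDr !scalerA scaleNr addrA addNr add0r.
    - by rewrite dotZl cf mulr0.
    - by rewrite scaler_eq0 mulf_eq0 negb_or negb_or mu0 ga0.
  case: ntt'; apply: (same_block_trans (tv_punip tx)).
    by apply: same_block_sym; apply: tv_same tx tt _; left; rewrite dotZl cf mulr0.
  by apply: tv_same tx tt' _; left; rewrite dotZl cf' mulr0.
have rq : r = al *: q by rewrite rE gac addr0.
rewrite rP -rq; split=> //; apply/eqP/negPn/negP=> nPg.
have al0 : al != 0 by apply: contraNneq r0 => al0; rewrite rq al0 scale0r.
(* This exponent makes the new column [h] orthogonal to [q']; orthogonality to [q] holds for every
   exponent. *)
have [k kE] := natr_Fp (- (al * dot q' g / dot q' f)).
pose h := al *: g + k%:R *: f.
have h0 : h != 0.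
  apply: contraNneq nPg => h0.
  have -> : g = (- (al^-1 * k%:R)) *: f.
    apply: (scalerI al0); rewrite scalerA mulrN mulrA mulfV // mul1r scaleNr.
    by apply/eqP; rewrite -addr_eq0 -/h h0.
  by rewrite -scalemxAr opp_proj_f.
have tx : tv (s * t ^+ k)%g h q.
  split; rewrite ?groupM ?groupX //.
  - rewrite rhoM ?groupX // sE (tvX _ tt) {1}rq.
    rewrite mulmxDl mul1mx mulmxDr mulmx1 -!scalemxAr -scalemxAl mul_rank1 qf.
    by rewrite scale0r !scaler0 addr0 /h mulmxDl -!scalemxAl -addrA [X in _ + X]addrC.
  - by rewrite dotDr !dotZr qg qf !mulr0 addr0.
case: ntt'; apply: (same_block_trans (tv_punip tx)).
  by apply: same_block_sym; apply: tv_same tx tt _; left.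
apply: tv_same tx tt' _; right.
by rewrite dotDr !dotZr kE mulNr mulfVK // subrr.
Qed.

End Pair.

Lemma opp_projC f f' q q' : opp_proj f f' q q' = opp_proj f' f q' q :> 'M['F_p]_n.
Proof. by rewrite /opp_proj addrC. Qed.

(** The conjugates of [t] by the powers [t' ^+ k] with [k < p], together with [t'], lie in [p + 1]
    distinct blocks and define the same projection. The row of [s] is orthogonal to the column of
    one of them, and the column of [s] to the row of one of them. Both share the block of [s], so
    they coincide, and [tv_commuting] applies. *)
Lemma tv_preserve t t' f f' q q' (d : 'cV['F_p]_n) (c : 'rV['F_p]_n) :
  tv t f q -> tv t' f' q' -> ~ same_block t t' ->
  1%:M - opp_proj f f' q q' = d *m c ->
  forall s g r, tv s g r ->
  r *m opp_proj f f' q q' = r /\ opp_proj f f' q q' *m g = g.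
Proof.
move=> tt tt' ntt' corank1 s g r ts.
have [a0 b0] := tv_opp tt tt' ntt'.
have [At tE qf f0 q0] := tt; have [At' tE' qf' f0' q0'] := tt'.
pose fk k : 'cV['F_p]_n := f - (k%:R * dot q' f) *: f'.
pose qk k : 'rV['F_p]_n := q + (k%:R * dot q f') *: q'.
pose tk k := (t ^ (t' ^+ k))%g.
have ttk k : tv (tk k) (fk k) (qk k).
  have := tvJ tt (groupX k At'); rewrite (tvX_inv _ tt') (tvX _ tt').
  rewrite mulmxBl mul1mx -scalemxAl rank1_col scalerA.
  by rewrite mulmxDr mulmx1 -scalemxAr row_rank1 scalerA.
have ux' := tv_punip tt'; have ux := tv_punip tt.
have nttk k : ~ same_block (tk k) t'.
  case=> h [Ah tkh th]; case: ntt'; exists h; split=> //.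
  by rewrite -(conjgK (t' ^+ k)%g t) (@groupJ _ (H :^ h)%G) ?groupV ?groupX.
(* Conjugating back by [t' ^+ k] puts [t] and its conjugate by [t' ^+ j] in one block. Then
   [t' ^+ j] is in that block, and so is [t'], which commutes with it. *)
have nttkm k m : (k < m < p)%N -> ~ same_block (tk k) (tk m).
  move=> /andP[ltkm ltmp] [h [Ah tkh tmh]]; case: ntt'.
  pose j := (m - k)%N.
  have Aj : (t' ^+ j)%g \in A by rewrite groupX.
  have Ahk : (h * t' ^- k)%g \in A by rewrite groupM ?groupV ?groupX.
  have sj : same_block t (t' ^+ j)%g.
    apply: same_block_conj => //; exists (h * t' ^- k)%g; split=> //; rewrite conjsgM.
      by rewrite -(conjgK (t' ^+ k)%g t) memJ_conjg.
    rewrite -(conjgK (t' ^+ k)%g (_ ^ _)%g) memJ_conjg -conjgM -expgD subnK //.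
    exact: ltnW.
  have uj : punip (t' ^+ j)%g.
    split=> //; first by rewrite expgAC; case: ux' => _ t1 _; rewrite rhoX ?groupX // t1; elim: (j) => //= i ->; rewrite mul1mx.
    rewrite (tvX _ tt') => /eqP; rewrite -subr_eq0 addrC addKr scaler_eq0.
    rewrite (negPf (rank1_neq0 f0' q0')) orbF -(dvdn_pcharf (pchar_Fp p_pr)).
    by apply/negP; rewrite gtnNdvd ?subn_gt0 // (leq_ltn_trans _ ltmp) // leq_subr.
  apply: (same_block_trans uj sj); apply: same_block_commute => //.
  by rewrite -!rhoM // -expgS -expgSr.
have Pk k : opp_proj (fk k) f' (qk k) q' = opp_proj f f' q q'.
  exact: opp_proj_shear.
have Fplt (x : 'F_p) : (val x < p)%N.
  by have := ltn_ord x; rewrite [X in (_ < X)%N -> _]Fp_cast.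
have kex : (exists k, (k < p)%N /\ dot r (fk k) = 0) \/ dot r f' = 0.
  have [e|e] := eqVneq (dot r f') 0; first by right.
  left; exists (val (dot r f / (dot q' f * dot r f') : 'F_p)); split=> //.
  by rewrite /fk natr_Zp shear_dot_row.
have mex : (exists m, (m < p)%N /\ dot (qk m) g = 0) \/ dot q' g = 0.
  have [e|e] := eqVneq (dot q' g) 0; first by right.
  left; exists (val (- dot q g / (dot q f' * dot q' g) : 'F_p)); split=> //.
  by rewrite /qk natr_Zp shear_dot_col.
have us := tv_punip ts.
case: kex mex => [[k [kp kE]]|kE] [[m [mp mE]]|mE].
- have sk : same_block (tk k) s by apply: same_block_sym; apply: tv_same ts (ttk k) _; left.
  have sm : same_block s (tk m) by apply: tv_same ts (ttk m) _; right.
  have skm := same_block_trans us sk sm.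
  case: (ltngtP k m) => [ltkm|ltmk|ekm].
  + by case: (nttkm k m); rewrite ?ltkm.
  + by case: (nttkm m k); rewrite ?ltmk //; apply: same_block_sym.
  + rewrite -ekm in mE.
    have ck : 1%:M - opp_proj (fk k) f' (qk k) q' = d *m c by rewrite Pk.
    by have := tv_commuting (ttk k) tt' (nttk k) ck ts kE mE; rewrite Pk.
- case: (nttk k); apply: (same_block_trans us).
    by apply: same_block_sym; apply: tv_same ts (ttk k) _; left.
  by apply: tv_same ts tt' _; right.
- case: (nttk m); apply: (same_block_trans us).
    by apply: same_block_sym; apply: tv_same ts (ttk m) _; right.
  by apply: tv_same ts tt' _; left.
- have cC : 1%:M - opp_proj f' f q' q = d *m c by rewrite opp_projC.
  have nC : ~ same_block t' t by move/same_block_sym.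
  by have := tv_commuting tt' tt nC cC ts kE mE; rewrite opp_projC.
Qed.

(** A block containing every conjugate of [t] would contain all of [A], by strong embedding. *)
Lemma other_block t : punip t -> exists2 h, h \in A & ~ same_block t (t ^ h)%g.
Proof.
move=> ut; have [At tp t1] := ut; have [k Ak tk] := covered At tp t1.
have [x Ax Hx] : exists2 x, x \in A & x \notin H :^ k.
  apply/subsetPn; rewrite proper_subn // properEcard -{1}(conjGid Ak) conjSg sHA.
  by rewrite cardJg proper_card.
exists x => // /(block_trans ut Ak tk) txk.
by case/negP: Hx; apply: block_conj tk txk.
Qed.

(** By [tv_preserve] for the conjugates of [t] and [t'], the projection acts as the identity on both
    sides of each of its conjugates. Comparing [y] with [y^-1] turns this into equality, so the
    plane and its complement are invariant. *)
Lemma transvection_plane t f q : (n <= 3)%N -> tv t f q ->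
  exists t' f' q', [/\ tv t' f' q', dot q f' != 0, dot q' f != 0,
    {in A, forall y, rho y *m opp_proj f f' q q' = opp_proj f f' q q' *m rho y} &
    exists2 z, z \in A & rho z = 1%:M - opp_proj f f' q q' *+ 2].
Proof.
move=> n3 tt; have [At tE qf f0 q0] := tt; have ut := tv_punip tt.
have [h Ah nth] := other_block ut; pose t' := (t ^ h)%g.
have tt' := tvJ tt Ah; set f' := _ *m f in tt'; set q' := q *m _ in tt'.
have [a0 b0] := tv_opp tt tt' nth; have [At' tE' qf' f0' q0'] := tt'.
exists t', f', q'; set P := opp_proj f f' q q'; split=> //.
  have corank := opp_proj_corank qf qf' a0 b0 n3.
  have [d [c dc]] := rank1_factor corank.
  have pres := tv_preserve tt tt' nth dc.
  have half y : y \in A -> let Py := rho y^-1%g *m P *m rho y in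
      Py *m P = Py /\ P *m Py = Py.
    move=> Ay Py; have ty := tvJ tt Ay; have ty' := tvJ tt' Ay.
    have [qP Pf] := pres _ _ _ ty; have [qP' Pf'] := pres _ _ _ ty'.
    rewrite -/P in qP Pf qP' Pf'.
    have PE : Py = (dot q f')^-1 *: ((rho y^-1%g *m f') *m (q *m rho y)) +
                   (dot q' f)^-1 *: ((rho y^-1%g *m f) *m (q' *m rho y)).
      rewrite /Py /P /opp_proj.
      by rewrite mulmxDr mulmxDl -!scalemxAr -!scalemxAl !mulmxA.
    split; rewrite PE.
      by rewrite mulmxDl -!scalemxAl -(mulmxA _ (q *m _)) qP -(mulmxA _ (q' *m _)) qP'.
    by rewrite mulmxDr -!scalemxAr (mulmxA P _ (q *m _)) Pf' (mulmxA P _ (q' *m _)) Pf.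
  move=> y Ay; have [_ PPy] := half y Ay.
  have [Py'P _] := half (y^-1)%g (groupVr Ay); rewrite invgK in Py'P.
  have : rho y^-1%g *m (rho y *m P *m rho y^-1%g *m P) *m rho y = P.
    by rewrite Py'P !mulmxA rhoVl // mul1mx -mulmxA rhoVl // mulmx1.
  rewrite !mulmxA rhoVl // mul1mx -!mulmxA (mulmxA (rho y^-1%g)) PPy => PyP.
  by rewrite -{1}PyP !mulmxA rhoV // mul1mx.
(* The two scalars of the word in [opp_involution], realised as exponents. *)
have [k kE] := natr_Fp (dot q' f)^-1; have [l lE] := natr_Fp (- (dot q f')^-1).
pose w := (t ^+ k * t' ^+ l * t ^+ k)%g.
have Aw : w \in A by rewrite !groupM ?groupX.
exists (w * w)%g; first by rewrite groupM.
rewrite rhoM // -(opp_involution qf qf' a0 b0) /w !rhoM ?groupM ?groupX //.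
by rewrite (tvX _ tt) (tvX _ tt') kE lE scaleNr.
Qed.

End Blocks.

(** * Strongly embedded subgroups and their preimages *)

Section StronglyEmbedded.
Import GRing.Theory.
Local Open Scope group_scope.
Variables (p : nat) (aT : finGroupType).
Hypothesis p_pr : prime p.

Section One.
Variables (G H : {group aT}).
Hypothesis spe : strongly_p_embedded p H G.

Lemma spe_proper : H \proper G. Proof. by case/and3P: spe. Qed.

Lemma spe_conj x g : x \in H -> g \in G -> p.-elt x -> x != 1 ->
  x ^ g \in H -> g \in H.
Proof.
move=> Hx Gg px x1 Hxg; apply/negPn/negP=> Hg.
case/and3P: spe => _ _ /forall_inP/(_ g); rewrite inE Hg Gg => /(_ isT)/negP; case.
have xI : x ^ g \in H :&: H :^ g by rewrite inE Hxg memJ_conjg.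
apply: dvdn_trans (order_dvdG (G := (H :&: H :^ g)%G) xI).
rewrite orderJ; have [||_ d _] := @pgroup_pdiv aT p <[x]>%G => //=.
by rewrite cycle_eq1.
Qed.

(** Strong embedding keeps the normaliser of [Q] in a larger [p]-group inside [H], where [Q] is
    already maximal, while normalisers grow in [p]-groups. *)
Lemma spe_Sylow (Q : {group aT}) : p.-Sylow(H) Q -> p.-Sylow(G) Q.
Proof.
move=> sylQ; have sHG := proper_sub spe_proper.
have [sQH pQ _] := and3P sylQ.
have Q1 : Q :!=: 1.
  case/and3P: spe => _ dH _; rewrite -cardG_gt1 (card_Hall sylQ) p_part_gt1.
  by rewrite mem_primes p_pr cardG_gt0.
have [R sylR sQR] := Sylow_superset (subset_trans sQH sHG) pQ.
have [sRG pR _] := and3P sylR.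
have [eQR|] := eqVproper sQR; first by rewrite -eQR in sylR.
move=> /(nilpotent_proper_norm (pgroup_nil pR)) ltQN.
have sNH : 'N_R(Q) \subset H.
  apply/subsetP=> g /setIP[Rg nQg]; have [x Qx x1] := trivgPn _ Q1.
  apply: (@spe_conj x) => //; rewrite ?(subsetP sQH) ?(subsetP sRG) //.
    exact: mem_p_elt pQ Qx.
  by rewrite memJ_norm.
have pN : p.-group 'N_R(Q) by apply: pgroupS pR; apply: subsetIl.
have sub := proper_sub ltQN.
have /eqP eQ : (Q : {set _}) == 'N_R(Q).
  rewrite eqEcard sub /= (card_Hall sylQ) /= -(part_pnat_id pN).
  by rewrite dvdn_leq ?part_gt0 // partn_dvd ?cardSg.
by rewrite {1}eQ properxx in ltQN.
Qed.

Lemma spe_cover x : x \in G -> p.-elt x -> exists2 h, h \in G & x \in H :^ h.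
Proof.
move=> Gx px; have [Q sylQ] := Sylow_exists p H.
have sylG := spe_Sylow sylQ; have [sQH _ _] := and3P sylQ.
have [|h Gh sxQ] := Sylow_Jsub sylG _ px; first by rewrite cycle_subG.
exists h^-1; rewrite ?groupV // mem_conjgV (subsetP sQH) // (subsetP sxQ) //.
by rewrite memJ_conjg cycle_id.
Qed.

(** [N] lies in a Sylow subgroup contained in [H]. All conjugates of a nontrivial element of [N]
    stay in [H], which would force [G] into [H]. *)
Lemma spe_pcore (N : {group aT}) : N <| G -> p.-group N -> N :=: 1.
Proof.
move=> nNG pN; have [Q sylQ] := Sylow_exists p H; have [sQH _ _] := and3P sylQ.
have sNQ : N \subset Q by apply: normal_sub_max_pgroup (Hall_max (spe_Sylow sylQ)) pN nNG.
apply/eqP/idPn=> /trivgPn[x Nx x1].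
have /subsetPn[g Gg /negP[]] : ~~ (G \subset H) by rewrite proper_subn ?spe_proper.
have Hx := subsetP (subset_trans sNQ sQH).
apply: (@spe_conj x) => //; first exact: Hx; first exact: mem_p_elt pN Nx.
by apply: Hx; rewrite memJ_norm // (subsetP (normal_norm nNG)).
Qed.

End One.

End StronglyEmbedded.

Section Quotient.
Import GRing.Theory.
Local Open Scope group_scope.

(** Transfers the hypothesis on [Out_F(E)] to [Aut_F(E)], with [I] the inner automorphisms, so that
    later arguments deal with permutations instead of cosets. *)
Lemma spe_quotient (p : nat) (aT : finGroupType) (A I : {group aT}) : prime p -> I <| A -> p.-group I ->
  has_strongly_p_embedded p (A / I) ->
  [/\ p %| #|A / I|,
      forall N : {group aT}, N <| A -> p.-group N -> N \subset I &
      exists H : {group aT}, [/\ H \proper A, I \subset H,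
       forall x y, x \in H -> y \in A -> p.-elt x -> x \notin I -> x ^ y \in H ->
          y \in H &
       forall x, x \in A -> p.-elt x -> exists2 h, h \in A & x \in H :^ h]].
Proof.
move=> p_pr nIA pI [Hb]; have [sIA nI] := andP nIA.
rewrite -[A / I]/(gval (A / I)%G) => spe; split.
- case/and3P: (spe) => pr dv _; apply: dvdn_trans dv (cardSg (proper_sub pr)).
- move=> N nNA pN; rewrite -quotient_sub1 ?(subset_trans (normal_sub nNA)) //.
  have nN : (N / I)%G <| (A / I)%G by rewrite quotient_normal.
  by rewrite (spe_pcore p_pr spe nN) ?quotient_pgroup.
have [sHA _ _] := and3P spe; have sHb := proper_sub sHA.
have [H defH sIH sHA'] := inv_quotientS nIA sHb.
have memH x : x \in A -> (x \in H) = (coset I x \in Hb).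
  move=> Ax; rewrite defH; apply/idP/idP=> [Hx|]; first by rewrite mem_quotient.
  by case/morphimP=> y Ny Hy /(rcoset_kercosetP (subsetP nI _ Ax) Ny)
      /rcosetP[z Iz ->]; rewrite groupM // (subsetP sIH).
exists H; split=> //.
- rewrite properEneq sHA' andbT; apply: contraTneq sHA => eHA.
  by rewrite defH eHA properxx.
- move=> x y Hx Ay px nIx Hxy; have Ax := subsetP sHA' _ Hx.
  rewrite memH //; apply: (spe_conj spe (x := coset I x)); rewrite ?mem_quotient //.
  + by rewrite -memH.
  + by apply: morph_p_elt => //; apply: (subsetP nI).
  + by apply: contra nIx => /eqP/coset_idr->; rewrite // (subsetP nI).
  + by have := memH _ (groupJ Ax Ay); rewrite Hxy morphJ ?(subsetP nI) // => <-.
move=> x Ax px.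
have [||_ /morphimP[h Nh Ah ->] xh] := spe_cover p_pr spe (x := coset I x).
- by rewrite mem_quotient.
- by apply: morph_p_elt => //; apply: (subsetP nI).
exists h => //; rewrite mem_conjg memH ?groupJ ?groupV //.
by rewrite morphJ ?groupV ?(subsetP nI) // morphV ?(subsetP nI) // -mem_conjg.
Qed.

End Quotient.

(** * Elementary abelian sections as row vectors *)

Section Coordinates.
Import GRing.Theory.
Local Open Scope group_scope.
Variables (p n : nat) (gT : finGroupType) (X Y : {group gT}).
Hypotheses (p_pr : prime p) (nYX : Y <| X) (abXY : p.-abelem (X / Y)).
Hypothesis iXY : #|X : Y| = (p ^ n)%N.

(** The coordinates are a function on all of [gT], meaningful only on [X], so that permutations of
    [gT] can be compared with matrices directly. *)
Lemma section_coord : exists psi : gT -> 'rV['F_p]_n,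
  [/\ {in X &, forall x y, psi (x * y) = (psi x + psi y)%R},
      {in X, forall x, (psi x == 0%R) = (x \in Y)} &
      forall v, exists2 x, x \in X & psi x = v].
Proof.
have [sYX nY] := andP nYX.
have : X / Y \isog [set: 'rV['F_p]_n].
  rewrite (isog_abelem_card _ abXY) mx_Fp_abelem //= cardsT card_mx mul1n card_Fp //.
  by rewrite card_quotient // iXY.
case/isogP=> f injf imf; exists (fun x => f (coset Y x)); split.
- move=> x y Xx Xy; rewrite morphM ?(subsetP nY) //.
  by rewrite (morphM f) ?mem_quotient.
- move=> x Xx; have Nx := subsetP nY _ Xx.
  have f1 : f 1 = 0%R := morph1 f.
  rewrite -f1 (inj_in_eq (injmP injf)) ?mem_quotient ?group1 //.
  by apply/eqP/idP=> [/coset_idr-> // | /coset_id].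
- move=> v; have : v \in f @* (X / Y) by rewrite imf inE.
  by case/morphimP=> _ _ /morphimP[x Nx Xx ->] ->; exists x.
Qed.

Variable psi : gT -> 'rV['F_p]_n.
Hypothesis psiM : {in X &, forall x y, psi (x * y) = (psi x + psi y)%R}.
Hypothesis psi0 : {in X, forall x, (psi x == 0%R) = (x \in Y)}.
Hypothesis psi_onto : forall v, exists2 x, x \in X & psi x = v.

Lemma coord1 : psi 1 = 0%R.
Proof. by apply/eqP; rewrite psi0. Qed.

Lemma coordV x : x \in X -> psi x^-1 = (- psi x)%R.
Proof.
by move=> Xx; apply/eqP; rewrite -addr_eq0 -psiM ?groupV // mulVg coord1.
Qed.

Lemma coordX x k : x \in X -> psi (x ^+ k) = (psi x *+ k)%R.
Proof.
move=> Xx; elim: k => [|k IH]; first by rewrite coord1.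
by rewrite expgS psiM ?groupX // IH mulrS.
Qed.

Lemma coord_eq x y : x \in X -> y \in X -> (psi x == psi y) = (x * y^-1 \in Y).
Proof.
by move=> Xx Xy; rewrite -psi0 ?groupM ?groupV // psiM ?groupV // coordV // subr_eq0.
Qed.

Definition acts_on_section (a : {perm gT}) :=
  [/\ {in X &, {morph a : x y / x * y}}, {in X, forall x, a x \in X} &
      {in Y, forall x, a x \in Y}].

(** The rows of [M] are the coordinates of the images of lifts [s i] of the standard basis. Over the
    prime field scalars are exponents, so additivity is linearity. *)
Lemma section_repr1 a : acts_on_section a ->
  exists M : 'M['F_p]_n, {in X, forall x, psi (a x) = (psi x *m M)%R}.
Proof.
case=> aM aX aY; have sYX := normal_sub nYX.
have [s sP] : exists s : 'I_n -> gT,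
    forall i, s i \in X /\ psi (s i) = delta_mx 0%R i.
  apply: (@fin_all_exists 'I_n (fun=> gT)
    (fun i x => x \in X /\ psi x = delta_mx 0%R i)) => i.
  by have [x Xx xv] := psi_onto (delta_mx 0%R i); exists x.
exists (\matrix_i psi (a (s i)))%R => x Xx.
have a1 : a 1 = 1 by apply: (mulgI (a 1)); rewrite -aM // !mulg1.
have compat x1 x2 : x1 \in X -> x2 \in X -> psi x1 = psi x2 -> psi (a x1) = psi (a x2).
  move=> X1 X2 e; apply/eqP; rewrite coord_eq ?aX //.
  have aV : a (x2 ^-1) = (a x2)^-1.
    by apply: (mulgI (a x2)); rewrite -aM ?groupV // !mulgV.
  by rewrite -aV -aM ?groupV // aY // -coord_eq // e.
have hom (v : 'rV['F_p]_n) : forall r : seq 'I_n, exists y, [/\ y \in X,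
   psi y = (\sum_(i <- r) v 0 i *: delta_mx 0 i)%R &
   psi (a y) = (\sum_(i <- r) v 0 i *: psi (a (s i)))%R].
  elim=> [|i r [y [Xy yE ayE]]].
    by exists 1; rewrite !big_nil a1 coord1.
  have [Xi iE] := sP i.
  exists (s i ^+ val (v 0 i)%R * y).
  have aXk k : a (s i ^+ k) = a (s i) ^+ k.
    by elim: k => [|k IH]; rewrite ?a1 // !expgS aM ?groupX ?IH.
  rewrite !big_cons groupM ?groupX // !aM ?groupX // aXk !psiM ?groupX ?aX //.
  rewrite !coordX ?aX // iE yE ayE -2!scaler_nat.
  by rewrite !natr_Zp.
have [y [Xy yE ayE]] := hom (psi x) (index_enum 'I_n).
have yx : psi y = psi x by rewrite yE -row_sum_delta.
rewrite -(compat y x) // ayE mulmx_sum_row; apply: eq_bigr => i _.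
by rewrite rowK.
Qed.

End Coordinates.

Section SectionRepr.
Import GRing.Theory.
Local Open Scope group_scope.
Variables (p n : nat) (gT : finGroupType) (X Y : {group gT}).
Hypotheses (p_pr : prime p) (nYX : Y <| X) (abXY : p.-abelem (X / Y)).
Hypothesis iXY : #|X : Y| = (p ^ n)%N.
Variable psi : gT -> 'rV['F_p]_n.
Hypothesis psiM : {in X &, forall x y, psi (x * y) = (psi x + psi y)%R}.
Hypothesis psi0 : {in X, forall x, (psi x == 0%R) = (x \in Y)}.
Hypothesis psi_onto : forall v, exists2 x, x \in X & psi x = v.

Lemma coord_mx_inj (M N : 'M['F_p]_n) :
  {in X, forall x, psi x *m M = psi x *m N}%R -> M = N.
Proof.
move=> MN; apply/row_matrixP=> i; rewrite !rowE.
by have [x Xx <-] := psi_onto (delta_mx 0%R i); apply: MN.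
Qed.

Lemma coord_repr (A : {group {perm gT}}) :
  {in A, forall a : {perm gT}, acts_on_section X Y a} ->
  exists rho : {perm gT} -> 'M['F_p]_n,
  [/\ {in A & X, forall (a : {perm gT}) x, psi (a x) = (psi x *m rho a)%R},
      {in A &, forall a b, rho (a * b) = (rho a *m rho b)%R} & rho 1 = 1%:M%R].
Proof.
move=> actA; have [rho rhoP] : exists rho : {perm gT} -> 'M['F_p]_n,
    forall a, a \in A -> {in X, forall x, psi (a x) = (psi x *m rho a)%R}.
  apply: (@fin_all_exists {perm gT} (fun=> 'M['F_p]_n) (fun a M => a \in A ->
    {in X, forall x, psi (a x) = (psi x *m M)%R})) => a.
  have [Aa|_] := boolP (a \in A); last by exists 0%R.
  have [M HM] := section_repr1 nYX psiM psi0 psi_onto (actA _ Aa).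
  by exists M.
exists rho; split.
- by move=> a x Aa Xx; apply: rhoP.
- move=> a b Aa Ab; apply: coord_mx_inj => x Xx.
  have [_ aX _] := actA _ Aa.
  by rewrite -rhoP ?groupM // permM !rhoP ?aX // mulmxA.
- by apply: coord_mx_inj => x Xx; rewrite -rhoP // perm1 mulmx1.
Qed.

End SectionRepr.

(** * Fusion systems *)

Section FusionFacts.
Local Open Scope group_scope.
Variables (p : nat) (gT : finGroupType) (S : {group gT}).
Variable F : {set gT} -> (gT -> gT) -> Prop.
Hypothesis p_pr : prime p.
Hypothesis pS : p.-group S.
Hypothesis satF : saturated S F p.

Let fusF : fusion_system S F. Proof. by case: satF. Qed.

Lemma fusion_mor (P : {set gT}) phi : F P phi ->
  [/\ group_set P, P \subset S, morph_on P phi, inj_on P phi & phi @: P \subset S].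
Proof. by case: fusF => h _ _ _; apply: h. Qed.

Lemma fusion_ext (P : {set gT}) phi psi : {in P, phi =1 psi} -> F P phi -> F P psi.
Proof. by case: fusF => _ h _ _; apply: h. Qed.

Lemma fusion_conj (P : {group gT}) g : P \subset S -> g \in S -> F P (fun x => x ^ g).
Proof. by case: fusF => _ _ h _; apply: h. Qed.

Lemma fusion_res (P : {set gT}) (Q : {group gT}) phi : F P phi -> Q \subset P -> F Q phi.
Proof. by case: fusF => _ _ _ [h _]; apply: h. Qed.

Lemma fusion_comp (P : {set gT}) phi psi : F P phi -> F (phi @: P) psi -> F P (psi \o phi).
Proof. by case: fusF => _ _ _ [_ [h _]]; apply: h. Qed.

Lemma mem_AutF (P : {set gT}) (a : {perm gT}) : reflect (a \in Aut P /\ F P a) (a \in AutF F P).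
Proof.
rewrite [_ \in AutF _ _]in_set; apply: (iffP idP) => [/andP[Aa /pboolP Fa] // | [Aa Fa]].
by rewrite Aa; apply/pboolP.
Qed.

Lemma Aut_imset (P : {group gT}) (a : {perm gT}) : a \in Aut P -> a @: P = P.
Proof.
move=> Aa; apply/eqP; rewrite eqEcard (card_imset _ perm_inj) leqnn andbT.
by apply/subsetP=> _ /imsetP[x Px ->]; rewrite Aut_closed.
Qed.

Lemma AutF_group_set (P : {group gT}) : P \subset S -> group_set (AutF F P).
Proof.
move=> sPS; apply/group_setP; split.
  apply/mem_AutF; split; first exact: group1.
  apply: fusion_ext (fusion_conj sPS (group1 S)) => x Px.
  by rewrite conjg1 perm1.
move=> a b /mem_AutF[Aa Fa] /mem_AutF[Ab Fb]; apply/mem_AutF.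
split; first by rewrite groupM.
apply: (@fusion_ext P (b \o a)) => [x Px|]; first by rewrite permM.
by apply: fusion_comp Fa _; rewrite Aut_imset.
Qed.

Lemma AutF_of_mor (P : {group gT}) phi : F P phi -> phi @: P \subset P ->
  exists2 a, a \in AutF F P & {in P, forall x, a x = phi x}.
Proof.
move=> Fphi sP; have [_ _ phiM injphi _] := fusion_mor Fphi.
have aE := perm_inE injphi sP; exists (perm_in injphi sP) => //.
apply/mem_AutF; split; last by apply: fusion_ext Fphi => x Px; rewrite aE.
rewrite inE perm_in_on; apply/morphicP => x y Px Py.
by rewrite !aE ?groupM ?phiM.
Qed.

Lemma sub_Aut (P : {group gT}) : AutF F P \subset Aut P.
Proof. by apply/subsetP=> a /mem_AutF[]. Qed.

Lemma AutS_conj (P : {group gT}) : AutS S P = conj_aut P @* 'N_S(P).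
Proof.
apply/setP=> a; apply/idP/idP.
  rewrite [_ \in AutS _ _]in_set => /andP[Aa /existsP[g /andP[Ng /forall_inP aE]]].
  have NPg : g \in 'N(P) by case/setIP: Ng.
  suff -> : a = conj_aut P g by rewrite mem_morphim.
  apply: (eq_Aut Aa); first exact: Aut_aut.
  by move=> x Px; rewrite norm_conj_autE //; apply/eqP; apply: aE.
case/morphimP=> g NPg Ng ->; rewrite [_ \in AutS _ _]in_set Aut_aut; apply/existsP; exists g.
by rewrite Ng; apply/forall_inP=> x Px; rewrite norm_conj_autE.
Qed.

Lemma Inn_conj (P : {group gT}) : Inn P = conj_aut P @* P.
Proof.
apply/setP=> a; apply/idP/idP.
  rewrite [_ \in Inn _]in_set => /andP[Aa /existsP[g /andP[Pg /forall_inP aE]]].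
  have NPg : g \in 'N(P) by rewrite (subsetP (normG P)).
  suff -> : a = conj_aut P g by rewrite mem_morphim.
  apply: (eq_Aut Aa); first exact: Aut_aut.
  by move=> x Px; rewrite norm_conj_autE //; apply/eqP; apply: aE.
case/morphimP=> g NPg Pg ->; rewrite [_ \in Inn _]in_set Aut_aut; apply/existsP; exists g.
by rewrite Pg; apply/forall_inP=> x Px; rewrite norm_conj_autE.
Qed.

Section Char.
Variable E : {group gT}.
Hypothesis sES : E \subset S.
Hypothesis charE : F_characteristic S F E.

Lemma AutF_char_sub b x : b \in AutF F S -> x \in E -> b x \in E.
Proof. by move=> Ab Ex; rewrite -(charE Ab) imset_f. Qed.

(** Conjugations by elements of [S] belong to [Aut_F(S)]. *)
Lemma Fchar_normal : E <| S.
Proof.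
rewrite /normal sES; apply/subsetP=> g Sg.
have nSg : g \in 'N(S) by rewrite (subsetP (normG S)).
rewrite inE; apply/subsetP=> _ /imsetP[x Ex ->].
have Sx := subsetP sES _ Ex.
rewrite -(norm_conj_autE nSg Sx); apply: AutF_char_sub => //.
apply/mem_AutF; split; first exact: Aut_aut.
by apply: fusion_ext (fusion_conj (subxx S) Sg) => y Sy; rewrite norm_conj_autE.
Qed.

Lemma AutF_restrict b : b \in AutF F S ->
  exists2 a, a \in AutF F E & {in E, forall x, a x = b x}.
Proof.
move=> Ab; apply: AutF_of_mor.
  by case/mem_AutF: Ab => _ Fb; apply: fusion_res Fb _.
by apply/subsetP=> _ /imsetP[x Ex ->]; apply: AutF_char_sub.
Qed.

Lemma AutS_normal : AutS S E = conj_aut E @* S.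
Proof.
by rewrite AutS_conj (setIidPl (normal_norm Fchar_normal)).
Qed.

Lemma conj_aut_AutF : conj_aut E @* S \subset AutF F E.
Proof.
apply/subsetP=> _ /morphimP[g nEg Sg ->]; apply/mem_AutF; split; first exact: Aut_aut.
by apply: fusion_ext (fusion_conj sES Sg) => y Ey; rewrite norm_conj_autE.
Qed.

(* Aut_S(E) is conjugated into Aut_S(Q) for a fully automized, receptive Q; the
   resulting isomorphism E -> Q extends to S, hence Q = E. *)
Lemma Fchar_receptive : fully_automized S F p E /\ receptive S F E.
Proof.
have nES := Fchar_normal.
have [Q [[phi [Fphi defQ]] [autQ recQ]]] := proj2 satF E sES.
have [_ _ phiM injphi sphiS] := fusion_mor Fphi.
pose f := Morphism phiM.
have injf : 'injm f by apply/injmP.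
have imf : f @* E = Q by rewrite morphimEdom.
pose QG := (f @* E)%G; have sQS : QG \subset S by rewrite /= imf defQ.
have [psi [Fpsi psiK]] : exists psi : gT -> gT,
    F (phi @: E) psi /\ {in E, forall x, psi (phi x) = x}.
  by case: fusF => _ _ _ [_ [_ h]]; apply: h.
pose c := Aut_isom injf (subxx E).
have cE a x : a \in Aut E -> x \in E -> c a (phi x) = phi (a x).
  by move=> Aa Ex; apply: (Aut_isomE injf (subxx E) Aa Ex).
pose PQ := (Aut_isom_morphism injf (subxx E) @* (conj_aut E @* S))%G.
have sPQ : PQ \subset AutF F QG.
  apply/subsetP=> _ /morphimP[a Aa Pa ->]; apply/mem_AutF.
  have /mem_AutF[_ Fa] := subsetP conj_aut_AutF _ Pa.
  split; first exact: Aut_Aut_isom.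
  have Fpa : F (phi @: E) (phi \o (a \o psi)).
    have psiE : psi @: (phi @: E) = E.
      apply/setP=> x; apply/imsetP/idP => [[_ /imsetP[y Ey ->] ->]|Ex].
        by rewrite psiK.
      by exists (phi x); rewrite ?psiK ?imset_f.
    have apE : (a \o psi) @: (phi @: E) = E.
      by rewrite imset_comp psiE Aut_imset.
    by apply: fusion_comp; [apply: fusion_comp Fpsi _; rewrite psiE | rewrite apE].
  apply: (@fusion_ext _ (phi \o (a \o psi))).
    by move=> _ /morphimP[x Ex _ ->] /=; rewrite psiK // cE.
  by rewrite /= imf defQ.
have [b Ab sPb] : exists2 b, b \in AutF F QG & PQ :^ b \subset AutS S QG.
  have AG := AutF_group_set sQS.
  have := @Sylow_Jsub p _ (Group AG) (conj_aut QG @* 'N_S(QG))%G PQ.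
  rewrite /= -AutS_conj => h; apply: h => //.
    by have: fully_automized S F p QG by rewrite /= imf.
  by rewrite !morphim_pgroup.
have /mem_AutF[Ab' Fb] := Ab.
pose phi' := b \o phi.
have Fphi' : F E phi'.
  apply: fusion_comp Fphi _; move: Fb; rewrite /= imf defQ; exact.
have imphi' : phi' @: E = Q.
  have bQ : [set b x | x in Q] = Q by rewrite -imf; apply: Aut_imset Ab'.
  by rewrite /phi' imset_comp -defQ.
have NphiE : Nphi S E phi' = S.
  apply/setP=> g; rewrite [_ \in Nphi _ _ _]in_set (setIidPl (normal_norm nES)).
  have [Sg|//] := boolP (g \in S); rewrite /=.
  have nEg := subsetP (normal_norm nES) _ Sg.
  have Pg : conj_aut E g \in conj_aut E @* S by rewrite mem_morphim.
  have Ag : conj_aut E g \in Aut E by apply: Aut_aut.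
  have : c (conj_aut E g) ^ b \in AutS S QG.
    by apply: (subsetP sPb); rewrite memJ_conjg; apply: mem_morphim.
  rewrite [_ \in AutS _ _]in_set => /andP[_ /existsP[h /andP[Nh /forall_inP hE]]].
  rewrite imphi' -imf; apply/existsP; exists h; rewrite Nh /=.
  apply/forall_inP=> x Ex; have Qx : b (phi x) \in QG.
    by rewrite Aut_closed // [_ \in _]mem_morphim.
  rewrite -(eqP (hE _ Qx)) /phi' /= conjgE !permM permK.
  by rewrite cE // norm_conj_autE.
have [phib [Fphib phibE]] := recQ _ _ Fphi' imphi'; rewrite NphiE in Fphib.
have [_ _ _ _ sbS] := fusion_mor Fphib.
have [t At tE] := AutF_of_mor Fphib sbS.
suff -> : (E : {set gT}) = Q by [].
rewrite -(charE At) -imphi'; apply: eq_in_imset => x Ex.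
by rewrite tE ?phibE // (subsetP sES).
Qed.

Lemma AutS_Sylow : p.-Sylow(AutF F E) (conj_aut E @* S).
Proof. by rewrite -AutS_normal; case: Fchar_receptive. Qed.

(** Normalising [Aut_S(E)] makes the extension domain [Nphi] all of [S]. Receptivity provides the
    extension, an injection of [S] into itself. *)
Lemma AutF_extend (a : {perm gT}) : a \in AutF F E -> a \in 'N(conj_aut E @* S) ->
  exists2 b, b \in AutF F S & {in E, forall x, b x = a x}.
Proof.
move=> Aa na; have nES := Fchar_normal.
have /mem_AutF[Aa' Fa] := Aa; have imE := Aut_imset Aa'.
have NE : Nphi S E a = S.
  apply/setP=> g; rewrite [_ \in Nphi _ _ _]in_set (setIidPl (normal_norm nES)).
  have [Sg|//] := boolP (g \in S); rewrite /=.
  have nEg := subsetP (normal_norm nES) _ Sg.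
  have Pg : conj_aut E g \in conj_aut E @* S by rewrite mem_morphim.
  have : conj_aut E g ^ a \in conj_aut E @* S by rewrite memJ_norm.
  case/morphimP=> h nEh Sh ahE; rewrite imE; apply/existsP; exists h.
  rewrite (setIidPl (normal_norm nES)) Sh /=; apply/forall_inP=> x Ex.
  rewrite -(norm_conj_autE nEh) ?Aut_closed // -ahE conjgE !permM permK.
  by rewrite norm_conj_autE.
have [_ /(_ _ _ Fa imE)[phib [Fphib phibE]]] := Fchar_receptive.
rewrite NE in Fphib; have [_ _ _ _ sbS] := fusion_mor Fphib.
have [t At tE] := AutF_of_mor Fphib sbS; exists t => // x Ex.
by rewrite tE ?phibE // (subsetP sES).
Qed.

End Char.

End FusionFacts.

(** * Automorphisms acting on sections *)

Section Perms.
Local Open Scope group_scope.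
Variables (p : nat) (gT : finGroupType).
Implicit Types (a b : {perm gT}) (X Y E : {group gT}) (A : {group {perm gT}}).

Definition triv_on X Y a := {in X, forall x, x^-1 * a x \in Y}.
Definition inv_under A X := {in A & X, forall a x, a x \in X}.

Lemma AutM E a : a \in Aut E -> {in E &, {morph a : x y / x * y}}.
Proof. by rewrite inE => /andP[_ /morphicP]. Qed.

Lemma Aut_fix1 E a : a \in Aut E -> a 1 = 1.
Proof. by move=> Aa; apply: (mulgI (a 1)); rewrite -(AutM Aa) ?mulg1. Qed.

Lemma AutV E a x : a \in Aut E -> x \in E -> a x^-1 = (a x)^-1.
Proof.
move=> Aa Ex; apply: (mulgI (a x)).
by rewrite -(AutM Aa) ?groupV // !mulgV (Aut_fix1 Aa).
Qed.

Lemma AutX E a x k : a \in Aut E -> x \in E -> a (x ^+ k) = a x ^+ k.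
Proof.
move=> Aa Ex; elim: k => [|k IH]; first exact: Aut_fix1 Aa.
by rewrite !expgS (AutM Aa) ?groupX ?IH.
Qed.

Lemma AutR E a x y : a \in Aut E -> x \in E -> y \in E ->
  a [~ x, y] = [~ a x, a y].
Proof.
move=> Aa Ex Ey; rewrite !commgEl !conjgE !(AutM Aa, AutV Aa) ?groupM ?groupV //.
Qed.

Lemma triv_onM X Y a b : {in X, forall x, a x \in X} ->
  triv_on X Y a -> triv_on X Y b -> triv_on X Y (a * b).
Proof.
move=> aX ta tb x Xx; rewrite permM.
have -> : x^-1 * b (a x) = (x^-1 * a x) * ((a x)^-1 * b (a x)) by rewrite mulgA mulgK.
by rewrite groupM ?ta ?tb ?aX.
Qed.

Lemma triv_on1 X Y : triv_on X Y 1.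
Proof. by move=> x _; rewrite perm1 mulVg. Qed.

Lemma triv_onJ E A X Y a b : A \subset Aut E -> X \subset E -> Y \subset X ->
  inv_under A X -> inv_under A Y ->
  a \in A -> b \in A -> triv_on X Y a -> triv_on X Y (a ^ b).
Proof.
move=> sA sXE sYX iX iY Aa Ab ta x Xx; have AutA := subsetP sA.
have Ab' : b^-1 \in A by rewrite groupV.
pose y := b^-1 x; have Xy : y \in X by apply: iX.
have xE : x = b y by rewrite /y permKV.
rewrite conjgE !permM -/y {1}xE -(AutV (AutA _ Ab)) ?(subsetP sXE) //.
rewrite -(AutM (AutA _ Ab)) ?groupV ?(subsetP sXE) ?iX //.
by apply: iY => //; apply: ta.
Qed.

Lemma fixed_in_coset E X Y a q : prime q -> q != p -> p.-group E -> #[a] = q ->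
  a \in Aut E -> X \subset E -> Y \subset X -> {in Y, forall y, a y \in Y} ->
  triv_on X Y a -> {in X, forall x, exists2 y, y \in Y & a (x * y) = x * y}.
Proof.
move=> q_pr neq pE oa Aa sXE sYX aY ta x Xx.
have actY : [acts <[a]>, on x *: Y | 'P].
  rewrite cycle_subG !inE; apply/subsetP=> _ /lcosetP[y Yy ->].
  rewrite inE /= apermE mem_lcoset (AutM Aa) ?(subsetP sXE) // ?(subsetP sYX) //.
  by rewrite mulgA; apply: groupM; [apply: ta | apply: aY].
have qa : q.-group <[a]> by rewrite /pgroup -orderE oa pnat_id.
have := pgroup_fix_mod qa actY; rewrite card_lcoset.
case: (set_0Vmem 'Fix_(x *: Y | 'P)(<[a]>)) => [-> | [z]].
  rewrite cards0 mod0n => /eqP qY; have pY : p.-group Y by apply: pgroupS pE; apply: subset_trans sXE.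
  have := pgroupP pY q q_pr qY.
  by rewrite inE /= (negPf neq).
rewrite inE => /andP[/lcosetP[y Yy ->]] /afixP/(_ a (cycle_id a)) /= fy _.
by exists y.
Qed.

(** Fixed points lift through each factor, so [E] is generated by them together with [Phi(E)], hence
    by them alone. Terms may repeat, so this covers every chain with at most four factors above
    [Phi(E)]. *)
Lemma chain_fix E a q X1 X2 X3 : prime q -> q != p -> p.-group E -> #[a] = q ->
  a \in Aut E ->
  X3 \subset E -> X2 \subset X3 -> X1 \subset X2 -> 'Phi(E) \subset X1 ->
  {in X1, forall y, a y \in X1} -> {in X2, forall y, a y \in X2} ->
  {in X3, forall y, a y \in X3} ->
  triv_on E X3 a -> triv_on X3 X2 a -> triv_on X2 X1 a ->
  triv_on X1 'Phi(E)%G a -> a = 1.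
Proof.
move=> q_pr neq pE oa Aa s3E s23 s12 sP1 i1 i2 i3 t3 t2 t1 t0.
pose f := [set x in E | a x == x].
have gf : group_set f.
  apply/group_setP; rewrite !inE group1 (Aut_fix1 Aa) eqxx; split=> // x y.
  rewrite !inE => /andP[Ex /eqP ax] /andP[Ey /eqP ay].
  by rewrite groupM //= (AutM Aa) // ax ay.
pose Fx := Group gf.
have iP : {in 'Phi(E)%G, forall y, a y \in 'Phi(E)%G}.
  move=> y Py; have /charP[_ /(_ (autm_morphism Aa))] := Phi_char E.
  rewrite injm_autm im_autm => /(_ isT erefl) <-.
  have Ey : y \in E by apply: subsetP Py; apply: Phi_sub.
  by rewrite -(autmE Aa) mem_morphim.
have step (X Y : {group gT}) : X \subset E -> Y \subset X ->
    {in Y, forall y, a y \in Y} -> triv_on X Y a -> X \subset Fx * Y.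
  move=> sXE sYX iY tXY; apply/subsetP=> x Xx.
  have [y Yy fy] := fixed_in_coset q_pr neq pE oa Aa sXE sYX iY tXY Xx.
  apply/mulsgP; exists (x * y) y^-1; rewrite ?groupV ?mulgK // inE fy eqxx andbT.
  by rewrite (subsetP sXE) // groupM // (subsetP sYX).
have sF Y Z : E \subset Fx * Y -> Y \subset Fx * Z -> E \subset Fx * Z.
  move=> sEY sYZ; apply: subset_trans sEY _; rewrite -{2}(mulGid Fx) -mulgA.
  exact: mulgS.
have s2E := subset_trans s23 s3E; have s1E := subset_trans s12 s2E.
have : E \subset Fx * 'Phi(E).
  apply: (sF _ _ _ (step _ _ s1E sP1 iP t0)).
  apply: (sF _ _ _ (step _ _ s2E s12 i1 t1)).
  by apply: (sF _ _ _ (step _ _ s3E s23 i2 t2)); apply: step t3.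
have sFE : Fx \subset E by apply/subsetP=> x; rewrite inE => /andP[].
move=> sE; have /Phi_nongen : 'Phi(E) <*> Fx = E.
  apply/eqP; rewrite eqEsubset join_subG Phi_sub sFE /=.
  by apply: subset_trans sE _; rewrite mul_subG ?joing_subl ?joing_subr.
rewrite genGid => defE; apply/permP=> x; rewrite perm1.
have [Ex|nEx] := boolP (x \in E); last exact: (out_Aut Aa).
by move: Ex; rewrite -{1}defE inE => /andP[_ /eqP].
Qed.

End Perms.

(** * Essential subgroups of sectional rank at most three *)

Lemma muln_regroup (a b c d : nat) :
  a * c * (a * b) = a * d * a -> a * a * (c * b) = a * a * d.
Proof. by move=> e; lia. Qed.

Section EssentialAction.
Import GRing.Theory.
Local Open Scope group_scope.
Variables (p : nat) (gT : finGroupType) (S E : {group gT}) (A : {group {perm gT}}).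
Hypotheses (p_pr : prime p) (p_odd : odd p) (pS : p.-group S) (nES : E <| S).
Hypotheses (cES : 'C_S(E) \subset E) (sAutA : A \subset Aut E).
Hypothesis sylP : p.-Sylow(A) (conj_aut E @* S).
Hypothesis spe : has_strongly_p_embedded p (A / (conj_aut E @* E)).

Local Notation c := (conj_aut E).
Local Notation I := (conj_aut E @* E)%G.
Local Notation P := (conj_aut E @* S)%G.
Local Notation Phi := ('Phi(E))%G.

Let pE : p.-group E. Proof. exact: pgroupS (normal_sub nES) pS. Qed.
Let sES := normal_sub nES.
Let nE := normal_norm nES.
Let AutA a : a \in A -> a \in Aut E. Proof. exact: (subsetP sAutA). Qed.

Lemma conj_autS s x : s \in S -> x \in E -> c s x = x ^ s.
Proof. by move=> Ss Ex; rewrite norm_conj_autE // (subsetP nE). Qed.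

Lemma conj_aut_mem s : s \in S -> c s \in A.
Proof.
move=> Ss; case/and3P: sylP => sPA _ _; apply: (subsetP sPA).
by apply: mem_morphim => //; apply: (subsetP nE).
Qed.

Lemma conj_aut_p s : s \in S -> p.-elt (c s).
Proof.
move=> Ss; apply: morph_p_elt; first by apply: (subsetP nE).
exact: mem_p_elt pS Ss.
Qed.

Lemma inv_conj X s x : inv_under A X -> X \subset E -> s \in S -> x \in X -> x ^ s \in X.
Proof.
move=> iX sXE Ss Xx; rewrite -conj_autS ?(subsetP sXE) //.
by apply: iX => //; apply: conj_aut_mem.
Qed.

Lemma inv_normal X : inv_under A X -> X \subset E -> X <| S.
Proof.
move=> iX sXE; rewrite /normal (subset_trans sXE) //.
apply/subsetP=> s Ss; rewrite inE; apply/subsetP=> _ /imsetP[x Xx ->].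
exact: inv_conj.
Qed.

Lemma inv_Phi : inv_under A Phi.
Proof.
move=> a x Aa Px; have /charP[_ /(_ (autm_morphism (AutA Aa)))] := Phi_char E.
rewrite injm_autm im_autm => /(_ isT erefl) <-.
have Ex : x \in E by apply: subsetP Px; apply: Phi_sub.
by rewrite -(autmE (AutA Aa)) mem_morphim.
Qed.

Lemma inv_E : inv_under A E.
Proof. by move=> a x Aa Ex; rewrite Aut_closed ?AutA. Qed.

(** [s] differs from an element of [E] by an element centralising [E], which is in [E] as well. *)
Lemma mem_conj_Inn s : s \in S -> c s \in I -> s \in E.
Proof.
move=> Ss /morphimP[e nEe Ee ce]; have Se := subsetP sES _ Ee.
suff : s * e^-1 \in E by rewrite groupMr // groupV.
apply: (subsetP cES); rewrite inE groupM ?groupV //=; apply/centP=> x Ex.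
apply: commute_sym; apply/commgP; rewrite commgEl; apply/eqP.
suff -> : x ^ (s * e^-1) = x by rewrite mulVg.
have xse : x ^ s = x ^ e by rewrite -(conj_autS Ss Ex) ce; apply: conj_autS.
by rewrite conjgM xse conjgK.
Qed.

Lemma Inn_normalA : I <| A.
Proof.
have sIA : I \subset A.
  case/and3P: sylP => sPA _ _; apply: subset_trans sPA; exact: morphimS.
rewrite /normal sIA; apply/subsetP=> a Aa; rewrite inE.
apply/subsetP=> _ /imsetP[_ /morphimP[e nEe Ee ->] ->].
have Eae : a e \in E by apply: inv_E.
suff -> : c e ^ a = c (a e) by apply: mem_morphim => //; apply: (subsetP (normG E)).
apply: (eq_Aut (AutA _)); rewrite ?Aut_aut //.
  by rewrite groupJ // (subsetP sIA) // mem_morphim.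
move=> x Ex; have Eax : a^-1 x \in E by apply: inv_E; rewrite ?groupV.
have nae : a e \in 'N(E) by apply: (subsetP (normG E)).
rewrite conjgE !permM norm_conj_autE // (norm_conj_autE nae) //.
by rewrite !conjgE !(AutM (AutA Aa), AutV (AutA Aa)) ?groupM ?groupV // permKV.
Qed.

Lemma Inn_p : p.-group I. Proof. exact: morphim_pgroup. Qed.

Lemma Inn_triv a : a \in I -> triv_on E Phi a.
Proof.
case/morphimP=> e nEe Ee -> x Ex; rewrite norm_conj_autE //.
rewrite -commgEl; apply: (subsetP (_ : E^`(1) \subset Phi)); last first.
  by rewrite mem_commg.
by rewrite der1_min ?gFnorm // (abelem_abelian (Phi_quotient_abelem pE)).
Qed.

Let quo := spe_quotient p_pr Inn_normalA Inn_p spe.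

(** The elements of [A] trivial on all factors form a normal subgroup, a [p]-group by [chain_fix];
    strong embedding puts every such subgroup inside [I]. *)
Lemma chain_Inn X1 X2 X3 a : inv_under A X1 -> inv_under A X2 -> inv_under A X3 ->
  Phi \subset X1 -> X1 \subset X2 -> X2 \subset X3 -> X3 \subset E -> a \in A ->
  triv_on E X3 a -> triv_on X3 X2 a -> triv_on X2 X1 a -> triv_on X1 Phi a ->
  a \in I.
Proof.
move=> i1 i2 i3 s01 s12 s23 s3E Aa t3 t2 t1 t0.
have s2E := subset_trans s23 s3E; have s1E := subset_trans s12 s2E.
pose tb (X Y : {group gT}) (b : {perm gT}) := [forall x in X, x^-1 * b x \in Y].
have tP X Y b : reflect (triv_on X Y b) (tb X Y b) by apply: (iffP forall_inP).
pose N := [set b in A | [&& tb E X3 b, tb X3 X2 b, tb X2 X1 b & tb X1 Phi b]].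
have NP b : reflect [/\ b \in A, triv_on E X3 b, triv_on X3 X2 b, triv_on X2 X1 b
    & triv_on X1 Phi b] (b \in N).
  rewrite !inE; apply: (iffP andP) => [[Ab /and4P[/tP ? /tP ? /tP ? /tP ?]] //|].
  by case=> Ab /tP-> /tP-> /tP-> /tP->.
have gN : group_set N.
  apply/group_setP; split; first by apply/NP; split=> //; apply: triv_on1.
  move=> b d /NP[Ab b3 b2 b1 b0] /NP[Ad d3 d2 d1 d0]; apply/NP.
  split; first by rewrite groupM.
  - by apply: triv_onM => // x; apply: inv_E.
  - by apply: triv_onM => // x; apply: i3.
  - by apply: triv_onM => // x; apply: i2.
  - by apply: triv_onM => // x; apply: i1.
have nN : Group gN <| A.
  rewrite /normal; apply/andP; split; first by apply/subsetP=> b /NP[].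
  apply/subsetP=> d Ad; rewrite inE; apply/subsetP=> _ /imsetP[b /NP[Ab b3 b2 b1 b0] ->].
  apply/NP; split; first by rewrite groupJ.
  - exact: (triv_onJ sAutA (subxx E) s3E inv_E i3 Ab Ad b3).
  - exact: (triv_onJ sAutA s3E s23 i3 i2 Ab Ad b2).
  - exact: (triv_onJ sAutA s2E s12 i2 i1 Ab Ad b1).
  - exact: (triv_onJ sAutA s1E s01 i1 inv_Phi Ab Ad b0).
have pN : p.-group (Group gN).
  apply/pgroupP=> q q_pr qN; rewrite inE /=; apply/negPn/negP=> neq.
  have [b /NP[Ab b3 b2 b1 b0] ob] := Cauchy q_pr qN.
  have b_1 : b = 1.
    apply: (chain_fix q_pr neq pE ob (AutA Ab) s3E s23 s12 s01) => //.
    - by move=> x; apply: i1.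
    - by move=> x; apply: i2.
    - by move=> x; apply: i3.
  by move: q_pr; rewrite -ob b_1 order1.
case: quo => _ sub _; apply: (subsetP (sub _ nN pN)); exact/NP.
Qed.

Lemma triv_Inn a : a \in A -> triv_on E Phi a -> a \in I.
Proof.
move=> Aa ta; have sub := Phi_sub E.
apply: (chain_Inn inv_Phi inv_Phi inv_Phi) => // x Px; rewrite groupM ?groupV //;
  exact: inv_Phi.
Qed.

(** [p] divides the order of [A / I], whereas [S = E] would make [I] a Sylow subgroup of [A]. *)
Lemma ex_outer : exists2 s, s \in S & s \notin E.
Proof.
apply/subsetPn/negP=> sSE; case: quo => dvA _ _.
have eSE : S :=: E by apply/eqP; rewrite eqEsubset sSE sES.
have := sylP; rewrite eSE => /and3P[sIA _]; rewrite -card_quotient ?normal_norm ?Inn_normalA //.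
by rewrite p'natE // dvA.
Qed.

Lemma comm_E s x : s \in S -> x \in E -> x^-1 * c s x = [~ x, s].
Proof. by move=> Ss Ex; rewrite conj_autS // commgEl. Qed.

Variable n : nat.
Hypothesis iPhi : #|E : Phi| = (p ^ n)%N.
Hypothesis n3 : n <= 3.

Variable psi : gT -> 'rV['F_p]_n.
Hypothesis psiM : {in E &, forall x y, psi (x * y) = (psi x + psi y)%R}.
Hypothesis psi0 : {in E, forall x, (psi x == 0%R) = (x \in Phi)}.
Hypothesis psi_onto : forall v, exists2 x, x \in E & psi x = v.
Variable rho : {perm gT} -> 'M['F_p]_n.
Hypothesis rhoP : {in A & E, forall (a : {perm gT}) x, psi (a x) = (psi x *m rho a)%R}.
Hypothesis rhoM : {in A &, forall a b, rho (a * b) = (rho a *m rho b)%R}.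
Hypothesis rho1 : rho 1 = 1%:M%R.

Let psiV x (Ex : x \in E) := coordV psiM psi0 Ex.

Lemma psi_act a x : a \in A -> x \in E ->
  psi (x^-1 * a x) = (psi x *m (rho a - 1%:M))%R.
Proof.
move=> Aa Ex; rewrite psiM ?groupV ?inv_E // rhoP // psiV //.
by rewrite mulmxBr mulmx1 addrC.
Qed.

Lemma ker_rho a : a \in A -> (rho a = 1%:M%R) <-> (a \in I).
Proof.
move=> Aa; split=> [r1 | Ia].
  apply: triv_Inn => // x Ex; rewrite -psi0 ?groupM ?groupV ?inv_E //.
  by rewrite psi_act // r1 subrr mulmx0.
apply: (coord_mx_inj psi_onto) => x Ex; rewrite mulmx1 -rhoP //.
apply/eqP; rewrite -subr_eq0 addrC -psiV // -psiM ?groupV ?inv_E // psi0.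
  exact: Inn_triv Ia _ Ex.
by rewrite groupM ?groupV ?inv_E.
Qed.

Lemma p_elt_rho x : x \in A -> rho (x ^+ p) = 1%:M%R -> p.-elt x.
Proof.
move=> Ax /(ker_rho (groupX p Ax)) Ixp.
have := mem_p_elt Inn_p Ixp => /p_natP[k ok].
have : #[x] %| p ^ k.+1 by rewrite order_dvdn expnS expgM -order_dvdn ok.
by move=> d; apply: pnat_dvd d _; rewrite pnatX pnat_id.
Qed.

Lemma block_hyps : exists H : {group {perm gT}}, [/\ H \subset A, H \proper A,
  {in A, forall x, rho x = 1%:M%R -> x \in H},
  (forall x y, x \in H -> y \in A -> rho (x ^+ p) = 1%:M%R ->
     rho x <> 1%:M%R -> x ^ y \in H -> y \in H) &
  forall x, x \in A -> rho (x ^+ p) = 1%:M%R ->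
     rho x <> 1%:M%R -> exists2 h, h \in A & x \in H :^ h].
Proof.
case: quo => _ _ [H [pHA sIH emb cov]]; have sHA := proper_sub pHA.
exists H; split=> //.
- by move=> x Ax /(ker_rho Ax); apply: (subsetP sIH).
- move=> x y Hx Ay xp x1; have Ax := subsetP sHA _ Hx; apply: emb => //.
    exact: p_elt_rho.
  by apply/negP=> /(ker_rho Ax).
- by move=> x Ax xp x1; apply: cov => //; apply: p_elt_rho.
Qed.

(** The displacement [rho a - 1] has rank one, say [f *m q]. A [p]-element has no eigenvalue other
    than 1, which makes [dot q f] vanish. *)
Lemma line_tv a (w : 'rV['F_p]_n) : a \in A -> p.-elt a -> a \notin I ->
  {in E, forall x, exists k : 'F_p, psi (x^-1 * a x) = (k *: w)%R} ->
  exists f q, tv A rho a f q.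
Proof.
move=> Aa pa nIa line; pose M := (rho a - 1%:M)%R.
have rk : (\rank M <= 1)%N.
  apply: leq_trans (rank_leq_row w); apply: mxrankS; apply/row_subP=> i.
  rewrite rowE; have [x Ex <-] := psi_onto (delta_mx 0%R i).
  by rewrite -psi_act //; have [k ->] := line x Ex; apply: scalemx_sub.
have [f [q fq]] := rank1_factor rk; exists f, q.
have rE : rho a = (1%:M + f *m q)%R by rewrite -fq addrC subrK.
have fq0 : (f *m q != 0)%R.
  by apply: contraNneq nIa => e; apply/(ker_rho Aa); rewrite rE e addr0.
split=> //; last 2 first.
- by apply: contraNneq fq0 => ->; rewrite mul0mx.
- by apply: contraNneq fq0 => ->; rewrite mulmx0.
have [k ok] := p_natP pa.
have qX m : (q *m rho (a ^+ m) = (1 + dot q f) ^+ m *: q)%R.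
  elim: m => [|m IH]; first by rewrite rho1 mulmx1 scale1r.
  rewrite expgSr rhoM ?groupX // mulmxA IH -scalemxAl rE mulmxDr mulmx1 row_rank1.
  have -> : (q + dot q f *: q = (1 + dot q f) *: q)%R by rewrite scalerDl scale1r.
  by rewrite scalerA exprSr.
have := qX (p ^ k)%N; rewrite -ok expg_order rho1 mulmx1 ok => qE.
(* Scalars are fixed by Frobenius, so the eigenvalue [1 + dot q f] equals its power by the order of
   [a], which fixes [q]. *)
have Fp_fix (x : 'F_p) m : (x ^+ (p ^ m) = x)%R.
  elim: m => [|m IH]; first by rewrite expr1.
  rewrite expnSr exprM IH -(natr_Zp x) -[X in X = _](pFrobenius_autE (pchar_Fp p_pr)).
  exact: pFrobenius_aut_nat.
move: qE; rewrite Fp_fix scalerDl scale1r => /eqP.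
rewrite -subr_eq0 opprD addrA subrr sub0r oppr_eq0 scaler_eq0.
case/orP=> /eqP // q0; by rewrite q0 mulmx0 eqxx in fq0.
Qed.

Lemma triv_onX (X Y : {group gT}) (a : {perm gT}) k : {in X, forall x, a x \in X} ->
  triv_on X Y a -> triv_on X Y (a ^+ k).
Proof.
move=> iX ta; elim: k => [|k IH]; first exact: triv_on1.
by rewrite expgS; apply: triv_onM.
Qed.

Lemma conj_triv (X Y : {group gT}) s : X <| S -> Y <| S -> Y \subset X -> X \subset E ->
  #|X : Y| <= p -> s \in S -> triv_on X Y (c s).
Proof.
move=> nXS nYS sYX sXE iXY Ss x Xx; rewrite comm_E ?(subsetP sXE) //.
by rewrite (subsetP (pgroup_comm_index p_pr pS nYS nXS sYX iXY)) ?mem_commg.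
Qed.

(** If [c s] were trivial on [X / Y], or if [A] preserved the line [L / Y], then [chain_Inn] would
    make [c s] inner. So [c s] and one of its conjugates are opposite transvections of [X / Y], and
    the squared word of [opp_involution] is -1 there. On the outer factors it is trivial because
    [c s] is. *)
Lemma section_involution (X L Y : {group gT}) s :
  inv_under A X -> inv_under A Y -> L <| S ->
  Phi \subset Y -> Y \subset L -> L \subset X -> X \subset E ->
  #|X : L| = p -> #|L : Y| = p -> #|E : X| <= p -> #|Y : Phi| <= p ->
  s \in S -> s \notin E ->
  exists2 z, z \in A & [/\ {in X, forall x, z x * x \in Y}, triv_on E X z,
    triv_on Y Phi z, z * z \in I & [~ z, c s] \in I].
Proof.
move=> iX iY nLS sPY sYL sLX sXE iXL iLY iEX iYP Ss nEs.
have sYX := subset_trans sYL sLX; have sLE := subset_trans sLX sXE.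
have nXS := inv_normal iX sXE; have nYS := inv_normal iY (subset_trans sYX sXE).
have nPS := inv_normal inv_Phi (Phi_sub E).
have sXS := normal_sub nXS.
have nYX : Y <| X by apply: normalS sYX sXS nYS.
have abXY := abelem_over_Phi pE sXE nYX sPY.
have iXY : #|X : Y| = (p ^ 2)%N by rewrite -(Lagrange_index sLX sYL) iXL iLY mulnn.
have [psi2 [psi2M psi20 psi2_onto]] := section_coord p_pr nYX abXY iXY.
have actA : {in A, forall a : {perm gT}, acts_on_section X Y a}.
  move=> a Aa; split=> [x y Xx Xy|x|x]; [|exact: iX|exact: iY].
  by rewrite (AutM (AutA Aa)) // (subsetP sXE).
have [r2 [r2P r2M r21]] := coord_repr nYX psi2M psi20 psi2_onto actA.
have act2 a x : a \in A -> x \in X -> psi2 (x^-1 * a x) = (psi2 x *m (r2 a - 1%:M))%R.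
  move=> Aa Xx; rewrite psi2M ?groupV ?iX // r2P // (coordV psi2M psi20) //.
  by rewrite mulmxBr mulmx1 addrC.
have triv2 a : a \in A -> r2 a = 1%:M%R -> triv_on X Y a.
  move=> Aa ra x Xx; rewrite -psi20 ?groupM ?groupV ?iX // act2 // ra subrr.
  by rewrite mulmx0.
have Acs := conj_aut_mem Ss; have nIcs : c s \notin I.
  by apply: contra nEs => /(mem_conj_Inn Ss).
have tEX := conj_triv nES nXS sXE (subxx E) iEX Ss.
have tXL : triv_on X L (c s) by apply: conj_triv; rewrite ?iXL.
have tLY : triv_on L Y (c s) by apply: conj_triv; rewrite ?iLY.
have tYP : triv_on Y Phi (c s).
  by apply: conj_triv => //; apply: subset_trans sYX sXE.
have [l Ll nYl] : exists2 l, l \in L & l \notin Y.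
  by apply/subsetPn; rewrite -indexg_eq1 iLY; apply: contraTneq p_pr => ->.
have Xl := subsetP sLX _ Ll; pose q := psi2 l.
have nYL : Y <| L by apply: normalS sYL (normal_sub nLS) nYS.
have spanL x : x \in L -> exists k : 'F_p, psi2 x = (k *: q)%R.
  move=> Lx; have [k xk] := prime_index_gen p_pr nYL iLY Ll nYl Lx.
  have Xx := subsetP sLX _ Lx; exists (k%:R)%R; apply/eqP.
  by rewrite scaler_nat -(coordX psi2M psi20) // (coord_eq psi2M psi20) ?groupX.
have [f0 f0P] : exists f0 : 'I_2 -> 'F_p,
    forall i, row i (r2 (c s) - 1%:M)%R = (f0 i *: q)%R.
  apply: (@fin_all_exists 'I_2 (fun=> 'F_p)
    (fun i k => row i (r2 (c s) - 1%:M) = (k *: q))%R) => i.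
  rewrite rowE; have [x Xx <-] := psi2_onto (delta_mx 0%R i).
  by rewrite -act2 //; apply: spanL; apply: tXL.
pose f : 'cV['F_p]_2 := (\col_i f0 i)%R.
have rE : r2 (c s) = (1%:M + f *m q)%R.
  suff <- : (r2 (c s) - 1%:M = f *m q)%R by rewrite addrC subrK.
  apply/row_matrixP=> i; rewrite f0P.
  by rewrite row_mul [row i f]mx11_scalar !mxE mul_scalar_mx.
have q0 : (q != 0)%R by rewrite psi20.
have qf : dot q f = 0%R.
  have /eqP : psi2 (l^-1 * c s l) = 0%R.
    apply/eqP; rewrite psi20 ?tLY // (subsetP sYX) ?tLY //.
  rewrite act2 // rE addrC addKr row_rank1 scaler_eq0 (negPf q0) orbF.
  by move/eqP.
have f_neq0 : (f != 0)%R.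
  apply: contraNneq nIcs => e.
  have tXY : triv_on X Y (c s) by apply: triv2 => //; rewrite rE e mul0mx addr0.
  apply: (chain_Inn iY iY iX sPY (subxx Y) sYX sXE Acs tEX tXY _ tYP) => x Yx.
  by rewrite groupM ?groupV ?iY.
have tt : tv A r2 (c s) f q by split.
have [a Aa na] : exists2 a, a \in A & ~~ ((q *m r2 a)%R <= q)%MS.
  apply/exists_inP; rewrite -negb_forall_in; apply: contra nIcs => /forall_inP qa.
  have iL : inv_under A L.
    move=> a x Aa Lx; have [k xk] := spanL _ Lx; have Xx := subsetP sLX _ Lx.
    have /sub_rVP[m qm] := qa _ Aa.
    pose y := l ^+ val (k * m)%R; have Ly : y \in L by rewrite groupX.
    rewrite -(mulgKV y (a x)) groupM // (subsetP sYL) //.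
    rewrite -(coord_eq psi2M psi20) ?iX ?(subsetP sLX _ Ly) //.
    by rewrite r2P // xk -scalemxAl qm scalerA (coordX psi2M psi20) // -scaler_nat natr_Zp.
  exact: (chain_Inn iY iL iX sPY sYL sLX sXE Acs tEX tXL tLY tYP).
pose t' := c s ^ a; have tt' := tvJ r2M r21 tt Aa.
set f' := (_ *m f)%R in tt'; set q' := (q *m _)%R in tt' na.
have [At' tE' qf' f'0 q'0] := tt'; rewrite -/t' in tt' At' tE'.
have basis m (M : 'M['F_p]_(2, m)) : (q *m M = 0 -> q' *m M = 0 -> M = 0)%R.
  move=> qM q'M; have fr : row_free (col_mx q q').
    apply: inj_row_free => v; rewrite -[v]hsubmxK mul_row_col.
    rewrite [lsubmx v]mx11_scalar [rsubmx v]mx11_scalar !mul_scalar_mx.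
    move: (lsubmx v 0 0)%R (rsubmx v 0 0)%R => x y e.
    have [y0|y0] := eqVneq y 0%R.
      move: e; rewrite y0 scale0r addr0 => /eqP; rewrite scaler_eq0 (negPf q0) orbF.
      by move/eqP=> ->; rewrite raddf0 row_mx0.
    case/negP: na; apply/sub_rVP; exists (- (y^-1 * x))%R.
    move/eqP: e; rewrite addrC addr_eq0 => /eqP e; apply: (scalerI y0).
    by rewrite e scalerA mulrN mulrA mulfV // mul1r scaleNr.
  have e : (col_mx q q' *m M = 0)%R by rewrite mul_col_mx qM q'M col_mx0.
  have := mulmx0_rank_max e; rewrite (eqP (fr : \rank _ == _)).
  by rewrite -[X in _ <= X -> _]addn0 leq_add2l leqn0 mxrank_eq0 => /eqP.
have dot0 (u : 'rV['F_p]_2) g : dot u g = 0%R -> (u *m g = 0)%R.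
  by rewrite dotE => ->; rewrite raddf0.
have a0 : (dot q f' != 0)%R.
  by apply: contraNneq f'0 => /dot0 e; apply/eqP; apply: basis => //; apply: dot0.
have b0 : (dot q' f != 0)%R.
  by apply: contraNneq f_neq0 => /dot0 e; apply/eqP; apply: basis => //; apply: dot0.
(* In rank two the plane is the whole space. *)
have P1 : opp_proj f f' q q' = 1%:M%R.
  apply/eqP; rewrite -subr_eq0; apply/eqP; apply: basis.
    by rewrite mulmxBr mulmx1 opp_proj_q // subrr.
  by rewrite mulmxBr mulmx1 opp_proj_q' // subrr.
have [k kE] := natr_Fp ((dot q' f)^-1)%R; have [m mE] := natr_Fp (- (dot q f')^-1)%R.
pose w := c s ^+ k * t' ^+ m * c s ^+ k; pose z := w * w.
have Aw : w \in A by rewrite !groupM ?groupX.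
have Az : z \in A by rewrite groupM.
have zE : r2 z = (- 1%:M)%R.
  rewrite r2M // /w !r2M ?groupM ?groupX // (tvX r2M r21 _ tt) (tvX r2M r21 _ tt').
  rewrite kE mE scaleNr (opp_involution qf qf' a0 b0) P1 mulr2n opprD addrA.
  by rewrite subrr sub0r.
have tz (U V : {group gT}) : inv_under A U -> inv_under A V -> U \subset E ->
    V \subset U -> triv_on U V (c s) -> triv_on U V z.
  move=> iU iV sUE sVU tcs.
  have iU' b : b \in A -> {in U, forall x, b x \in U} by move=> Ab x; apply: iU.
  have tw : triv_on U V w.
    have tt2 : triv_on U V t' by exact: (triv_onJ sAutA sUE sVU iU iV Acs Aa tcs).
    apply: triv_onM (triv_onX _ _ tcs); rewrite ?iU' ?groupM ?groupX //.
    - by apply: iU'; rewrite groupM ?groupX.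
    - by apply: triv_onM; [apply: iU'; rewrite groupX | apply: triv_onX => //; apply: iU'
         | apply: triv_onX => //; apply: iU'].
    - exact: iU'.
  by apply: triv_onM => //; apply: iU'.
have tzE : triv_on E X z by apply: tz => //; apply: inv_E.
have tzP : triv_on Y Phi z.
  by apply: tz => //; [apply: inv_Phi | apply: subset_trans sYX sXE].
(* Serves twice: for [z * z] and for the commutator of [z] with [c s]. *)
have inI b : b \in A -> r2 b = 1%:M%R -> triv_on E X b -> triv_on Y Phi b -> b \in I.
  move=> Ab rb tb tb'; have tXY := triv2 _ Ab rb.
  apply: (chain_Inn iY iY iX sPY (subxx Y) sYX sXE Ab tb tXY _ tb') => x Yx.
  by rewrite groupM ?groupV ?iY.
clear tz; clearbody z; exists z => //; split=> //.
- move=> x Xx; rewrite -psi20 ?groupM ?iX // psi2M ?iX // r2P // zE mulmxN mulmx1.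
  by rewrite addNr.
- apply: inI; rewrite ?groupM //.
  + by rewrite r2M // zE mulmxN mulmx1 opprK.
  + by apply: triv_onM => //; move=> x; apply: inv_E.
  + by apply: triv_onM => //; move=> x; apply: iY.
have trV (U V : {group gT}) b : inv_under A U -> b \in A -> triv_on U V b ->
    triv_on U V b^-1.
  by move=> iU Ab tb; rewrite invg_expg; apply: triv_onX => // x; apply: iU.
have AR : [~ z, c s] \in A by rewrite groupR.
apply: inI => //.
- rewrite commgEl conjgE !r2M ?groupM ?groupV // -(r2M _ _ Az Acs) r2M // zE.
  rewrite mulNmx mul1mx mulmxN -r2M ?groupV // mulVg r21.
  by rewrite -zE -r2M ?groupV // mulVg.
- rewrite commgEl; apply: triv_onM; first by move=> x; apply: inv_E; rewrite groupV.
    by apply: trV => //; apply: inv_E.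
  exact: (triv_onJ sAutA (subxx E) sXE inv_E iX Az Acs tzE).
- have sYE := subset_trans sYX sXE.
  rewrite commgEl; apply: triv_onM; first by move=> x; apply: iY; rewrite groupV.
    exact: trV.
  exact: (triv_onJ sAutA sYE sPY iY inv_Phi Az Acs tzP).
Qed.

(** [W / Phi] is the plane of two opposite transvections, [C / Phi] its complement, and [z] acts as
    -1 on the first and 1 on the second. Normalising [Aut_S(E)] allows [z] to be lifted to [S]; the
    commutator condition makes the lift trivial on [S / E]. *)
Definition split_action := exists (W C : {group gT}) (z : {perm gT}),
 [/\ [/\ Phi \subset W, W \subset E, Phi \subset C, C \subset E & E \subset W * C],
     [/\ W :&: C \subset Phi, #|W : Phi| = (p ^ 2)%N & #|C : Phi| <= p],
     [/\ inv_under A W, inv_under A C,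
        (forall X : {group gT}, inv_under A X -> Phi \subset X -> X \subset W ->
           X :=: Phi \/ X :=: W) &
        ~~ ([~: W, S] \subset Phi)] &
     [/\ z \in A, z \in 'N(c @* S), {in W, forall x, z x * x \in Phi},
        triv_on C Phi z & {in S, forall s, [~ z, c s] \in I}]].

(** [W] and [C] are the preimages of the image and the kernel of the projection, which commutes with
    all of [A]. *)
Lemma tv_split t f q : tv A rho t f q -> split_action.
Proof.
move=> tt; have [H [sHA pHA kerH emb cov]] := block_hyps.
have [t' [f' [q' [tt' a0 b0 comP [z Az zE]]]]] :=
  transvection_plane p_pr rhoM rho1 sHA pHA kerH emb cov n3 tt.
have [At tE qf _ _] := tt; have [At' tE' qf' _ _] := tt'.
set Pj := opp_proj f f' q q' in comP zE.
have memE (R : 'rV['F_p]_n -> bool) : R 0%R ->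
    (forall u v, R u -> R v -> R (u + v)%R) ->
    group_set [set x in E | R (psi x)].
  move=> R0 RD; apply/group_setP; split; first by rewrite inE group1 (coord1 psi0).
  move=> x y; rewrite !inE => /andP[Ex Rx] /andP[Ey Ry].
  by rewrite groupM // psiM // RD.
have gW : group_set [set x in E | psi x *m Pj == psi x]%R.
  apply: (memE (fun v => v *m Pj == v)%R) => [|u v /eqP eu /eqP ev].
    by rewrite mul0mx.
  by rewrite mulmxDl eu ev.
have gC : group_set [set x in E | psi x *m Pj == 0]%R.
  apply: (memE (fun v => v *m Pj == 0)%R) => [|u v /eqP eu /eqP ev].
    by rewrite mul0mx.
  by rewrite mulmxDl eu ev addr0.
pose W := Group gW; pose C := Group gC.
have WP x : (x \in W) = (x \in E) && (psi x *m Pj == psi x)%R by rewrite inE.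
have CP x : (x \in C) = (x \in E) && (psi x *m Pj == 0)%R by rewrite inE.
have PjPj : (Pj *m Pj = Pj)%R := opp_proj_idem qf qf' a0 b0.
have sWE : W \subset E by apply/subsetP=> x; rewrite WP => /andP[].
have sCE : C \subset E by apply/subsetP=> x; rewrite CP => /andP[].
have PhiE x : x \in Phi -> x \in E /\ psi x = 0%R.
  by move=> Px; have Ex := subsetP (Phi_sub E) _ Px; split=> //; apply/eqP; rewrite psi0.
have sPW : Phi \subset W.
  by apply/subsetP=> x /PhiE[Ex x0]; rewrite WP Ex x0 mul0mx eqxx.
have sPC : Phi \subset C.
  by apply/subsetP=> x /PhiE[Ex x0]; rewrite CP Ex x0 mul0mx eqxx.
have iW : inv_under A W.
  move=> a x Aa; rewrite !WP => /andP[Ex /eqP xW]; rewrite inv_E //= rhoP //.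
  by rewrite -mulmxA comP // mulmxA xW.
have iC : inv_under A C.
  move=> a x Aa; rewrite !CP => /andP[Ex /eqP xC]; rewrite inv_E //= rhoP //.
  by rewrite -mulmxA comP // mulmxA xC mul0mx.
have sEWC : E \subset W * C.
  apply/subsetP=> x Ex; have [y Ey yE] := psi_onto (psi x *m Pj)%R.
  apply/mulsgP; exists y (y^-1 * x); rewrite ?mulKVg //.
    by rewrite WP Ey yE -mulmxA PjPj eqxx.
  by rewrite CP groupM ?groupV //= psiM ?groupV // psiV // yE mulmxDl mulNmx -mulmxA PjPj addNr.
have sWC : W :&: C \subset Phi.
  apply/subsetP=> x /setIP[]; rewrite WP CP => /andP[Ex /eqP xW] /andP[_ /eqP].
  by rewrite xW => x0; rewrite -psi0 // x0.
have span2 x : x \in W -> exists k m : 'F_p, psi x = (k *: q + m *: q')%R.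
  by rewrite WP => /andP[_ /eqP <-]; rewrite row_opp_proj //; do 2!eexists.
have iWPhi : #|W : Phi| = (p ^ 2)%N.
  pose g := @Morphism _ _ E psi psiM.
  have kg : 'ker g = Phi.
    apply/setP=> x; rewrite !inE; apply/andP/idP => [[Ex x0] | Px].
      by rewrite -psi0.
    by have [Ex x0] := PhiE _ Px; split=> //; apply/eqP.
  have <- : #|g @* W| = #|W : Phi| by rewrite card_morphim kg (setIidPr sWE).
  have -> : g @* W = [set (u.1 *: q + u.2 *: q')%R | u in [set: 'F_p * 'F_p]].
    apply/setP=> v; apply/morphimP/imsetP => [[x Ex Wx ->] | [[k m] _ ->] /=].
      by have [k [m e]] := span2 _ Wx; exists (k, m).
    have [x Ex xE] := psi_onto (k *: q + m *: q')%R; exists x => //.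
    by rewrite inE Ex xE mulmxDl -!scalemxAl opp_proj_q // opp_proj_q' // eqxx.
  rewrite card_in_imset ?cardsT ?card_prod ?card_Fp ?mulnn // => -[k m] [k' m'] _ _ /= e.
  have /eqP := congr1 (fun v => dot v f') e; rewrite !dotDl !dotZl qf' !mulr0 !addr0.
  move/eqP/(mulIf a0) => ->.
  have /eqP := congr1 (fun v => dot v f) e; rewrite !dotDl !dotZl qf !mulr0 !add0r.
  by move/eqP/(mulIf b0) => ->.
have iCPhi : #|C : Phi| <= p.
  have := mul_cardG W C; have eWC : W * C = E.
    by apply/eqP; rewrite eqEsubset sEWC mul_subG.
  have -> : #|W :&: C| = #|Phi|.
    by apply/eqP; rewrite eqn_leq !subset_leq_card // subsetI sPW.
  rewrite eWC -(Lagrange sPW) -(Lagrange sPC) -(Lagrange (Phi_sub E)) iWPhi iPhi.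
  have P0 : 0 < #|Phi| by apply: cardG_gt0.
  move=> e; have : (p ^ 2 * #|C : Phi| = p ^ n)%N.
    apply/eqP; rewrite -(eqn_pmul2l (_ : 0 < #|Phi| * #|Phi|)%N) ?muln_gt0 ?P0 //.
    by apply/eqP; apply: muln_regroup e.
  move=> e'; rewrite -(leq_pmul2l (_ : 0 < p ^ 2)%N) ?expn_gt0 ?prime_gt0 // e'.
  by rewrite -expnSr leq_exp2l ?prime_gt1.
have rc a : a \in A -> (rho a *m (1%:M - Pj *+ 2) = (1%:M - Pj *+ 2) *m rho a)%R.
  move=> Aa; rewrite mulmxBr mulmxBl mulmx1 mul1mx !mulr2n mulmxDr mulmxDl.
  by rewrite comP.
have zcomm a : a \in A -> [~ z, a] \in I.
  move=> Aa; apply/ker_rho; first by rewrite groupR.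
  rewrite commgEl conjgE !rhoM ?groupM ?groupV // -(rhoM Az) //.
  have rzV : (rho z^-1 *m rho z = 1%:M)%R by rewrite -rhoM ?groupV // mulVg.
  have raV : (rho a^-1 *m rho a = 1%:M)%R by rewrite -rhoM ?groupV // mulVg.
  by rewrite (rhoM Az Aa) zE -rc // -zE (mulmxA (rho a^-1)) raV mul1mx rzV.
exists W, C, z; split; split=> //.
- move=> X iX sPX sXW; have [sXP|/subsetPn[x Xx nPx]] := boolP (X \subset Phi).
    by left; apply/eqP; rewrite eqEsubset sXP.
  right; apply/eqP; rewrite eqEsubset sXW /=.
  have sXE := subset_trans sXW sWE; have Ex := subsetP sXE _ Xx.
  pose inX v := exists2 y, y \in X & psi y = v.
  have inXB a v : a \in A -> inX v -> inX (v *m (rho a - 1%:M))%R.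
    move=> Aa [y Xy <-]; exists (y^-1 * a y); last by rewrite psi_act // (subsetP sXE).
    by rewrite groupM ?groupV ?iX.
  have inXZ k v : k != 0%R -> inX (k *: v)%R -> inX v.
    move=> k0 [y Xy yE]; exists (y ^+ val (k^-1)%R); first by rewrite groupX.
    by rewrite (coordX psiM psi0) ?(subsetP sXE) // yE -scaler_nat natr_Zp scalerA mulVf // scale1r.
  have actT v : (v *m (rho t - 1%:M) = dot v f *: q)%R.
    by rewrite tE addrC addKr row_rank1.
  have actT' v : (v *m (rho t' - 1%:M) = dot v f' *: q')%R.
    by rewrite tE' addrC addKr row_rank1.
  have Xx' : inX (psi x) by exists x.
  (* A nonzero vector of the plane is moved by [t] or by [t'], which produces [q] or [q']; the other
     transvection then produces the remaining one. *)
  have [Xq Xq'] : inX q /\ inX q'.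
    have [e|e] := eqVneq (dot (psi x) f) 0%R; last first.
      have Xq : inX q by apply: (inXZ _ _ e); rewrite -actT; apply: inXB.
      by split=> //; apply: (inXZ _ _ a0); rewrite -actT'; apply: inXB.
    have [e'|e'] := eqVneq (dot (psi x) f') 0%R; last first.
      have Xq' : inX q' by apply: (inXZ _ _ e'); rewrite -actT'; apply: inXB.
      by split=> //; apply: (inXZ _ _ b0); rewrite -actT; apply: inXB.
    case/negP: nPx; rewrite -psi0 //; have := subsetP sXW _ Xx.
    by rewrite WP Ex row_opp_proj // e e' !mulr0 !scale0r addr0 eq_sym.
  apply/subsetP=> w Ww; have [k [m wE]] := span2 _ Ww.
  have [y Xy yq] := Xq; have [y' Xy' yq'] := Xq'.
  pose u := y ^+ val k * y' ^+ val m.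
  have Xu : u \in X by rewrite groupM ?groupX.
  have sX := subsetP sXE; have Ew := subsetP sWE _ Ww.
  rewrite -(mulgKV u w) groupM // (subsetP sPX) // -(coord_eq psiM psi0) // ?sX //.
  rewrite psiM ?groupX ?sX // !(coordX psiM psi0) ?sX // yq yq' -2!scaler_nat.
  by rewrite !natr_Zp wE.
(* [C / Phi] is central in any case, so an [S] centralising [W / Phi] would be trivial on [E / Phi]
   and contained in [E]. *)
- apply/negP=> sWS; have [s Ss nEs] := ex_outer.
  case/negP: nEs; apply: mem_conj_Inn => //; apply: triv_Inn; first exact: conj_aut_mem.
  have sCS : [~: C, S] \subset Phi.
    by apply: pgroup_comm_index pS (inv_normal inv_Phi (Phi_sub E)) (inv_normal iC sCE) sPC _.
  move=> e Ee; rewrite comm_E //; have /mulsgP[w d Ww Cd ->] := subsetP sEWC _ Ee.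
  rewrite commMgJ; apply: groupM; last by rewrite (subsetP sCS) ?mem_commg.
  rewrite memJ_norm ?(subsetP sWS) ?mem_commg //.
  by rewrite (subsetP (gFnorm _ _)) // (subsetP sCE).
- rewrite inE; apply/subsetP=> _ /imsetP[_ /morphimP[s nEs Ss ->] ->].
  rewrite -(mulKVg (c s) (c s ^ z)) -commgEl groupM //; first exact: mem_morphim.
  rewrite -groupV invg_comm; apply: (subsetP (morphimS _ sES)).
  exact: zcomm (conj_aut_mem Ss).
- move=> x Wx; have Ex := subsetP sWE _ Wx; have := Wx; rewrite WP Ex /= => /eqP xW.
  rewrite -psi0 ?groupM ?inv_E // psiM ?inv_E // rhoP // zE mulmxBr mulmx1.
  by rewrite mulr2n mulmxDr xW opprD addrA subrr sub0r addNr.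
- move=> x Cx; have Ex := subsetP sCE _ Cx; have := Cx; rewrite CP Ex /= => /eqP xC.
  rewrite -psi0 ?groupM ?groupV ?inv_E // psi_act // zE addrC addrA addNr sub0r.
  by rewrite mulmxN mulr2n mulmxDr xC addr0 oppr0.
- by move=> s Ss; apply: zcomm (conj_aut_mem Ss).
Qed.

(** As [S] centralises [C / Phi], an element centralising [W / Phi] is trivial on [E / Phi] and lies
    in [E]. So [index_centralizer_p2] can be applied to the rank two section [W / Phi]. *)
Lemma split_index : split_action -> #|S : E| = p.
Proof.
case=> W [C [z [[sPW sWE sPC sCE sEWC] [sWC iW iC] [invW invC _ _] _]]].
have [s0 Ss0 nEs0] := ex_outer.
have le_p : #|S : E| <= p.
  have nWS := inv_normal invW sWE; have nPS := inv_normal inv_Phi (Phi_sub E).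
  have [X [nXS sPX sXW iX]] := pgroup_flag (r := 1) p_pr pS nPS nWS sPW iW isT.
  have iWX : #|W : X| = p.
    have := Lagrange_index sXW sPX; rewrite iW iX expn1 => /eqP.
    by rewrite expnS expn1 eqn_pmul2r ?prime_gt0 // => /eqP.
  apply: (index_centralizer_p2 p_pr pS sES (Phi_sub E) nWS nXS nPS sPX sXW iWX).
    by rewrite iX expn1.
  move=> s Ss Ws; apply: mem_conj_Inn => //; apply: triv_Inn; first exact: conj_aut_mem.
  have sCS : [~: C, S] \subset Phi.
    by apply: pgroup_comm_index pS (inv_normal inv_Phi (Phi_sub E)) (inv_normal invC sCE) sPC _.
  move=> e Ee; rewrite comm_E //; have /mulsgP[w d Ww Cd ->] := subsetP sEWC _ Ee.
  rewrite commMgJ; apply: groupM; last by rewrite (subsetP sCS) ?mem_commg.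
  rewrite memJ_norm ?Ws //.
  by rewrite (subsetP (gFnorm _ _)) // (subsetP sCE).
have [e|//] := pgroup_indexP p_pr pS sES le_p.
by case/negP: nEs0; move/eqP: e; rewrite indexg_eq1 => /subsetP->.
Qed.

(** The two failing inclusions say that [S] acts uniserially along the flag of [X1] and [X2], with a
    Jordan block of full size three. *)
Definition irreducible_action :=
 [/\ #|E : Phi| = (p ^ 3)%N,
  (forall X : {group gT}, inv_under A X -> Phi \subset X -> X \subset E ->
     X :=: Phi \/ X :=: E) &
  exists X1 X2 : {group gT}, [/\ X1 <| S, X2 <| S, Phi \subset X1, X1 \subset X2 & X2 \subset E] /\
  [/\ #|E : X2| = p, #|X2 : X1| = p, #|X1 : Phi| = p, ~~ ([~: E, S] \subset X1) &
      ~~ ([~: X2, S] \subset Phi)]].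

(** * The action in the absence of transvections *)

Section NoTransvection.
Hypothesis notv : forall a f q, ~ tv A rho a f q.

Lemma notv_line s (w : 'rV['F_p]_n) : s \in S ->
  {in E, forall x, exists k : 'F_p, psi (x^-1 * c s x) = (k *: w)%R} -> s \in E.
Proof.
move=> Ss line; apply/negPn/negP=> nEs.
have [|f [q tt]] := @line_tv (c s) w (conj_aut_mem Ss) (conj_aut_p Ss) _ line.
  by apply: contra nEs => /(mem_conj_Inn Ss).
exact: notv tt.
Qed.

(** Commutators with [s] fill at most a line modulo [Phi(E)], so outside [E] such an [s] would be a
    transvection. *)
Lemma notv_sub (X1 : {group gT}) s : X1 <| S -> Phi \subset X1 -> X1 \subset E -> #|X1 : Phi| <= p ->
  s \in S -> {in E, forall x, [~ x, s] \in X1} -> s \in E.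
Proof.
move=> n1S sP1 s1E i1 Ss triv.
have nP1 : Phi <| X1 by apply: normalS sP1 s1E (Phi_normal E).
case: (pgroup_indexP p_pr (pgroupS s1E pE) sP1 i1) => [/eqP|ip].
  rewrite indexg_eq1 => s1P; apply: (@notv_line s 0%R) => // x Ex; exists 0%R.
  apply/eqP; rewrite comm_E // scaler0 psi0 ?(subsetP s1E) ?triv //.
  exact: (subsetP s1P) (triv _ Ex).
have [x0 X0 nPx0] : exists2 x, x \in X1 & x \notin Phi.
  by apply/subsetPn; rewrite -indexg_eq1 ip; apply: contraTneq p_pr => ->.
apply: (@notv_line s (psi x0)) => // x Ex.
have [k xk] := prime_index_gen p_pr nP1 ip X0 nPx0 (triv _ Ex).
exists (k%:R)%R; apply/eqP.
rewrite comm_E // scaler_nat -(coordX psiM psi0) ?(subsetP s1E) //.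
by rewrite (coord_eq psiM psi0) ?groupX // (subsetP s1E) ?triv.
Qed.

(** Dual to [notv_sub]: an [s] centralising a hyperplane moves [E] along the single vector
    [[e, s]]. *)
Lemma notv_quo (X2 : {group gT}) s : X2 <| S -> Phi \subset X2 -> X2 \subset E -> #|E : X2| <= p ->
  s \in S -> {in X2, forall x, [~ x, s] \in Phi} -> s \in E.
Proof.
move=> n2S sP2 s2E i2 Ss triv; have Ac := conj_aut_mem Ss.
have n2E : X2 <| E by apply: normalS s2E sES n2S.
have killed x : x \in X2 -> (psi x *m (rho (c s) - 1%:M) = 0)%R.
  move=> X2x; have Ex := subsetP s2E _ X2x; rewrite -psi_act // comm_E //.
  by apply/eqP; rewrite psi0 ?triv // (subsetP (Phi_sub E)) ?triv.
case: (pgroup_indexP p_pr pE s2E i2) => [/eqP|ip].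
  rewrite indexg_eq1 => sE2; apply: (@notv_line s 0%R) => // x Ex; exists 0%R.
  by rewrite psi_act // killed ?scaler0 // (subsetP sE2).
have [e Ee n2e] : exists2 e, e \in E & e \notin X2.
  by apply/subsetPn; rewrite -indexg_eq1 ip; apply: contraTneq p_pr => ->.
apply: (@notv_line s (psi (e^-1 * c s e))) => // x Ex.
have [k xk] := prime_index_gen p_pr n2E ip Ee n2e Ex; exists (k%:R)%R.
rewrite !psi_act // -(mulgKV (e ^+ k) x) psiM; last 2 first.
- exact: (subsetP s2E).
- exact: groupX.
by rewrite mulmxDl killed // add0r (coordX psiM psi0) // -scaler_nat -scalemxAl.
Qed.

(** In rank at most two, some [X] has both [E / X] and [X / Phi(E)] of order at most [p]. Then
    [[E, S]] lies in [X], and [notv_sub] puts all of [S] into [E]. *)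
Lemma notv_rank3 : n = 3.
Proof.
apply/eqP; rewrite eqn_leq n3 ltnNge /=; apply/negP=> n2.
have [s Ss nEs] := ex_outer.
have nPS := inv_normal inv_Phi (Phi_sub E).
(* The minimum covers the degenerate rank 0. *)
have [X [nXS sPX sXE iX]] := pgroup_flag (r := minn n 1) p_pr pS nPS nES (Phi_sub E) iPhi (geq_minl _ _).
case/negP: nEs; apply: (notv_sub nXS sPX sXE _ Ss).
  by rewrite iX -{2}[p]expn1 leq_exp2l ?prime_gt1 ?geq_minr.
move=> x Ex; have := Lagrange_index sXE sPX; rewrite iPhi iX => e.
have iEX : #|E : X| <= p.
  have P0 : 0 < (p ^ minn n 1)%N by rewrite expn_gt0 prime_gt0.
  rewrite -(leq_pmul2r P0) e -expnS leq_exp2l ?prime_gt1 //.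
  by case: (n) n2 => [|[|[|]]].
by rewrite (subsetP (pgroup_comm_index p_pr pS nXS nES sXE iEX)) ?mem_commg.
Qed.

Lemma notv_flag (X1 X2 : {group gT}) : X1 <| S -> X2 <| S -> Phi \subset X1 -> X1 \subset X2 ->
  X2 \subset E -> #|E : X2| = p -> #|X2 : X1| = p -> #|X1 : Phi| = p ->
  [/\ #|S : E| <= p, ~~ ([~: E, S] \subset X1) & ~~ ([~: X2, S] \subset Phi)].
Proof.
move=> n1 n2 sP1 s12 s2E i2 i1 iP; have [s0 Ss0 nEs0] := ex_outer.
have s1E := subset_trans s12 s2E; have sP2 := subset_trans sP1 s12.
have i1' : #|X1 : Phi| <= p by rewrite iP.
have i2' : #|E : X2| <= p by rewrite i2.
split.
- apply: (index_centralizer_p2 p_pr pS sES s1E nES n2 n1 s12 s2E i2 i1) => s Ss.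
  exact: (notv_sub n1 sP1 s1E i1' Ss).
- apply: contra nEs0 => sE1; apply: (notv_sub n1 sP1 s1E i1' Ss0) => x Ex.
  by rewrite (subsetP sE1) ?mem_commg.
- apply: contra nEs0 => sE1; apply: (notv_quo n2 sP2 s2E i2' Ss0) => x Ex.
  by rewrite (subsetP sE1) ?mem_commg.
Qed.

(* In both cases below the element z negates exactly the rank 2 section, so that
   [E, s] is contained in a line, making s a transvection. *)
Lemma notv_irr (X : {group gT}) : inv_under A X -> Phi \subset X -> X \subset E ->
  X :=: Phi \/ X :=: E.
Proof.
move=> iX sPX sXE; have nPS := inv_normal inv_Phi (Phi_sub E).
have nXS := inv_normal iX sXE; have [s Ss nEs] := ex_outer.
have Acs := conj_aut_mem Ss; have e3 := Lagrange_index sXE sPX.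
rewrite iPhi notv_rank3 in e3.
have two_neq0 : (2%:R != 0 :> 'F_p)%R.
  rewrite -(dvdn_pcharf (pchar_Fp p_pr)) dvdn_prime2 //.
  by apply: contraTneq p_odd => ->.
have half (u v : 'rV['F_p]_n) : (u *+ 2 = v)%R -> u = (2%:R^-1 *: v)%R.
  by move=> <-; rewrite -scaler_nat scalerA mulVf // scale1r.
have [i [iXP le_i3]] : exists i, #|X : Phi| = (p ^ i)%N /\ i <= 3.
  have : #|X : Phi| %| p ^ 3 by rewrite -e3 dvdn_mull.
  by case/(dvdn_pfactor _ _ p_pr)=> i le_i ->; exists i.
have iEX : #|E : X| = (p ^ (3 - i))%N.
  apply/eqP; rewrite -(eqn_pmul2r (_ : 0 < #|X : Phi|)) // e3 iXP -expnD.
  by rewrite subnK.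
have yact u x : u \in A -> x \in E -> (psi x *m (rho u - 1%:M) = psi (x^-1 * u x))%R.
  by move=> Au Ex; rewrite psi_act.
have killP x : x \in Phi -> psi x = 0%R.
  by move=> Px; apply/eqP; rewrite psi0 // (subsetP (Phi_sub E)).
have comm z : z \in A -> [~ z, c s] \in I ->
    (rho z *m rho (c s) = rho (c s) *m rho z)%R.
  move=> Az /ker_rho; rewrite groupR // => /(_ isT) e.
  rewrite -!rhoM // [z * c s]commgC.
  by rewrite (rhoM (groupM Acs Az) (groupR Az Acs)) e mulmx1.
case: i iXP iEX le_i3 => [|[|[|[|//]]]] iXP iEX _.
- left; apply/eqP; rewrite eqEsubset sPX andbT -indexg_eq1 iXP //.
- case/negP: nEs.
  have [L [nLS sXL sLE iLX]] := pgroup_flag (r := 1) p_pr pS nXS nES sXE iEX isT.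
  have iEL : #|E : L| = p.
    apply/eqP; rewrite -(eqn_pmul2r (_ : 0 < #|L : X|)) // Lagrange_index //.
    by rewrite iEX iLX expn1 mulnn.
  rewrite expn1 in iLX iXP.
  apply/negPn/negP=> nEs.
  have [||z Az [zE _ zX zz zc]] := section_involution inv_E iX nLS sPX sXL sLE (subxx E) iEL iLX _ _ Ss nEs.
  + by rewrite indexgg prime_gt0.
  + by rewrite iXP.
  case/negP: nEs.
  have [l Ll nXl] : exists2 l, l \in L & l \notin X.
    by apply/subsetPn; rewrite -indexg_eq1 iLX; apply: contraTneq p_pr => ->.
  have El := subsetP sLE _ Ll.
  have nXL : X <| L by apply: normalS sXL (normal_sub nLS) nXS.
  apply: (@notv_line s (2%:R^-1 *: (psi l *m (1%:M - rho z)))%R) => // e Ee.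
  have Lce : e^-1 * c s e \in L.
    rewrite comm_E // (subsetP (pgroup_comm_index p_pr pS nLS nES sLE _)) ?iEL //.
    by rewrite mem_commg.
  set y := e^-1 * c s e in Lce *.
  have [k yk] := prime_index_gen p_pr nXL iLX Ll nXl Lce.
  pose u := y * l ^- k; have Eu : u \in E by apply: (subsetP sXE).
  have yE : psi y = (psi u + psi l *+ k)%R.
    by rewrite -(coordX psiM psi0) // -psiM ?groupX // mulgKV.
  (* [1 + z] maps [e] into [X], which [s] centralises modulo [Phi(E)]. As [z] and [s] commute,
     [1 + z] kills [y], so [2 y = y (1 - z)]; this is a multiple of [l (1 - z)] because [1 - z]
     kills [X]. *)
  have ym : (psi y *m (1%:M + rho z) = 0)%R.
    rewrite /y -yact // -mulmxA.
    have -> : ((rho (c s) - 1%:M) *m (1%:M + rho z) =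
             (1%:M + rho z) *m (rho (c s) - 1%:M))%R.
      by rewrite mulmxBl mulmxBr mulmxDl mulmxDr !mulmx1 !mul1mx comm.
    rewrite mulmxA; have -> : (psi e *m (1%:M + rho z) = psi (z e * e))%R.
      by rewrite mulmxDr mulmx1 psiM ?inv_E // rhoP // addrC.
    have Xw := zE _ Ee; have Ew := subsetP sXE _ Xw.
    rewrite yact // killP // comm_E //.
    rewrite (subsetP (pgroup_comm_index p_pr pS nPS nXS sPX _)) ?iXP //.
    by rewrite mem_commg.
  have um : (psi u *m (1%:M - rho z) = 0)%R.
    apply/eqP; rewrite -oppr_eq0 -mulmxN opprB yact // killP // zX //.
  exists (k%:R)%R; rewrite scalerA mulrC -scalerA scaler_nat; apply: half.
  have -> : (psi y *+ 2 = psi y *m (1%:M - rho z))%R.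
    rewrite mulr2n mulmxBr mulmx1; congr (_ + _)%R; apply/eqP; rewrite -addr_eq0.
    by move/eqP: ym; rewrite mulmxDr mulmx1.
  by rewrite yE mulmxDl um add0r -[(psi l *+ k)%R]scaler_nat -scalemxAl scaler_nat.
- case/negP: nEs.
  have [L [nLS sPL sLX iLP]] := pgroup_flag (r := 1) p_pr pS nPS nXS sPX iXP isT.
  have iXL : #|X : L| = p.
    apply/eqP; rewrite -(eqn_pmul2r (_ : 0 < #|L : Phi|)) // Lagrange_index //.
    by rewrite iXP iLP expn1 mulnn.
  rewrite expn1 in iLP iEX.
  apply/negPn/negP=> nEs.
  have [||z Az [zX zE _ zz zc]] := section_involution iX inv_Phi nLS (subxx _) sPL sLX sXE iXL iLP _ _ Ss nEs.
  + by rewrite iEX.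
  + by rewrite indexgg prime_gt0.
  case/negP: nEs.
  have [l Ll nXl] : exists2 l, l \in L & l \notin Phi.
    by apply/subsetPn; rewrite -indexg_eq1 iLP; apply: contraTneq p_pr => ->.
  have sLE := subset_trans sLX sXE; have El := subsetP sLE _ Ll.
  have nPL : Phi <| L by apply: normalS sPL sLE (Phi_normal E).
  apply: (@notv_line s (psi l)) => // e Ee.
  have Xce : e^-1 * c s e \in X.
    rewrite comm_E // (subsetP (pgroup_comm_index p_pr pS nXS nES sXE _)) ?iEX //.
    by rewrite mem_commg.
  set y := e^-1 * c s e in Xce *.
  pose u := e^-1 * z e; have Xu : u \in X by apply: zE.
  have Eu := subsetP sXE _ Xu; pose v := u^-1 * c s u.
  have Lv : v \in L.
    rewrite /v comm_E // (subsetP (pgroup_comm_index p_pr pS nLS nXS sLX _)) ?iXL //.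
    by rewrite mem_commg.
  have [k vk] := prime_index_gen p_pr nPL iLP Ll nXl Lv.
  have vE : psi v = (psi l *+ k)%R.
    have Ev := subsetP sLE _ Lv.
    by apply/eqP; rewrite -(coordX psiM psi0) // (coord_eq psiM psi0) ?groupX.
  (* Since [z] and [s] commute, [[[e, z], s]], which lies in [L], equals [[[e, s], z]], which is
     [-2 y] as [z] inverts [X / Phi(E)]. *)
  have yy : (- (psi y *+ 2) = psi l *+ k)%R.
    rewrite -vE /v -(yact _ _ Acs Eu) /u -(yact _ _ Az Ee) -mulmxA.
    have -> : ((rho z - 1%:M) *m (rho (c s) - 1%:M) =
             (rho (c s) - 1%:M) *m (rho z - 1%:M))%R.
      rewrite !mulmxBl !mulmxBr !mulmx1 !mul1mx comm // !opprB !addrA.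
      by rewrite -!addrA; congr (_ + _)%R; rewrite addrC -addrA [RHS]addrCA.
    rewrite mulmxA yact // -/y mulmxBr mulmx1.
    have : psi (z y * y) = 0%R by apply: killP; apply: zX.
    rewrite psiM ?inv_E ?(subsetP sXE) // rhoP ?(subsetP sXE) // => /eqP.
    by rewrite addr_eq0 => /eqP ->; rewrite mulr2n opprD.
  exists (- (2%:R^-1 * k%:R))%R; rewrite scaleNr -scalerA scaler_nat -yy scalerN opprK.
  exact: half.
- right; apply/eqP; rewrite eqEsubset sXE -indexg_eq1 iEX //.
Qed.

Lemma notv_irreducible : irreducible_action /\ #|S : E| = p.
Proof.
have e3 := iPhi; rewrite notv_rank3 in e3.
have nPS := inv_normal inv_Phi (Phi_sub E).
have [X1 [n1 sP1 s1E i1]] := pgroup_flag (r := 1) p_pr pS nPS nES (Phi_sub E) e3 isT.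
have iE1 : #|E : X1| = (p ^ 2)%N.
  apply/eqP; rewrite -(eqn_pmul2r (_ : 0 < #|X1 : Phi|)) // Lagrange_index //.
  by rewrite e3 i1 -expnD.
have [X2 [n2 s12 s2E i2]] := pgroup_flag (r := 1) p_pr pS n1 nES s1E iE1 isT.
have iE2 : #|E : X2| = p.
  apply/eqP; rewrite -(eqn_pmul2r (_ : 0 < #|X2 : X1|)) // Lagrange_index //.
  by rewrite iE1 i2 expn1 mulnn.
rewrite expn1 in i1 i2.
have [iS nE1 nE2] := notv_flag n1 n2 sP1 s12 s2E iE2 i2 i1.
split; first split=> //; first exact: notv_irr.
  by exists X1, X2.
have [e|//] := pgroup_indexP p_pr pS sES iS.
have [s Ss] := ex_outer; move/eqP: e; rewrite indexg_eq1 => /subsetP/(_ _ Ss) Es.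
by rewrite Es.
Qed.

End NoTransvection.

End EssentialAction.

Section Structure.
Local Open Scope group_scope.
Variables (p : nat) (gT : finGroupType).
Hypothesis p_pr : prime p.

Lemma grank_Frattini_index (G : {group gT}) k : p.-group G -> 'm(G) <= k ->
  exists2 n, #|G : 'Phi(G)| = (p ^ n)%N & n <= k.
Proof.
move=> pG mG; have ab := Phi_quotient_abelem pG.
have nP : G \subset 'N('Phi(G)) by apply: gFnorm.
exists (logn p #|G / 'Phi(G)|).
  by rewrite -card_quotient //; apply: card_pgroup; apply: quotient_pgroup.
rewrite -(rank_abelem ab) -(grank_abelian (abelem_abelian ab)).
by apply: leq_trans mG; apply: quotient_grank.
Qed.

Variables (S E : {group gT}) (A : {group {perm gT}}).
Hypotheses (p_odd : odd p) (pS : p.-group S) (nES : E <| S).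
Hypotheses (cES : 'C_S(E) \subset E) (sAutA : A \subset Aut E).
Hypothesis sylP : p.-Sylow(A) (conj_aut E @* S).
Hypothesis spe : has_strongly_p_embedded p (A / (conj_aut E @* E)).
Hypothesis rkE : 'm(E) <= 3.

Lemma essential_structure :
  #|S : E| = p /\ (split_action p S E A \/ irreducible_action p S E A).
Proof.
have pE : p.-group E := pgroupS (normal_sub nES) pS.
have [n iPhi n3] := grank_Frattini_index pE rkE.
have [psi [psiM psi0 psi_onto]] := section_coord p_pr (Phi_normal E)
  (Phi_quotient_abelem pE) iPhi.
have actA : {in A, forall a : {perm gT}, acts_on_section E 'Phi(E)%G a}.
  move=> a Aa; split=> [|x|x].
  - exact: AutM (subsetP sAutA _ Aa).
  - exact: (inv_E sAutA).
  - exact: (inv_Phi sAutA).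
have [rho [rhoP rhoM rho1]] := coord_repr (Phi_normal E) psiM psi0 psi_onto actA.
case: (pboolP (exists a f q, tv A rho a f q)) => [[a [f [q tt]]] | notv].
  have sp : split_action p S E A.
    exact: (tv_split p_pr pS nES cES sAutA sylP spe iPhi n3 psiM psi0 psi_onto rhoP rhoM rho1 tt).
  split; last by left.
  exact: (split_index p_pr pS nES cES sAutA sylP spe sp).
have notv' a f q : ~ tv A rho a f q by move=> tt; case: notv; exists a, f, q.
have [irr iS] := notv_irreducible p_pr p_odd pS nES cES sAutA sylP spe iPhi n3 psiM psi0
  psi_onto rhoP rhoM rho1 notv'.
by split=> //; right.
Qed.

End Structure.

(** * Types of essential subgroups *)

Lemma muln_cancel2 (a b c d : nat) :
  0 < a -> 0 < c -> (a * b * c = c * d * a -> b = d)%N.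
Proof.
move=> a0 c0 e; apply/eqP; rewrite -(eqn_pmul2l (_ : 0 < a * c)%N) ?muln_gt0 ?a0 //.
by rewrite mulnAC e mulnC mulnA.
Qed.

Section Types.
Local Open Scope group_scope.
Variables (p : nat) (gT : finGroupType).

(* The three possible configurations for [E], with [D] the intersection of the two essential
   subgroups: in type N the moved section is [E / K] and in type B it is [D / Phi(E)], both of
   rank two and inverted by the lift [t] of a central involution; in type A the whole of
   [E / Phi(E)], of rank three, is irreducible and [S] has a Jordan block of size three on it. *)
Definition negates (X Y : {group gT}) (a : {perm gT}) := {in X, forall x, x * a x \in Y}.

Definition typeN (S E : {group gT}) (A : {group {perm gT}}) (D K : {group gT}) t :=
  [/\ [/\ 'Phi(E) \subset K, K \subset D, K <| S & #|D : K| = p],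
      [/\ inv_under A K,
         (forall X : {group gT}, inv_under A X -> K \subset X -> X \subset E ->
            X :=: K \/ X :=: E),
         ~~ ([~: E, S] \subset K) & [~: K, S] \subset 'Phi(E)] &
      [/\ negates E K t, triv_on S E t & triv_on K 'Phi(E)%G t]].

Definition typeA (S E : {group gT}) (A : {group {perm gT}}) (D Y : {group gT}) :=
  [/\ #|E : 'Phi(E)| = (p ^ 3)%N,
      (forall X : {group gT}, inv_under A X -> 'Phi(E) \subset X -> X \subset E ->
            X :=: 'Phi(E) \/ X :=: E),
      [/\ Y <| S, 'Phi(E) \subset Y, Y \subset D, #|D : Y| = p & #|Y : 'Phi(E)| = p] &
      ~~ ([~: E, S] \subset Y) /\ ~~ ([~: D, S] \subset 'Phi(E))].

Definition typeB (S E : {group gT}) (A : {group {perm gT}}) (D : {group gT}) t :=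
  [/\ inv_under A D, 'Phi(E) \subset D /\ #|D : 'Phi(E)| = (p ^ 2)%N,
      (forall X : {group gT}, inv_under A X -> 'Phi(E) \subset X -> X \subset D ->
            X :=: 'Phi(E) \/ X :=: D),
      ~~ ([~: D, S] \subset 'Phi(E)) &
      [/\ triv_on S E t, triv_on E D t & negates D 'Phi(E)%G t]].

Hypothesis p_pr : prime p.
Hypothesis p_odd : odd p.

(** An element of odd order is a power of its square. *)
Lemma sqr_mem (S Y : {group gT}) x : p.-group S -> x \in S -> x * x \in Y -> x \in Y.
Proof.
move=> pS Sx Yxx; have o_odd : odd #[x].
  have [k ->] := p_natP (mem_p_elt pS Sx); by rewrite oddX p_odd orbT.
have -> : x = (x ^+ 2) ^+ (#[x].+1)./2.
  by rewrite -expgM mul2n halfK /= o_odd subn0 expgS expg_order mulg1.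
by rewrite groupX.
Qed.

(** Dividing [x * a x] by [x^-1 * a x] leaves [x * x]. Several comparisons of types end here. *)
Lemma sign_conflict (S X Y : {group gT}) a : p.-group S -> X \subset S ->
  triv_on X Y a -> negates X Y a -> X \subset Y.
Proof.
move=> pS sXS ta na; apply/subsetP=> x Xx; apply: (sqr_mem pS); first exact: (subsetP sXS).
have -> : x * x = x * a x * (x^-1 * a x)^-1 by rewrite invMg invgK mulgA mulgK.
by rewrite groupM ?groupV ?na ?ta.
Qed.

Lemma prime_index_sub (A B X : {group gT}) : #|B : A| = p -> A \subset X -> X \subset B ->
  X :=: A \/ X :=: B.
Proof.
move=> iBA sAX sXB; have := Lagrange_index sXB sAX; rewrite iBA => e.
have: #|B : X| %| p by rewrite -e dvdn_mulr.
case/primeP: p_pr => _ pp /pp /orP[|/eqP ep].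
  by rewrite indexg_eq1 => sBX; right; apply/eqP; rewrite eqEsubset sXB.
move/eqP: e; rewrite ep -{2}[p]muln1 eqn_pmul2l ?prime_gt0 // indexg_eq1 => sXA.
by left; apply/eqP; rewrite eqEsubset sAX sXA.
Qed.

Lemma prime_index_mul (A B W : {group gT}) : A <| B -> #|B : A| = p -> W \subset B ->
  ~~ (W \subset A) -> W * A = B.
Proof.
move=> nAB iBA sWB nWA; have [sAB nA] := andP nAB.
have eJ : W <*> A = W * A by rewrite norm_joinEl // (subset_trans sWB).
have [|eA|//] := prime_index_sub iBA (joing_subr W A).
- by rewrite join_subG sWB.
- by case/negP: nWA; move: (joing_subl W A); rewrite [W <*> A]eA.
- by rewrite -eJ.
Qed.

Variables (S E : {group gT}) (A : {group {perm gT}}) (B : {set {perm gT}}).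
Hypotheses (pS : p.-group S) (nES : E <| S).
Hypotheses (cES : 'C_S(E) \subset E) (sAutA : A \subset Aut E).
Hypothesis sylP : p.-Sylow(A) (conj_aut E @* S).
Hypothesis spe : has_strongly_p_embedded p (A / (conj_aut E @* E)).
Hypothesis sBAut : B \subset Aut S.
Hypothesis ext : forall z, z \in A -> z \in 'N(conj_aut E @* S) ->
  exists2 t, t \in B & {in E, forall x, t x = z x}.
Variable D : {group gT}.
Hypotheses (nDS : D <| S) (sDE : D \subset E) (iED : #|E : D| = p).
Hypothesis invD : {in B & D, forall (t : {perm gT}) x, t x \in D}.
Hypothesis invE : {in B & E, forall (t : {perm gT}) x, t x \in E}.

Let sES := normal_sub nES.
Let nDE : D <| E. Proof. exact: normalS sDE sES nDS. Qed.
Let pE : p.-group E := pgroupS sES pS.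

Lemma Phi_sub_D : 'Phi(E) \subset D.
Proof.
by apply: Phi_sub_max; apply: p_index_maximal; rewrite ?iED.
Qed.

Lemma comm_E_D : [~: E, S] \subset D.
Proof. by apply: (pgroup_comm_index p_pr pS nDS nES sDE); rewrite iED. Qed.

(** [R], generated by [[E, S]] and [Phi(E)], lies in both [D] and [X2]. Were it smaller than [X2],
    then [S] would centralise [R] and [X1], hence their product [X2], modulo [Phi(E)]. So [X2] lies
    in [D], and both have index [p]. *)
Lemma classify_irreducible : irreducible_action p S E A ->
  exists Y, typeA S E A D Y.
Proof.
case=> iPhi irr [X1 [X2 [[n1 n2 sP1 s12 s2E] [iE2 i21 i1P nE1 nE2]]]].
have sPD := Phi_sub_D; have sP2 := subset_trans sP1 s12.
have nPS : 'Phi(E)%G <| S by apply: (inv_normal nES sylP (inv_Phi sAutA)); apply: Phi_sub.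
suff eD : X2 :=: D.
  by exists X1; rewrite /typeA -eD; split.
pose R := ([~: E, S] <*> 'Phi(E))%G.
have sPR : 'Phi(E) \subset R by apply: joing_subr.
have sRD : R \subset D by rewrite join_subG comm_E_D.
have sR2 : R \subset X2.
  by rewrite join_subG sP2 andbT; apply: (pgroup_comm_index p_pr pS n2 nES s2E); rewrite iE2.
have nRS : R <| S.
  by rewrite /= normalY // /normal comm_subG ?(normal_sub nES) // normsR ?normG ?normal_norm.
have eR2 : R :=: X2.
  have n1R : ~~ (R \subset X1).
    by apply: contra nE1; apply: subset_trans; apply: joing_subl.
  have n12 : X1 <| X2 by apply: normalS s12 (normal_sub n2) n1.
  have e2 : R * X1 = X2 by apply: prime_index_mul i21 sR2 n1R.
  apply/eqP; rewrite eqEproper sR2 /=; apply/negP=> ltR2; case/negP: nE2.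
  have pX2 : p.-group X2 by apply: pgroupS pE.
  have iRP : #|R : 'Phi(E)| <= p.
    have := Lagrange_index sR2 sPR; rewrite -(Lagrange_index s12 sP1) i21 i1P => e.
    rewrite -(leq_pmul2l (prime_gt0 p_pr)) -e leq_mul2r.
    by rewrite (pgroup_index_gt p_pr pX2 ltR2) orbT.
  have sRS := pgroup_comm_index p_pr pS nPS nRS sPR iRP.
  have s1S : [~: X1, S] \subset 'Phi(E).
    by apply: (pgroup_comm_index p_pr pS nPS n1 sP1); rewrite i1P.
  rewrite -e2 commMG ?mul_subG //.
  by rewrite normsR ?(subset_trans (normal_sub n1)) ?normG ?normal_norm.
have s2D : X2 \subset D by rewrite -eR2.
apply/eqP; rewrite eqEsubset s2D /=.
by case: (prime_index_sub iE2 s2D sDE) => [->|e] //; move: iED; rewrite e indexgg => p1; move: p_pr; rewrite -p1.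
Qed.

(** The lift [t] of [z] preserves [D]. If [W] lies in [D] they are equal, giving type B. Otherwise
    [W] covers [E / D], which [t] therefore inverts, so [C], centralised by [t] modulo [Phi(E)],
    lies in [D] and serves as [K]. *)
Lemma classify_split : split_action p S E A ->
  (exists K t, t \in B /\ typeN S E A D K t) \/ (exists2 t, t \in B & typeB S E A D t).
Proof.
case=> W [C [z [[sPW sWE sPC sCE sEWC] [sWC iW iC] [invW invC irr nWS] [Az nz negz trz zc]]]].
have [t Bt tz] := ext Az nz; have Aut_t := subsetP sBAut _ Bt.
have Phi_normal_S := inv_normal nES sylP (inv_Phi sAutA) (Phi_sub E).
have nCS := inv_normal nES sylP invC sCE.
have nWSn := inv_normal nES sylP invW sWE.
have nCE : C <| E by apply: normalS sCE sES nCS.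
have eWC : W * C = E by apply/eqP; rewrite eqEsubset sEWC mul_subG.
have sPD := Phi_sub_D.
(* [t s] acts on [E] as the conjugate by [z] of the action of [s]. So [s^-1 * t s] acts as a
   commutator of [c s] with [z], which is inner. *)
have tSE : triv_on S E t.
  move=> s Ss; have nEs := subsetP (normal_norm nES) _ Ss.
  have Sts : t s \in S by rewrite Aut_closed.
  have nEts := subsetP (normal_norm nES) _ Sts.
  have cts : conj_aut E (t s) = conj_aut E s ^ z.
    have AutA := subsetP sAutA; have Acs := conj_aut_mem nES sylP Ss.
    apply: (eq_Aut (Aut_aut _ _)); first by apply: AutA; rewrite groupJ.
    move=> x Ex; have Ezx : z^-1 x \in E by apply: (inv_E sAutA); rewrite ?groupV.
    rewrite norm_conj_autE // conjgE !permM (conj_autS nES) // -tz ?memJ_norm //.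
    have Sx := subsetP sES _ Ezx.
    have tzx : t (z^-1 x) = x by rewrite tz // permKV.
    transitivity (t (s^-1 * (z^-1 x * s))); last by [].
    by rewrite (AutM Aut_t) ?groupM ?groupV // (AutM Aut_t) // (AutV Aut_t) // tzx.
  apply: (mem_conj_Inn nES cES); first by rewrite groupM ?groupV.
  have -> : conj_aut E (s^-1 * t s) = [~ conj_aut E s, z].
    by rewrite morphM ?groupV // morphV //= cts commgEl.
  by rewrite -groupV invg_comm; apply: zc.
have tE : {in E, forall x, t x \in E} by move=> x Ex; apply: invE.
have s2E x : x \in E -> x \in S by apply: (subsetP sES).
have tC : triv_on C 'Phi(E)%G t by move=> x Cx; rewrite tz ?trz // (subsetP sCE).
have tW : negates W 'Phi(E)%G t.
  move=> x Wx; have Ex := subsetP sWE _ Wx; rewrite tz //.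
  have nPx : x \in 'N('Phi(E)).
    by rewrite (subsetP (normal_norm Phi_normal_S)) // s2E.
  by rewrite -(memJ_norm _ nPx) conjgE -mulgA mulKg negz.
have [sWD|nWD] := boolP (W \subset D).
  right; exists t => //.
  have nCD : ~~ (C \subset D).
    apply/negP=> sCD; have : E \subset D by rewrite -eWC mul_subG.
    by rewrite -indexg_eq1 iED => /eqP p1; move: p_pr; rewrite p1.
  have sCDP : C :&: D \subset 'Phi(E).
    have sPI : 'Phi(E) \subset C :&: D by rewrite subsetI sPC.
    have [e|e] := pgroup_indexP p_pr (pgroupS sCE pE) sPC iC.
      by case/negP: nCD; apply: subset_trans sPD; rewrite -indexg_eq1 e.
    have [-> //|eI] := @prime_index_sub _ _ (C :&: D)%G e sPI (subsetIl _ _).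
    by case/negP: nCD; move: (subsetIr C D); rewrite [C :&: D]eI.
  have eDW : D :=: W.
    apply/eqP; rewrite eqEsubset sWD andbT; apply/subsetP=> d Dd.
    have /mulsgP[w c Ww Cc dE] := subsetP sEWC _ (subsetP sDE _ Dd).
    have Pc : c \in 'Phi(E).
      apply: (subsetP sCDP); rewrite inE Cc /= -(mulKg w c) -dE groupM ?groupV //.
      exact: (subsetP sWD).
    by rewrite dE groupM // (subsetP sPW).
  split.
  - by move=> a x Aa; rewrite eDW; apply: invW.
  - by rewrite eDW.
  - by move=> X iX sPX; rewrite eDW; apply: irr.
  - by rewrite eDW.
  - split=> //.
      move=> x /(subsetP sEWC)/mulsgP[w c Ww Cc ->].
      have Dw := subsetP sWD _ Ww; have Dtw : t w \in D by apply: invD.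
      have [Ew Ec] := (subsetP sWE _ Ww, subsetP sCE _ Cc).
      rewrite (AutM Aut_t) ?s2E // invMg.
      have -> : c^-1 * w^-1 * (t w * t c) = (w^-1 * t w) ^ c * (c^-1 * t c).
        by rewrite conjgE !mulgA mulgK.
      rewrite groupM ?(subsetP sPD _ (tC _ Cc)) // memJ_norm ?groupM ?groupV //.
      exact: (subsetP (normal_norm nDE)).
    by move=> x; rewrite eDW => /tW.
left; exists C, t; split=> //.
have sCD : C \subset D.
  apply/subsetP=> c Cc; have Ec := subsetP sCE _ Cc.
  have eWD : W * D = E by apply: prime_index_mul.
  have : c \in W * D by rewrite eWD.
  case/mulsgP=> w d Ww Dd cE; have [Ew Ed] := (subsetP sWE _ Ww, subsetP sDE _ Dd).
  have Dtd : t d \in D by apply: invD.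
  have wtw : w^-1 * t w \in D.
    have Dc := subsetP sPD _ (tC _ Cc).
    rewrite cE (AutM Aut_t) ?s2E // invMg in Dc.
    have -> : w^-1 * t w = d * (d^-1 * w^-1 * (t w * t d)) * (t d)^-1.
      by rewrite !mulgA mulgK mulgV mul1g.
    by rewrite groupM ?groupV // groupM.
  have Dw : w \in D.
    apply: (sqr_mem pS (s2E _ Ew)).
    have -> : w * w = w * t w * (w^-1 * t w)^-1 by rewrite invMg invgK mulgA mulgK.
    by rewrite groupM ?groupV // (subsetP sPD) // tW.
  by rewrite cE groupM.
have iEC : #|E : C| = (p ^ 2)%N.
  have := mul_cardG W C; rewrite eWC.
  have -> : #|W :&: C| = #|'Phi(E)|.
    by apply/eqP; rewrite eqn_leq !subset_leq_card // subsetI sPW.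
  rewrite -(Lagrange sPW) -(Lagrange sCE) iW => e.
  by rewrite (muln_cancel2 (cardG_gt0 _) (cardG_gt0 _) e).
split.
- split=> //; apply/eqP; rewrite -(eqn_pmul2l (prime_gt0 p_pr)) -{1}iED Lagrange_index //.
  by rewrite iEC mulnn.
- split=> //.
  + move=> X iX sCX sXE.
    have iXW : inv_under A (X :&: W)%G.
      by move=> a x Aa /setIP[Xx Wx]; rewrite inE iX ?invW.
    have [||eP|eW] := irr _ iXW; rewrite ?subsetI ?subsetIr ?sPW ?(subset_trans sPC) //.
      left; apply/eqP; rewrite eqEsubset sCX andbT; apply/subsetP=> x Xx.
      have /mulsgP[w c Ww Cc xE] := subsetP sEWC _ (subsetP sXE _ Xx).
      have : w \in X :&: W.
        by rewrite inE Ww andbT -(mulgK c w) -xE groupM ?groupV // (subsetP sCX).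
      by rewrite [X :&: W]eP xE => /(subsetP sPC) Cw; rewrite groupM.
    right; apply/eqP; rewrite eqEsubset sXE -eWC mul_subG //.
    by move: (subsetIl X W); rewrite [X :&: W]eW.
  + apply: contra nWS => sEC; apply: subset_trans sWC; rewrite subsetI.
    rewrite commg_subl normal_norm //=; apply: subset_trans sEC.
    by apply: commSg.
  + exact: (pgroup_comm_index p_pr pS Phi_normal_S nCS sPC).
- split=> // x /(subsetP sEWC)/mulsgP[w c Ww Cc ->].
  have [Ew Ec] := (subsetP sWE _ Ww, subsetP sCE _ Cc).
  have Etw := tE _ Ew.
  have Ctc : t c \in C by rewrite -(mulKVg c (t c)) groupM // (subsetP sPC) // tC.
  rewrite (AutM Aut_t) ?s2E //.
  have -> : w * c * (t w * t c) = w * t w * (c ^ t w) * t c.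
    by rewrite conjgE !mulgA mulgK.
  have Cwtw : w * t w \in C by rewrite (subsetP sPC) // tW.
  apply: groupM => //; apply: groupM => //.
  by rewrite memJ_norm // (subsetP (normal_norm nCE)).
Qed.

End Types.

(** * Signs on commutators *)

Section Signs.
Local Open Scope group_scope.
Variables (p : nat) (gT : finGroupType).
Hypotheses (p_pr : prime p) (p_odd : odd p).

(** With booleans as signs, [true] meaning inversion, the sign of a commutator is the exclusive
    or. *)
Definition sgn (rT : finGroupType) (b : bool) (x : rT) := if b then x^-1 else x.

Lemma comm_twist (rT : finGroupType) (x u y v : rT) : commute u y -> commute u v -> commute x v ->
  commute [~ x, y] u -> commute [~ x, y] v -> [~ x * u, y * v] = [~ x, y].
Proof.
move=> uy uv xv zu zv; rewrite commMgJ.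
have -> : [~ u, y * v] = 1.
  by apply/eqP/commgP; apply: commuteM.
rewrite mulg1 commgMJ; have -> : [~ x, v] = 1 by apply/eqP/commgP.
by rewrite mul1g !conjgE zv mulKg zu mulKg.
Qed.

Lemma comm_sgn (rT : finGroupType) (x y : rT) b1 b2 : commute [~ x, y] x -> commute [~ x, y] y ->
  [~ sgn b1 x, sgn b2 y] = sgn (b1 (+) b2) [~ x, y].
Proof.
move=> zx zy; have hl w : commute [~ x, w] x -> [~ x^-1, w] = [~ x, w]^-1.
  move=> c; have := commMgJ x x^-1 w.
  rewrite mulgV comm1g conjgE invgK (commuteV c) mulKVg => e.
  by apply: (mulgI [~ x, w]); rewrite mulgV -e.
have hr w : commute [~ w, y] y -> [~ w, y^-1] = [~ w, y]^-1.
  move=> c; have := commgMJ w y y^-1.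
  rewrite mulgV commg1 conjgE invgK (commuteV c) mulKVg => e.
  by apply: (mulIg [~ w, y]); rewrite mulVg -e.
case: b1 b2 => [] [] /=; rewrite ?hl ?hr //.
  by rewrite invgK.
by apply: commute_sym; apply: commuteV; apply: commute_sym.
Qed.

Variables (S : {group gT}) (t : {perm gT}).
Hypotheses (pS : p.-group S) (Aut_t : t \in Aut S).

Lemma coset_comm1 (N : {group gT}) x y : x \in 'N(N) -> y \in 'N(N) ->
  [~ x, y] \in N -> commute (coset N x) (coset N y).
Proof.
by move=> Nx Ny Nxy; apply/commgP; rewrite -(morphR (coset_morphism N)) //= coset_id.
Qed.

(** Modulo [N] the commutator is central and the corrections [u] and [v] drop out of it, so only the
    two signs survive, and they multiply. *)
Lemma act_comm_sgn (N : {group gT}) x y u v b1 b2 : N <| S ->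
  x \in S -> y \in S -> u \in S -> v \in S ->
  t x = sgn b1 x * u -> t y = sgn b2 y * v ->
  [~ u, y] \in N -> [~ u, v] \in N -> [~ x, v] \in N ->
  {in S, forall w, [~ [~ x, y], w] \in N} ->
  coset N (t [~ x, y]) = sgn (b1 (+) b2) (coset N [~ x, y]).
Proof.
move=> nNS Sx Sy Su Sv tx ty uy uv xv cz; have nN := subsetP (normal_norm nNS).
have cc a b : a \in S -> b \in S -> [~ a, b] \in N -> commute (coset N a) (coset N b).
  by move=> Sa Sb; apply: coset_comm1; apply: nN.
have Sz : [~ x, y] \in S by rewrite groupR.
have cz' a : a \in S -> commute [~ coset N x, coset N y] (coset N a).
  move=> Sa; rewrite -(morphR (coset_morphism N)) ?nN //=; apply: cc => //; exact: cz.
have msg b a : a \in S -> coset N (sgn b a) = sgn b (coset N a).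
  by case: b => //= Sa; rewrite morphV ?nN.
have Ssg b a : a \in S -> sgn b a \in S by case: b => //= Sa; rewrite groupV.
have mM b a c : a \in S -> c \in S ->
    coset N (sgn b a * c) = sgn b (coset N a) * coset N c.
  by move=> Sa Sc; rewrite (morphM (coset_morphism N)) ?nN ?Ssg //= msg.
rewrite (AutR Aut_t) // tx ty (morphR (coset_morphism N)) ?nN ?groupM ?Ssg //=.
rewrite !mM // (morphR (coset_morphism N)) ?nN //=.
have cV b (c d : coset_of N) : commute c d -> commute c (sgn b d).
  by case: b => //=; apply: commuteV.
have cs := comm_sgn b1 b2 (cz' _ Sx) (cz' _ Sy).
have cVl b (c d : coset_of N) : commute c d -> commute (sgn b c) d.
  by move=> e; apply: commute_sym; apply: cV; apply: commute_sym.
have zV a : a \in S -> commute [~ sgn b1 (coset N x), sgn b2 (coset N y)] (coset N a).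
  by move=> Sa; rewrite cs; apply: cVl; apply: cz'.
rewrite comm_twist ?cs //; first last.
- by rewrite -cs; apply: zV.
- by rewrite -cs; apply: zV.
- by apply: cVl; apply: cc.
- exact: cc.
- by apply: cV; apply: cc.
Qed.

(** [Z / N] is cyclic, generated by the image of [z]. *)
Lemma sign_prime (Z N : {group gT}) z b : Z <| S -> N <| S -> N \subset Z ->
  #|Z : N| = p -> {in N, forall x, t x \in N} -> {in Z, forall x, t x \in Z} ->
  z \in Z -> z \notin N -> coset N (t z) = sgn b (coset N z) ->
  {in Z, forall w, coset N (t w) = sgn b (coset N w)}.
Proof.
move=> nZS nNS sNZ iZN iN iZ Zz nNz tz w Zw; have nN := subsetP (normal_norm nNS).
have sZS := subsetP (normal_sub nZS); have nNZ : N <| Z.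
  exact: normalS sNZ (normal_sub nZS) nNS.
have [k wk] := prime_index_gen p_pr nNZ iZN Zz nNz Zw.
pose u := w * z ^- k; have Zu : u \in Z by rewrite (subsetP sNZ).
have wE : w = u * z ^+ k by rewrite mulgKV.
have cw : coset N w = coset N z ^+ k.
  by rewrite wE morphM ?nN ?groupX ?sZS //= (coset_id wk) mul1g morphX ?nN ?sZS.
have -> : coset N (t w) = coset N (t z) ^+ k.
  rewrite wE (AutM Aut_t) ?groupX ?sZS // (AutX _ Aut_t) ?sZS //.
  by rewrite morphM ?nN ?groupX ?sZS ?iZ //= (coset_id (iN _ wk)) mul1g morphX ?nN ?sZS ?iZ.
by rewrite tz cw; case: (b) => //=; rewrite expgVn.
Qed.

Lemma triv_coset (Z N : {group gT}) : Z <| S -> N <| S -> {in Z, forall x, t x \in Z} ->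
  {in Z, forall w, coset N (t w) = sgn false (coset N w)} -> triv_on Z N t.
Proof.
move=> nZS nNS iZ h w Zw; have nN := subsetP (normal_norm nNS).
have sZS := subsetP (normal_sub nZS); apply: coset_idr.
  by rewrite nN // sZS // groupM ?groupV ?iZ.
by rewrite morphM ?morphV ?groupV ?nN ?sZS ?iZ //= h //= mulVg.
Qed.

Lemma neg_coset (Z N : {group gT}) : Z <| S -> N <| S -> {in Z, forall x, t x \in Z} ->
  {in Z, forall w, coset N (t w) = sgn true (coset N w)} -> negates Z N t.
Proof.
move=> nZS nNS iZ h w Zw; have nN := subsetP (normal_norm nNS).
have sZS := subsetP (normal_sub nZS); apply: coset_idr.
  by rewrite nN // sZS // groupM ?iZ.
by rewrite morphM ?nN ?sZS ?iZ //= h //= mulgV.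
Qed.

Lemma abelian_over (E D K : {group gT}) : E <| S -> D <| S -> K <| S ->
  K \subset D -> D \subset E -> #|E : D| = p -> [~: D, S] \subset K -> abelian (E / K).
Proof.
move=> nES nDS nKS sKD sDE iED cD; have sES := normal_sub nES.
have nK := normal_norm nKS; have nKE := subset_trans sES nK.
apply: (@cyclic_factor_abelian _ (D / K)%G).
  rewrite subsetI quotientS //= quotient_cents2 ?(subset_trans sDE) //.
  by apply: subset_trans cD; apply: commgS.
have nD : E \subset 'N(D) by apply: subset_trans sES (normal_norm nDS).
apply: prime_cyclic; rewrite card_quotient ?quotient_norms //.
rewrite index_quotient_eq ?iED //; apply: subset_trans sKD; exact: subsetIr.
Qed.

(** Write [t x = x * d] with [d] in [D]. As [E / K] is abelian and [d ^+ p] is in [K], [t] fixes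
    [x ^+ p] modulo [K]. But [x ^+ p] lies in [D], which [t] inverts modulo [K], so [E / K] has
    exponent [p]. *)
Lemma power_sub (E D K : {group gT}) : E <| S -> D <| S -> K <| S ->
  K \subset D -> D \subset E -> #|E : D| = p -> #|D : K| = p ->
  {in D, forall x, t x \in D} ->
  'Phi(E) \subset D -> triv_on E D t -> negates D K t -> 'Phi(E) \subset K.
Proof.
move=> nES nDS nKS sKD sDE iED iDK iD sPD tED nDK; have sES := normal_sub nES.
have nK := normal_norm nKS; have nKE := subset_trans sES nK.
have pE := pgroupS sES pS; have sDS := normal_sub nDS.
have cD : [~: D, S] \subset K by apply: (pgroup_comm_index p_pr pS nKS nDS sKD); rewrite iDK.
have abEK := abelian_over nES nDS nKS sKD sDE iED cD.
have xpK x : x \in E -> x ^+ p \in K.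
  move=> Ex; have Sx := subsetP sES _ Ex; pose d := x^-1 * t x.
  have Dd : d \in D by apply: tED.
  have xpD : x ^+ p \in D.
    apply: (subsetP sPD); rewrite (Phi_joing pE) mem_gen // inE; apply/orP; right.
    by rewrite -[p]expn1; apply: Mho_p_elt => //; apply: mem_p_elt pE Ex.
  have dpK : coset K d ^+ p = 1.
    by apply/eqP; rewrite -order_dvdn -iDK -card_quotient ?(subset_trans sDS) // order_dvdG ?mem_quotient.
  have Nx : x \in 'N(K) by apply: (subsetP nKE).
  have Nd : d \in 'N(K) by rewrite (subsetP nK) // (subsetP sDS).
  have cxp : coset K (t (x ^+ p)) = coset K (x ^+ p).
    have -> : t (x ^+ p) = (x * d) ^+ p by rewrite (AutX _ Aut_t) // mulKVg.
    have Nxd : x * d \in 'N(K) by rewrite groupM.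
    have cX y : y \in 'N(K) -> coset K (y ^+ p) = coset K y ^+ p.
      exact: (morphX (coset_morphism K)).
    have cM : coset K (x * d) = coset K x * coset K d.
      exact: (morphM (coset_morphism K)).
    rewrite !cX // cM expgMn ?dpK ?mulg1 //.
    by apply: (centsP abEK); rewrite mem_quotient // (subsetP sDE).
  have Nxp : x ^+ p \in 'N(K) by rewrite groupX.
  have trx : (x ^+ p)^-1 * t (x ^+ p) \in K.
    apply: coset_idr; last by rewrite morphM ?morphV ?groupV //= ?cxp ?mulVg // (subsetP nK) // (subsetP sDS) // iD.
    by rewrite groupM ?groupV // (subsetP nK) // (subsetP sDS) // iD.
  apply: (sqr_mem p_odd pS); first by rewrite groupX.
  have -> : x ^+ p * x ^+ p = x ^+ p * t (x ^+ p) * ((x ^+ p)^-1 * t (x ^+ p))^-1.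
    by rewrite invMg invgK mulgA mulgK.
  by rewrite groupM ?groupV // nDK.
apply: (Phi_min pE nKE); rewrite abelemE // abEK /=; apply/exponentP.
by move=> _ /morphimP[x Nx Ex ->]; rewrite -(morphX (coset_morphism K)) //= coset_id // xpK.
Qed.

End Signs.

(** * The lower exponent-p central series *)

Section FrattiniPGroup.
Local Open Scope group_scope.
Variables (p : nat) (gT : finGroupType).
Hypothesis p_pr : prime p.

Lemma comm_sub_Phi (E : {group gT}) : p.-group E -> [~: E, E] \subset 'Phi(E).
Proof. by move=> pE; rewrite (Phi_joing pE) joing_subl. Qed.

Lemma pow_in_Phi (E : {group gT}) x : p.-group E -> x \in E -> x ^+ p \in 'Phi(E).
Proof.
move=> pE Ex; rewrite (Phi_joing pE) mem_gen // inE; apply/orP; right.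
by rewrite -[p]expn1; apply: Mho_p_elt => //; apply: mem_p_elt pE Ex.
Qed.

(* With [H/Z(H)] of rank at most two, [H'] is generated by a single commutator. *)
Lemma card_der1_le (rT : finGroupType) (H Z : {group rT}) : p.-group H -> Z \subset 'Z(H) -> #|H : Z| = (p ^ 2)%N ->
  {in H, forall x, x ^+ p = 1} -> #|H^`(1)| <= p.
Proof.
move=> pH sZ iZ xp; have [sZH cZH] := subsetIP sZ.
have abH : abelian H -> #|H^`(1)| <= p.
  by move/commG1P=> e; rewrite derg1 e cards1 prime_gt0.
have [sHZ|nHZ] := boolP (H \subset Z).
  by apply: abH; rewrite /abelian (subset_trans sHZ).
have [a Ha nZa] := subsetPn nHZ; pose W := (Z <*> <[a]>)%G.
have nZ : H \subset 'N(Z) by apply: cents_norm; rewrite centsC.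
have sWH : W \subset H by rewrite join_subG sZH cycle_subG.
have cWZ : <[a]> \subset 'C(Z) by rewrite cycle_subG (subsetP _ _ Ha) // centsC.
have abW : abelian W.
  by rewrite abelianY cWZ cycle_abelian /abelian (subset_trans sZH) // centsC.
have [sHW|nHW] := boolP (H \subset W).
  by apply: abH; apply: abelianS sHW abW.
have [b Hb nWb] := subsetPn nHW; pose c := [~ a, b].
have sXH : <[a]> <*> <[b]> \subset H by rewrite join_subG !cycle_subG Ha.
have Zc : c \in Z.
  apply: coset_idr; first by rewrite (subsetP nZ) // groupR.
  rewrite (morphR (coset_morphism Z)) ?(subsetP nZ) //=; apply/eqP/commgP.
  have /centsP abHZ : abelian (H / Z).
    by apply: (card_p2group_abelian p_pr); rewrite card_quotient.
  by apply: abHZ; apply: mem_quotient.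
have cc : c \in 'C(<[a]> <*> <[b]>).
  by apply: subsetP Zc; apply: subset_trans cZH (centS sXH).
have eX := der1_joing_cycles cc.
have sZW : Z \proper W.
  rewrite properEneq joing_subl andbT; apply: contraNneq nZa => ->.
  by rewrite mem_gen // inE cycle_id orbT.
have sWX : W \proper (<[a]> <*> <[b]> <*> Z)%G.
  rewrite properE join_subG joing_subr -andbA (subset_trans _ (joing_subl _ _)) ?joing_subl //=.
  by apply/subsetPn; exists b => //; rewrite mem_gen // inE mem_gen // inE cycle_id orbT.
have sXZ : <[a]> <*> <[b]> <*> Z \subset H by rewrite join_subG sXH.
have eH : <[a]> <*> <[b]> <*> Z = H.
  apply/eqP; rewrite eqEsubset sXZ /= -indexg_eq1.
  have := Lagrange_index (proper_sub sWX) (proper_sub sZW).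
  have := Lagrange_index sXZ (subset_trans (proper_sub sZW) (proper_sub sWX)).
  rewrite iZ => e1 e2; have pX := pgroupS sXZ pH.
  have l1 := pgroup_index_gt p_pr pX sWX.
  have l2 := pgroup_index_gt p_pr (pgroupS sWH pH) sZW.
  have : #|H : <[a]> <*> <[b]> <*> Z| * p ^ 2 <= p ^ 2.
    by rewrite -{2}e1 leq_mul2l -e2 leq_mul ?orbT.
  rewrite -{2}[(p ^ 2)%N]mul1n leq_pmul2r ?expn_gt0 ?prime_gt0 // => le1.
  by rewrite eqn_leq le1 indexg_gt0.
have dp : (<[a]> <*> <[b]>) \* Z = H.
  rewrite cprodE; last by rewrite (subset_trans cZH) // centS.
  by rewrite -eH norm_joinEl //; apply: cents_norm; rewrite centsC (subset_trans cZH) // centS.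
have := der_cprod 1 dp; have /commG1P : abelian Z by rewrite /abelian (subset_trans sZH) // centsC.
rewrite -derg1 => ->; rewrite cprodg1 => <-.
rewrite eX -orderE; apply: dvdn_leq; first exact: prime_gt0.
by rewrite order_dvdn xp // groupR.
Qed.

(** Modulo [R] the exponent is [p], so the Frattini subgroup is the derived subgroup, which
    [card_der1_le] bounds. *)
Lemma index_Phi_over_le (G Z R : {group gT}) : p.-group G -> R <| G -> R \subset Z -> Z \subset G ->
  [~: Z, G] \subset R -> #|G : Z| = (p ^ 2)%N -> {in G, forall x, x ^+ p \in R} ->
  #|'Phi(G) : R| <= p.
Proof.
move=> pG nRG sRZ sZG cZG iZ xp; have [sRG nR] := andP nRG.
have nRP : 'Phi(G) \subset 'N(R) := subset_trans (Phi_sub G) nR.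
have xpR : {in (G / R)%g, forall x, x ^+ p = 1}.
  by move=> _ /morphimP[x Nx Gx ->]; rewrite -(morphX (coset_morphism R)) //= coset_id ?xp.
have le : #|(G / R)^`(1)| <= p.
  apply: (card_der1_le (Z := (Z / R)%G)) => //; first exact: quotient_pgroup.
    by rewrite subsetI quotientS //= quotient_cents2 // (subset_trans sZG).
  by rewrite index_quotient_eq // subIset // sRZ orbT.
rewrite -card_quotient // (quotient_Phi pG nR); apply: leq_trans le; apply: subset_leq_card.
have pGR : p.-group (G / R) := quotient_pgroup R pG.
rewrite (Phi_joing pGR) join_subG subxx (MhoE _ pGR) gen_subG.
by apply/subsetP=> _ /imsetP[x Gx ->]; rewrite expn1 xpR.
Qed.

End FrattiniPGroup.

Section PowerSeries.
Local Open Scope group_scope.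
Variables (p : nat) (gT : finGroupType) (G : {group gT}).
Hypotheses (p_pr : prime p) (p_odd : odd p) (pG : p.-group G).

(** Numbered from [lowerp 0 = G]. The Frattini subgroup contributes [p]-th powers; its commutators
    lie in [[lowerp k, G]] anyway, so this is the usual series. *)
Fixpoint lowerp k : {group gT} :=
  if k is k'.+1 then ('Phi(lowerp k') <*> [~: lowerp k', G])%G else G.
Arguments lowerp : simpl never.

Lemma lowerpS k : lowerp k.+1 = ('Phi(lowerp k) <*> [~: lowerp k, G])%G. Proof. by []. Qed.

(** The correction is [[x, y]] to the power [p (p - 1) / 2], a multiple of [p] for odd [p]. *)
Lemma expMg_class2 (rT : finGroupType) (x y : rT) : commute x [~ x, y] ->
  commute y [~ x, y] -> [~ x, y] ^+ p = 1 -> (y * x) ^+ p = y ^+ p * x ^+ p.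
Proof.
move=> cx cy cp; rewrite expMg_Rmul //.
have /dvdnP[q ->] : p %| 'C(p, 2).
  by rewrite prime_dvd_bin //= ltn_neqAle prime_gt1 // andbT; apply: contraTneq p_odd => <-.
by rewrite mulnC expgM cp expg1n mulg1.
Qed.

Lemma lowerp_char k : lowerp k \char G.
Proof.
elim: k => [|k IH]; first exact: char_refl.
by rewrite lowerpS charY ?charR ?char_refl // (char_trans (Phi_char _)).
Qed.

Lemma lowerp_sub k : lowerp k.+1 \subset lowerp k.
Proof.
by rewrite lowerpS join_subG Phi_sub commg_subl (char_norm (lowerp_char k)).
Qed.

Lemma lowerp_subG k : lowerp k \subset G. Proof. exact: char_sub (lowerp_char k). Qed.

Lemma lowerp_norm k x : x \in G -> x \in 'N(lowerp k).
Proof. exact: (subsetP (char_norm (lowerp_char k))). Qed.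

Lemma lowerp_comm k x g : x \in lowerp k -> g \in G -> [~ x, g] \in lowerp k.+1.
Proof. by move=> Lx Gg; rewrite lowerpS mem_gen // inE mem_commg ?orbT. Qed.

Lemma lowerp_pow k x : x \in lowerp k -> x ^+ p \in lowerp k.+1.
Proof.
move=> Lx; rewrite lowerpS mem_gen // inE pow_in_Phi //; exact: pgroupS (lowerp_subG k) pG.
Qed.

Lemma lowerp_inG k x : x \in lowerp k -> x \in G. Proof. exact: (subsetP (lowerp_subG k)). Qed.

Local Notation q k := (coset (lowerp k)).

Lemma qM k x y : x \in G -> y \in G -> q k (x * y) = q k x * q k y.
Proof. by move=> Gx Gy; rewrite (morphM (coset_morphism _)) ?lowerp_norm. Qed.

Lemma qX k x n : x \in G -> q k (x ^+ n) = q k x ^+ n.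
Proof. by move=> Gx; rewrite (morphX (coset_morphism _)) ?lowerp_norm. Qed.

Lemma qR k x y : x \in G -> y \in G -> q k [~ x, y] = [~ q k x, q k y].
Proof. by move=> Gx Gy; rewrite (morphR (coset_morphism _)) ?lowerp_norm. Qed.

Lemma q_commute k x g : x \in lowerp k -> g \in G -> commute (q k.+1 x) (q k.+1 g).
Proof.
by move=> Lx Gg; apply/commgP; rewrite -qR ?(lowerp_inG Lx) // coset_id // lowerp_comm.
Qed.

(** Modulo [lowerp k.+2] the commutator of [x] and [y] is central with trivial [p]-th power. *)
Lemma lowerp_powM k x y : x \in lowerp k -> y \in lowerp k ->
  q k.+2 ((x * y) ^+ p) = q k.+2 (x ^+ p) * q k.+2 (y ^+ p).
Proof.
move=> Lx Ly; have [Gx Gy] := (lowerp_inG Lx, lowerp_inG Ly).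
have Lc := lowerp_comm Ly Gx; rewrite !qX ?groupM // qM // expMg_class2 //.
- by rewrite -qR //; apply: commute_sym; apply: q_commute.
- by rewrite -qR //; apply: commute_sym; apply: q_commute.
- by rewrite -qR // -qX ?groupR // coset_id // lowerp_pow.
Qed.

(** Conjugation by [e] turns [x ^+ p] into the [p]-th power of [x * [x, e]]. This power is
    multiplicative even modulo [lowerp k.+3], since the commutator of the two factors already lies
    in [lowerp k.+2]. *)
Lemma lowerp_powR k x e : x \in lowerp k -> e \in G ->
  q k.+3 [~ x ^+ p, e] = q k.+3 ([~ x, e] ^+ p).
Proof.
move=> Lx Ge; have Gx := lowerp_inG Lx; have [c cE] : {c | c = [~ x, e]} by exists [~ x, e].
have Lc : c \in lowerp k.+1 by rewrite cE lowerp_comm.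
have Gc := lowerp_inG Lc; have Lcx : [~ c, x] \in lowerp k.+2 by apply: lowerp_comm.
rewrite commgEl conjXg -(mulKVg x (x ^ e)) -commgEl -cE qM ?groupV ?groupX ?groupM //.
have -> : q k.+3 ((x * c) ^+ p) = q k.+3 (x ^+ p) * q k.+3 (c ^+ p).
  rewrite !qX ?groupM // qM // expMg_class2 // -qR //.
  - by apply: commute_sym; apply: q_commute.
  - by apply: commute_sym; apply: q_commute.
  - by rewrite -qX ?(lowerp_inG Lcx) // coset_id // lowerp_pow.
by rewrite -qM ?groupX // -qM ?groupM ?groupV ?groupX // mulKg.
Qed.

(** Surjectivity of the map induced by the [p]-th power between consecutive factors, a homomorphism
    by [lowerp_powM]. *)
Definition pow_onto k :=
  {in lowerp k.+1, forall y, exists2 x, x \in lowerp k & q k.+2 y = q k.+2 (x ^+ p)}.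

(** The image of the power map is a subgroup, so generators suffice. For a commutator [[y, e]],
    write [y] as [x ^+ p] modulo [lowerp k.+2]; then [[y, e]] agrees with [[x, e] ^+ p] by
    [lowerp_powR]. *)
Lemma pow_onto_step k : pow_onto k -> pow_onto k.+1.
Proof.
move=> Pk; pose f x := q k.+3 (x ^+ p).
have fM : {in lowerp k.+1 &, {morph f : x y / x * y}} by move=> x y; apply: lowerp_powM.
pose W := (Morphism fM @* lowerp k.+1)%G.
suff sLW : lowerp k.+2 \subset (coset (lowerp k.+3) @*^-1 W)%G.
  by move=> y /(subsetP sLW); rewrite !inE => /andP[_ /morphimP[x _ Lx ->]]; exists x.
have inW x : x \in lowerp k.+1 -> x ^+ p \in (coset (lowerp k.+3) @*^-1 W)%G.
  move=> Lx; rewrite mem_morphpre ?lowerp_norm ?groupX ?(lowerp_inG Lx) //=.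
  by apply/morphimP; exists x.
have sR : [~: lowerp k.+1, G] \subset (coset (lowerp k.+3) @*^-1 W)%G.
  rewrite gen_subG; apply/subsetP=> _ /imset2P[y e Ly Ge ->].
  have [x Lx yx] := Pk _ Ly; have Gy := lowerp_inG Ly; have Gx := lowerp_inG Lx.
  have [w wE] : {w | w = (x ^+ p)^-1 * y} by exists ((x ^+ p)^-1 * y).
  have Lw : w \in lowerp k.+2.
    rewrite wE; apply: coset_idr; first by rewrite lowerp_norm // groupM // groupV groupX.
    by rewrite qM ?groupV ?groupX // morphV ?lowerp_norm ?groupX //= yx mulVg.
  have Gw := lowerp_inG Lw; have Lxe : [~ x, e] \in lowerp k.+1 by apply: lowerp_comm.
  rewrite mem_morphpre ?lowerp_norm ?groupR //; apply/morphimP; exists [~ x, e] => //.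
  change (q k.+3 [~ y, e] = q k.+3 ([~ x, e] ^+ p)).
  rewrite -(lowerp_powR Lx Ge) -(mulKVg (x ^+ p) y) -wE commMgJ.
  have Lxp : [~ x ^+ p, e] \in lowerp k.+2 by apply: lowerp_comm => //; apply: lowerp_pow.
  have Gxp := lowerp_inG Lxp; rewrite qM ?groupJ ?groupR ?groupX //.
  rewrite [X in _ * X]coset_id ?lowerp_comm // mulg1.
  rewrite (morphJ (coset_morphism _)) ?lowerp_norm // conjgE.
  by rewrite (q_commute Lxp Gw) mulKg.
rewrite lowerpS join_subG sR andbT (Phi_joing (pgroupS (lowerp_subG _) pG)) join_subG.
rewrite derg1 (subset_trans (commgS _ (lowerp_subG _)) sR) (MhoE _ (pgroupS (lowerp_subG _) pG)) gen_subG.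
by apply/subsetP=> _ /imsetP[x Lx ->]; rewrite expn1; apply: inW.
Qed.

Lemma powk_mem j k x : x \in lowerp j -> x ^+ (p ^ k) \in lowerp (j + k).
Proof.
by move=> Lx; elim: k => [|k IH]; rewrite ?addn0 // addnS expnSr expgM lowerp_pow.
Qed.

Lemma powkM k x y : x \in G -> y \in G ->
  q k.+1 ((x * y) ^+ (p ^ k)) = q k.+1 (x ^+ (p ^ k)) * q k.+1 (y ^+ (p ^ k)).
Proof.
move=> Gx Gy; elim: k => [|k IH]; first by rewrite !expg1 qM.
rewrite expnSr !expgM; set u := x ^+ _; set v := y ^+ _; set w := _ ^+ _ in IH *.
have [Lu Lv Lw] : [/\ u \in lowerp k, v \in lowerp k & w \in lowerp k].
  by rewrite -[k]add0n !powk_mem // groupM.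
have [Gu Gv Gw] := And3 (lowerp_inG Lu) (lowerp_inG Lv) (lowerp_inG Lw).
have [z zE] : {z | z = (u * v)^-1 * w} by exists ((u * v)^-1 * w).
have Lz : z \in lowerp k.+1.
  rewrite zE; apply: coset_idr; first by rewrite lowerp_norm // !(groupM, groupV).
  by rewrite qM ?groupV ?groupM // morphV ?lowerp_norm ?groupM //= IH -qM // mulVg.
have -> : w = u * v * z by rewrite zE mulKVg.
rewrite lowerp_powM ?groupM //; last exact: (subsetP (lowerp_sub _)).
by rewrite lowerp_powM // [X in _ * X]coset_id ?mulg1 // lowerp_pow.
Qed.

Lemma powk_onto k : pow_onto 0 ->
  {in lowerp k, forall y, exists2 x, x \in G & q k.+1 y = q k.+1 (x ^+ (p ^ k))}.
Proof.
move=> P0; have P j : pow_onto j by elim: j => // j; apply: pow_onto_step.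
elim: k => [|k IH] y Ly; first by exists y; rewrite ?expg1.
have [u Lu yu] := P k _ Ly; have [x Gx ux] := IH _ Lu.
exists x => //; rewrite yu expnSr expgM; set v := x ^+ _ in ux *.
have Lv : v \in lowerp k by rewrite -[k]add0n powk_mem.
have [Gu Gv] := (lowerp_inG Lu, lowerp_inG Lv).
have Lw : v^-1 * u \in lowerp k.+1.
  apply: coset_idr; first by rewrite lowerp_norm // !(groupM, groupV).
  by rewrite qM ?groupV // morphV ?lowerp_norm //= ux mulVg.
rewrite -(mulKVg v u) lowerp_powM //; last exact: (subsetP (lowerp_sub _)).
by rewrite [X in _ * X]coset_id ?mulg1 // lowerp_pow.
Qed.

(** In case of equality [[lowerp k, G]] would generate [lowerp k] modulo its Frattini subgroup,
    hence equal it, against nilpotency. *)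
Lemma lowerp_proper k : lowerp k :!=: 1 -> lowerp k.+1 \proper lowerp k.
Proof.
move=> nt; rewrite properEneq lowerp_sub andbT; apply/eqP=> e.
have sRL : [~: lowerp k, G] \subset lowerp k by rewrite commg_subl (char_norm (lowerp_char k)).
have /forall_inP nilG := pgroup_nil pG; case/negP: nt; apply: nilG.
have eR : <<[~: lowerp k, G]>> = lowerp k by apply: Phi_nongen; rewrite -[RHS]e lowerpS.
by rewrite genGid in eR; rewrite subsetI lowerp_subG eR subxx.
Qed.

Lemma lowerp_trivial : exists k, lowerp k :==: 1.
Proof.
suff H n k : #|lowerp k| <= n -> exists j, lowerp j :==: 1 by apply: (H #|G| 0).
elim: n k => [|n IH] k; first by rewrite leqNgt cardG_gt0.
have [e _|nt le] := eqVneq (lowerp k : {set gT}) 1; first by exists k; rewrite e.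
apply: (IH k.+1); rewrite -ltnS; apply: leq_trans le.
exact: proper_card (lowerp_proper nt).
Qed.

(* The map [x |-> x ^+ p ^ m] induces an A-equivariant surjection from [G / lowerp 1] onto
   the last nontrivial term of the series, so irreducibility identifies its kernel. *)
Lemma uniform_exponent (A : {group {perm gT}}) : A \subset Aut G -> G :!=: 1 ->
  (forall X : {group gT}, inv_under A X -> lowerp 1 \subset X -> X \subset G ->
     X :=: lowerp 1 \/ X :=: G) ->
  pow_onto 0 -> exists m, {in G, forall x, (x ^+ (p ^ m) == 1) = (x \in lowerp 1)}.
Proof.
move=> sA ntG irr P0.
have [m ntm tm] : exists2 m, lowerp m :!=: 1 & lowerp m.+1 :==: 1.
  case: (ex_minnP lowerp_trivial) => [[|m]] tm minm; first by case/negP: ntG.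
  by exists m => //; apply/negP=> /minm; rewrite ltnn.
exists m; pose f x := q m.+1 (x ^+ (p ^ m)).
have fM : {in G &, {morph f : x y / x * y}} by move=> x y; apply: powkM.
have [K sKG kerP] : exists2 K : {group gT}, K \subset G &
    {in G, forall x, (x \in K) = (x ^+ (p ^ m) == 1)}.
  exists ('ker (Morphism fM))%G; first exact: subsetIl.
  move=> x Gx; have Nx : x ^+ (p ^ m) \in 'N(lowerp m.+1) by rewrite lowerp_norm ?groupX.
  have -> : (x \in 'ker (Morphism fM)) = (f x == 1) by rewrite !inE Gx.
  apply/eqP/eqP=> [/(coset_idr Nx)|e]; first by rewrite (eqP tm) => /set1P.
  by rewrite /f e coset_id.
have iK : inv_under A K.
  move=> a x Aa Kx; have Gx := subsetP sKG _ Kx.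
  have AutA := subsetP sA _ Aa; rewrite kerP // in Kx; rewrite kerP ?(Aut_closed AutA) //.
  by rewrite -(AutX _ AutA) // (eqP Kx) (Aut_fix1 AutA).
have sK : lowerp 1 \subset K.
  apply/subsetP=> x Lx; rewrite kerP ?(lowerp_inG Lx) //.
  by have := powk_mem m Lx; rewrite add1n (eqP tm) => /set1P ->.
have [e|e] := irr _ iK sK sKG; first by move=> x Gx; rewrite -kerP // e.
case/negP: ntm; rewrite -subG1; apply/subsetP=> y Ly.
have [x Gx yx] := powk_onto P0 Ly.
have : x \in K by rewrite e.
rewrite kerP // => /eqP x1; rewrite x1 morph1 in yx.
have : y \in lowerp m.+1 by apply: coset_idr => //; rewrite lowerp_norm ?(lowerp_inG Ly).
by rewrite (eqP tm).
Qed.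

End PowerSeries.

(** * Pairs of essential subgroups *)

Section PairContext.
Local Open Scope group_scope.
Variables (p : nat) (gT : finGroupType).

(** One essential subgroup with the fusion system abstracted away: [A] is [Aut_F(E)] and [B] is
    [Aut_F(S)]. The fourth clause is extension to [S], the fifth a consequence of restriction to
    [E]. *)
Definition side (S E : {group gT}) (A : {group {perm gT}}) (B : {set {perm gT}}) (D : {group gT}) :=
  [/\ E <| S /\ #|E : D| = p, A \subset Aut E, p.-Sylow(A) (conj_aut E @* S),
      forall z, z \in A -> z \in 'N(conj_aut E @* S) ->
        exists2 t, t \in B & {in E, forall x, t x = z x}
    & forall X : {group gT}, inv_under A X -> X \subset E ->
        {in B & X, forall (t : {perm gT}) x, t x \in X}].

Definition pair_context (S E1 E2 : {group gT}) (A1 A2 : {group {perm gT}})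
    (B : {set {perm gT}}) (D : {group gT}) :=
  [/\ p.-group S /\ B \subset Aut S, D <| S /\ E1 :&: E2 = D, E1 * E2 = S,
      side S E1 A1 B D & side S E2 A2 B D].

Lemma pair_sym S E1 E2 A1 A2 B D :
  pair_context S E1 E2 A1 A2 B D -> pair_context S E2 E1 A2 A1 B D.
Proof.
case=> [[pS sB] [nD eD] eS s1 s2]; split=> //; first by rewrite setIC.
have [[n1 _] _ _ _ _] := s1; have [[n2 _] _ _ _ _] := s2.
rewrite -eS; apply: esym; apply: normC.
by apply: subset_trans (normal_sub n1) (normal_norm n2).
Qed.

End PairContext.

(** * Centralisers modulo a subgroup, and invariance under automorphisms *)

Section CentMod.
Local Open Scope group_scope.
Variable gT : finGroupType.
Implicit Types (G M E : {group gT}).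

Definition cent_mod G M E := (G :&: coset M @*^-1 'C(E / M))%G.

Lemma cent_modP G M E x : G \subset 'N(M) -> E \subset 'N(M) ->
  reflect (x \in G /\ {in E, forall e, [~ x, e] \in M}) (x \in cent_mod G M E).
Proof.
move=> nG nE; rewrite inE; apply: (iffP andP) => [[Gx]|[Gx cx]]; split=> //.
  move=> e Ee; have [Nx Ne] := (subsetP nG _ Gx, subsetP nE _ Ee).
  have cxe : [~ coset M x, coset M e] = 1.
    apply/eqP/commgP; move: b; rewrite !inE /= => /andP[_ /centP]; apply; exact: mem_quotient.
  by apply: coset_idr; [rewrite groupR | rewrite (morphR (coset_morphism M))].
have Nx := subsetP nG _ Gx; apply: mem_morphpre => //=; apply/centP=> _ /morphimP[e Ne Ee ->].
apply/commgP; apply/eqP; rewrite -(morphR (coset_morphism M)) //=.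
by apply: coset_id; apply: cx.
Qed.

Lemma cent_mod_inv (A : {group {perm gT}}) G M E : A \subset Aut E -> G \subset E -> E \subset 'N(M) ->
  inv_under A G -> inv_under A M -> inv_under A (cent_mod G M E).
Proof.
move=> sA sGE nE iG iM a x Aa; have nG := subset_trans sGE nE.
have AutA := subsetP sA; have invE := inv_E sA.
case/(cent_modP _ nG nE)=> Gx cx; apply/(cent_modP _ nG nE); split; first exact: iG.
move=> e Ee; have Ee' : a^-1 e \in E by apply: invE; rewrite ?groupV.
have -> : e = a (a^-1 e) by rewrite permKV.
by rewrite -(AutR (AutA _ Aa) (subsetP sGE _ Gx)) //; apply: iM => //; apply: cx.
Qed.

Lemma inv_char (A : {group {perm gT}}) (E G X : {group gT}) : A \subset Aut E -> G \subset E ->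
  inv_under A G -> X \char G -> inv_under A X.
Proof.
move=> sA sGE iG chX a x Aa Xx; have AutA := subsetP sA _ Aa.
have /charP[sXG /(_ (restrm_morphism sGE (autm_morphism AutA)))] := chX.
have iaG : restrm sGE (autm AutA) @* G = G.
  rewrite morphim_restrm setIid; apply/eqP; rewrite eqEcard card_injm ?injm_autm // leqnn andbT.
  by apply/subsetP=> _ /morphimP[y Ey Gy ->]; apply: iG.
rewrite injm_restrm ?injm_autm // => /(_ isT iaG) <-.
have Gx := subsetP sXG _ Xx.
exact: (mem_morphim (restrm_morphism sGE (autm_morphism AutA)) Gx Xx).
Qed.

Lemma inv_morphim (A : {group {perm gT}}) (E X : {group gT}) a (Aa : a \in Aut E) : a \in A ->
  inv_under A X -> autm Aa @* X \subset X.
Proof. by move=> Aa' iX; apply/subsetP=> _ /morphimP[y _ Xy ->]; apply: iX. Qed.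

Lemma inv_joing (A : {group {perm gT}}) (E X Y : {group gT}) : A \subset Aut E ->
  X \subset E -> Y \subset E -> inv_under A X -> inv_under A Y -> inv_under A (X <*> Y)%G.
Proof.
move=> sA sX sY iX iY a x Aa XYx; have AutA := subsetP sA _ Aa.
have Ex : x \in E by apply: subsetP XYx; rewrite join_subG sX.
have : autm AutA x \in autm AutA @* (X <*> Y) by rewrite mem_morphim.
by apply: subsetP; rewrite morphimY // genS // setUSS // (inv_morphim _ Aa).
Qed.

Lemma inv_commg (A : {group {perm gT}}) (E X Y : {group gT}) : A \subset Aut E ->
  X \subset E -> Y \subset E -> inv_under A X -> inv_under A Y -> inv_under A [~: X, Y]%G.
Proof.
move=> sA sX sY iX iY a x Aa XYx; have AutA := subsetP sA _ Aa.
have Ex : x \in E by apply: subsetP XYx; rewrite comm_subG.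
have : autm AutA x \in autm AutA @* [~: X, Y] by rewrite mem_morphim.
by apply: subsetP; rewrite morphimR // commgSS // (inv_morphim _ Aa).
Qed.

Lemma cent_mod_sub G M E : cent_mod G M E \subset G.
Proof. exact: subsetIl. Qed.

End CentMod.

(** * Comparison of two essential subgroups, type by type *)

Section Pair.
Local Open Scope group_scope.
Variables (p : nat) (gT : finGroupType).
Hypotheses (p_pr : prime p) (p_odd : odd p).
Variables (S E1 E2 : {group gT}) (A1 A2 : {group {perm gT}}) (B : {set {perm gT}}).
Variable D : {group gT}.
Hypothesis ctx : pair_context p S E1 E2 A1 A2 B D.

Let pS : p.-group S. Proof. by case: ctx => [[]]. Qed.
Let BAut t : t \in B -> t \in Aut S. Proof. by case: ctx => [[_ /subsetP]] sB *; apply: sB. Qed.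
Let nDS : D <| S. Proof. by case: ctx => [_ []]. Qed.
Let eD : E1 :&: E2 = D. Proof. by case: ctx => [_ []]. Qed.
Let eS : E1 * E2 = S. Proof. by case: ctx. Qed.
Let n1 : E1 <| S. Proof. by case: ctx => [_ _ _ [[]]]. Qed.
Let n2 : E2 <| S. Proof. by case: ctx => [_ _ _ _ [[]]]. Qed.
Let i1 : #|E1 : D| = p. Proof. by case: ctx => [_ _ _ [[]]]. Qed.
Let i2 : #|E2 : D| = p. Proof. by case: ctx => [_ _ _ _ [[]]]. Qed.
Let sA1 : A1 \subset Aut E1. Proof. by case: ctx => [_ _ _ []]. Qed.
Let sA2 : A2 \subset Aut E2. Proof. by case: ctx => [_ _ _ _ []]. Qed.
Let syl1 : p.-Sylow(A1) (conj_aut E1 @* S). Proof. by case: ctx => [_ _ _ []]. Qed.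
Let syl2 : p.-Sylow(A2) (conj_aut E2 @* S). Proof. by case: ctx => [_ _ _ _ []]. Qed.
Let ext1 z : z \in A1 -> z \in 'N(conj_aut E1 @* S) ->
        exists2 t, t \in B & {in E1, forall x, t x = z x}.
Proof. by case: ctx => [_ _ _ [_ _ _ h _] _]; apply: h. Qed.
Let res1 (X : {group gT}) t x : inv_under A1 X -> X \subset E1 -> t \in B -> x \in X -> t x \in X.
Proof. by case: ctx => [_ _ _ [_ _ _ _ h] _] iX sX; apply: h. Qed.
Let res2 (X : {group gT}) t x : inv_under A2 X -> X \subset E2 -> t \in B -> x \in X -> t x \in X.
Proof. by case: ctx => [_ _ _ _ [_ _ _ _ h]] iX sX; apply: h. Qed.

Let s1 : E1 \subset S := normal_sub n1.
Let s2 : E2 \subset S := normal_sub n2.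
Let sD1 : D \subset E1. Proof. by rewrite -eD subsetIl. Qed.
Let sD2 : D \subset E2. Proof. by rewrite -eD subsetIr. Qed.
Let sDS : D \subset S := normal_sub nDS.
Let p1 : p.-group E1 := pgroupS s1 pS.
Let p2 : p.-group E2 := pgroupS s2 pS.
Let nP1 : 'Phi(E1)%G <| S. Proof. by apply: (inv_normal n1 syl1 (inv_Phi sA1)); apply: Phi_sub. Qed.
Let nP2 : 'Phi(E2)%G <| S. Proof. by apply: (inv_normal n2 syl2 (inv_Phi sA2)); apply: Phi_sub. Qed.
Let sP1D : 'Phi(E1) \subset D. Proof. exact: (Phi_sub_D p_pr sD1 i1). Qed.
Let sP2D : 'Phi(E2) \subset D. Proof. exact: (Phi_sub_D p_pr sD2 i2). Qed.
Let c2D : [~: E2, S] \subset D. Proof. exact: (comm_E_D p_pr pS n2 nDS sD2 i2). Qed.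

(** [S] is the product of [E1] and [E2], and [E2] centralises [X] modulo [N], so [E1] must act
    nontrivially. *)
Lemma witness (X N : {group gT}) : N <| S -> X \subset S -> [~: X, E2] \subset N ->
  ~~ ([~: X, S] \subset N) -> exists x, exists2 y, y \in X & x \in E1 /\ [~ x, y] \notin N.
Proof.
move=> nNS sXS c2 nc; have nN := normal_norm nNS.
suff /exists_inP[x E1x /exists_inP[y Xy xy]] :
    [exists x in E1, exists y in X, [~ x, y] \notin N] by exists x, y.
move: nc; apply: contraR => /exists_inPn no.
rewrite -quotient_cents2 ?(subset_trans sXS) // -eS quotientMl ?(subset_trans s1) //.
rewrite centM subsetI !quotient_cents2 ?(subset_trans sXS) ?(subset_trans s1) ?(subset_trans s2) //.
rewrite c2 andbT commGC gen_subG; apply/subsetP=> _ /imset2P[x y E1x Xy ->].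
by apply/negPn; apply/negP=> xy; case/negP: (no _ E1x); apply/exists_inP; exists y.
Qed.

Lemma E1_stable t x : t \in B -> x \in E1 -> t x \in E1.
Proof. by apply: res1 => //; apply: inv_E sA1. Qed.
Lemma E2_stable t x : t \in B -> x \in E2 -> t x \in E2.
Proof. by apply: res2 => //; apply: inv_E sA2. Qed.
Lemma D_stable t x : t \in B -> x \in D -> t x \in D.
Proof. by rewrite -eD !inE => Bt /andP[x1 x2]; rewrite E1_stable ?E2_stable. Qed.

Lemma triv_cross t : t \in B -> triv_on S E1 t -> triv_on E2 D t.
Proof.
move=> Bt tS x x2; rewrite -eD inE tS ?(subsetP s2) //=.
by rewrite groupM ?groupV // E2_stable.
Qed.

Lemma triv_cross2 t : t \in B -> triv_on S E2 t -> triv_on E1 D t.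
Proof.
move=> Bt tS x x1; rewrite -eD inE andbC tS ?(subsetP s1) //=.
by rewrite groupM ?groupV // E1_stable.
Qed.

(** [t] inverts [E1 / K], hence [D / K], and centralises [S / E1], hence [E2 / D]: the situation of
    [power_sub] for [E2]. *)
Lemma typeN_Phi K t : t \in B -> typeN p S E1 A1 D K t -> 'Phi(E2) \subset K.
Proof.
move=> Bt [[_ sKD nKS iK] _ [nt tt _]].
have iD x : x \in D -> t x \in D by apply: D_stable.
apply: (power_sub p_pr p_odd pS (BAut Bt) n2 nDS nKS sKD sD2 i2 iK iD sP2D).
  exact: triv_cross.
by move=> x Dx; apply: nt; apply: (subsetP sD1).
Qed.

Lemma typeN_Phi2 K t : t \in B -> typeN p S E2 A2 D K t -> 'Phi(E1) \subset K.
Proof.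
move=> Bt [[_ sKD nKS iK] _ [nt tt _]].
have iD x : x \in D -> t x \in D by apply: D_stable.
apply: (power_sub p_pr p_odd pS (BAut Bt) n1 nDS nKS sKD sD1 i1 iK iD sP1D).
  exact: triv_cross2.
by move=> x Dx; apply: nt; apply: (subsetP sD2).
Qed.

(** [D / N] is generated by some [[x, y]] with [x] in [E1] and [y] in [E2]. Modulo [D], [t] has sign
    [b] on [x] and is trivial on [y]. *)
Lemma bracket_D (N : {group gT}) t b : t \in B -> N <| S -> N \subset D -> #|D : N| = p ->
  'Phi(E2) \subset N -> ~~ ([~: E2, S] \subset N) ->
  {in N, forall x, t x \in N} -> triv_on E2 D t ->
  {in E1, forall x, exists2 u, u \in D & t x = sgn b x * u} ->
  {in D, forall w, coset N (t w) = sgn b (coset N w)}.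
Proof.
move=> Bt nNS sND iDN sPN nc iN t2 t1.
have cD : [~: D, S] \subset N by apply: (pgroup_comm_index p_pr pS nNS nDS sND); rewrite iDN.
have c22 : [~: E2, E2] \subset N := subset_trans (comm_sub_Phi p2) sPN.
have [x [y y2 [x1 xy]]] := witness nNS s2 c22 nc.
have [u Du tx] := t1 _ x1; pose v := y^-1 * t y.
have ty : t y = sgn false y * v by rewrite /= mulKVg.
have Dv : v \in D by apply: t2.
have inD a b' : a \in D -> b' \in S -> [~ a, b'] \in N.
  by move=> Da Sb; apply: (subsetP cD); apply: mem_commg.
have [Sx Sy Su Sv] : [/\ x \in S, y \in S, u \in S & v \in S].
  by split; [apply: (subsetP s1)|apply: (subsetP s2)|apply: (subsetP sDS)|apply: (subsetP sDS)].
have Dxy : [~ x, y] \in D.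
  by apply: (subsetP c2D); rewrite commGC; apply: mem_commg.
apply: (sign_prime p_pr (BAut Bt) nDS nNS sND iDN iN _ Dxy xy) => [z|]; first exact: D_stable.
rewrite (act_comm_sgn (BAut Bt) nNS _ _ _ _ tx ty) ?addbF //.
- exact: inD.
- exact: inD.
- by rewrite -groupV invg_comm inD.
- by move=> w Sw; apply: inD.
Qed.

Lemma triv_bracket (N : {group gT}) t : t \in B -> N <| S -> N \subset D -> #|D : N| = p ->
  'Phi(E2) \subset N -> ~~ ([~: E2, S] \subset N) ->
  {in N, forall x, t x \in N} -> triv_on S E1 t -> triv_on E1 D t -> triv_on D N t.
Proof.
move=> Bt nNS sND iDN sPN nc iN tS t1.
apply: (triv_coset nDS nNS) => [x|]; first exact: D_stable.
apply: bracket_D => //; first exact: triv_cross.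
by move=> x x1; exists (x^-1 * t x); rewrite ?t1 //= mulKVg.
Qed.

Lemma neg_bracket (N K : {group gT}) t : t \in B -> N <| S -> N \subset D -> #|D : N| = p ->
  'Phi(E2) \subset N -> ~~ ([~: E2, S] \subset N) -> K \subset D ->
  {in N, forall x, t x \in N} -> triv_on S E1 t -> negates E1 K t -> negates D N t.
Proof.
move=> Bt nNS sND iDN sPN nc sKD iN tS t1.
apply: (neg_coset nDS nNS) => [x|]; first exact: D_stable.
apply: bracket_D => //; first exact: triv_cross.
by move=> x x1; exists (x * t x); rewrite ?(subsetP sKD) ?t1 //= mulKg.
Qed.

Lemma index_p_neq (X Y : {group gT}) : #|X : Y| = p -> ~~ (X \subset Y).
Proof. by move=> i; rewrite -indexg_eq1 i; apply: contraTneq p_pr => ->. Qed.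

(** [t1] inverts [D / K2] by [neg_bracket], but centralises [K1] modulo [Phi(E1)], which lies in
    [K2]. So [K1] lies in [K2], and their indices in [D] agree. *)
Lemma pair_NN K1 t1 K2 t2 : t1 \in B -> t2 \in B ->
  typeN p S E1 A1 D K1 t1 -> typeN p S E2 A2 D K2 t2 -> K1 :=: K2.
Proof.
move=> B1 B2 N1 N2; have P12 := typeN_Phi2 B2 N2.
have [[_ sK1 nK1 iK1] _ [ng1 tr1 c1]] := N1.
have [[Pk2 sK2 nK2 iK2] [iv2 _ nc2 _] _] := N2.
have ng : negates D K2 t1.
  apply: (neg_bracket B1 nK2 sK2 iK2 Pk2 nc2 sK1) => // x Kx.
  by apply: (res2 iv2) => //; apply: subset_trans sD2.
have sK12 : K1 \subset K2.
  apply: (sign_conflict p_odd pS (subset_trans sK1 sDS) (a := t1)).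
    by move=> x Kx; apply: (subsetP P12); apply: c1.
  by move=> x Kx; apply: ng; apply: (subsetP sK1).
apply/eqP; rewrite eqEcard sK12 /= -(leq_pmul2r (prime_gt0 p_pr)).
by rewrite -{1}iK2 -iK1 !Lagrange.
Qed.

(** [t1] centralises [E1 / D] and [E2 / D], hence [D / K2], but inverts [D] modulo [Phi(E1)], which
    lies in [K2]. *)
Lemma pair_BN t1 K2 t2 : t1 \in B -> t2 \in B ->
  typeB p S E1 A1 D t1 -> typeN p S E2 A2 D K2 t2 -> False.
Proof.
move=> B1 B2 [_ _ _ _ [tS1 tr1 ng1]] N2; have P12 := typeN_Phi2 B2 N2.
have [[Pk2 sK2 nK2 iK2] [iv2 _ nc2 _] _] := N2.
case/negP: (index_p_neq iK2); apply: (sign_conflict p_odd pS sDS (a := t1)).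
  apply: triv_bracket => // x Kx.
  by apply: (res2 iv2) => //; apply: subset_trans sD2.
by move=> x Dx; apply: (subsetP P12); apply: ng1.
Qed.

(** With both Frattini subgroups in [X], each [Ei] is abelian modulo [X] and so centralises [D]
    there; then [S] does too. *)
Lemma Phi_neq (X : {group gT}) : X \subset D -> ~~ ([~: D, S] \subset X) ->
  X <| S -> 'Phi(E1) \subset X -> ~~ ('Phi(E2) \subset X).
Proof.
move=> sXD nc nX sP1; apply: contra nc => sP2.
have sDN := subset_trans sDS (normal_norm nX).
rewrite -quotient_cents2 ?(normal_norm nX) // -eS quotientMl ?(subset_trans s1) ?(normal_norm nX) //.
rewrite centM subsetI !quotient_cents2 ?(subset_trans _ (normal_norm nX)) //.
rewrite (subset_trans (commSg _ sD1) (subset_trans (comm_sub_Phi p1) sP1)).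
exact: (subset_trans (commSg _ sD2) (subset_trans (comm_sub_Phi p2) sP2)).
Qed.

Hypothesis rkS : forall H : {group gT}, H \subset S -> 'm(H) <= 3.

Lemma index_Phi_le (H : {group gT}) : H \subset S -> #|H : 'Phi(H)| <= p ^ 3.
Proof.
move=> sHS; have [n -> le3] := grank_Frattini_index (pgroupS sHS pS) (rkS sHS).
by rewrite leq_pexp2l // prime_gt0.
Qed.

Lemma Phi_D_sub : 'Phi(D) \subset 'Phi(E1) :&: 'Phi(E2).
Proof.
rewrite subsetI (PhiS p1 sD1) (PhiS p2 sD2) //.
Qed.

(** [t1] centralises [D / Y2] but inverts [D / Phi(E1)], so [Phi(E1)] is not inside [Y2];
    uniseriality then gives [D = Phi(E1) Phi(E2)]. Both factors have index [p ^ 2], so their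
    intersection, which contains [Phi(D)], has index [p ^ 4], beyond the rank bound. *)
Lemma pair_BA t1 Y2 : t1 \in B -> typeB p S E1 A1 D t1 -> typeA p S E2 A2 D Y2 -> False.
Proof.
move=> B1 [_ [_ iDP] _ _ [tS1 tr1 ng1]] [iP2 _ [nY2 sPY sYD iDY iYP] [nE2 ncD]].
have cD : [~: D, S] \subset Y2 by apply: (pgroup_comm_index p_pr pS nY2 nDS sYD); rewrite iDY.
have cY : [~: Y2, S] \subset 'Phi(E2).
  by apply: (pgroup_comm_index p_pr pS nP2 nY2 sPY); rewrite iYP.
have eY : Y2 :=: [~: D, S] <*> 'Phi(E2).
  have [|e|<- //] := prime_index_sub p_pr iYP (joing_subr [~: D, S] 'Phi(E2)).
    by rewrite join_subG cD.
  by case/negP: ncD; rewrite -e joing_subl.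
(* [[D, S]] and [Phi(E2)] are stable under [t1] and generate [Y2]. *)
have iY x : x \in Y2 -> t1 x \in Y2.
  have AutS := BAut B1; move=> Yx.
  have: autm AutS x \in autm AutS @* Y2 by rewrite mem_morphim // (subsetP sDS) // (subsetP sYD).
  have iX (X : {group gT}) : X \subset S -> {in X, forall x, t1 x \in X} -> autm AutS @* X \subset X.
    move=> sXS iX; apply/subsetP=> _ /morphimP[y Sy Xy ->]; exact: iX.
  apply: subsetP; rewrite eY morphimY ?comm_subG ?(subset_trans sP2D) //.
  rewrite morphimR // join_subG; apply/andP; split.
    apply: subset_trans (joing_subl _ _); apply: commgSS; apply: iX => // y Dy.
      exact: D_stable.
    by rewrite Aut_closed.
  apply: subset_trans (joing_subr _ _); apply: iX => [|y Py].
    exact: subset_trans sP2D sDS.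
  by apply: (res2 (inv_Phi sA2)); rewrite ?Phi_sub.
have tD : triv_on D Y2 t1 by apply: triv_bracket.
have nP1Y : ~~ ('Phi(E1) \subset Y2).
  apply: contra (index_p_neq iDY) => sP1Y; apply: (sign_conflict p_odd pS sDS tD).
  by move=> x Dx; apply: (subsetP sP1Y); apply: ng1.
have nYD : Y2 <| D by apply: normalS sYD sDS nY2.
have eD1 : 'Phi(E1) * Y2 = D by apply: prime_index_mul iDY _ nP1Y.
pose Q := ('Phi(E1) <*> 'Phi(E2))%G.
have nc : ~~ ([~: 'Phi(E1), S] \subset 'Phi(E2)).
  apply: contra ncD => c1; rewrite -eD1 commMG; first by rewrite mul_subG.
  apply: subset_trans (subset_trans sYD sDS) _.
  by rewrite normsR ?normG ?(normal_norm nP1).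
have sDQ : D \subset Q.
  rewrite -eD1 mul_subG ?joing_subl //.
  have c12 : [~: 'Phi(E1), S] \subset Y2 by apply: subset_trans cD; apply: commSg.
  have c11 : [~: 'Phi(E1), S] \subset 'Phi(E1) by rewrite commg_subl (normal_norm nP1).
  have [||e|<-] := prime_index_sub p_pr iYP (X := ([~: 'Phi(E1), S] <*> 'Phi(E2))%G).
  - exact: joing_subr.
  - by rewrite join_subG c12.
  - by case/negP: nc; rewrite -e joing_subl.
  - by rewrite join_subG joing_subr (subset_trans c11) ?joing_subl.
have eQ : 'Phi(E1) * 'Phi(E2) = D.
  apply/eqP; rewrite eqEsubset mul_subG //= -norm_joinEl //.
  by apply: subset_trans (normal_norm nP2); apply: subset_trans sP1D sDS.
have := mul_cardG 'Phi(E1) 'Phi(E2); rewrite eQ => eC.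
have: #|D : 'Phi(D)| >= p ^ 4.
  have sPI := Phi_D_sub.
  have sID : 'Phi(E1) :&: 'Phi(E2) \subset D by rewrite subIset // sP1D.
  rewrite -(Lagrange_index sID sPI).
  have -> : #|D : 'Phi(E1) :&: 'Phi(E2)| = (p ^ 4)%N; last by rewrite leq_pmulr.
  apply/eqP; rewrite -(eqn_pmul2l (cardG_gt0 ('Phi(E1) :&: 'Phi(E2))%G)) Lagrange //.
  have iDP2 : #|D : 'Phi(E2)| = (p ^ 2)%N by rewrite -(Lagrange_index sYD sPY) iDY iYP mulnn.
  have e1 := Lagrange sP1D; have e2 := Lagrange sP2D; rewrite iDP in e1; rewrite iDP2 in e2.
  rewrite -(eqn_pmul2l (cardG_gt0 D)) mulnA -eC -{1}e1 -e2 -[4]/(2 + 2)%N expnD.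
  by rewrite mulnACA.
rewrite leqNgt; case/negP; apply: leq_ltn_trans (index_Phi_le sDS) _.
by rewrite ltn_exp2l // prime_gt1.
Qed.

(** By [Phi_neq] the two Frattini subgroups differ, so they meet in index at least [p ^ 3]; the
    intersection contains [Phi(D)], of index at most [p ^ 3]. *)
Lemma Phi_D_eq : #|D : 'Phi(E1)| = (p ^ 2)%N -> #|D : 'Phi(E2)| = (p ^ 2)%N ->
  ~~ ([~: D, S] \subset 'Phi(E1)) ->
  [/\ 'Phi(D) = 'Phi(E1) :&: 'Phi(E2), #|'Phi(E1) : 'Phi(E1) :&: 'Phi(E2)| = p,
      #|'Phi(E2) : 'Phi(E1) :&: 'Phi(E2)| = p & ~~ ('Phi(E2) \subset 'Phi(E1))].
Proof.
move=> i1D i2D nc; have nP := Phi_neq sP1D nc nP1 (subxx _).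
pose M := ('Phi(E1) :&: 'Phi(E2))%G.
have sM1 : M \subset 'Phi(E1) := subsetIl _ _; have sM2 : M \subset 'Phi(E2) := subsetIr _ _.
have sMD := subset_trans sM2 sP2D.
have cP : #|'Phi(E1)| = #|'Phi(E2)|.
  have /eqP := Lagrange sP1D; rewrite i1D -(Lagrange sP2D) i2D.
  by rewrite eqn_pmul2r ?expn_gt0 ?prime_gt0 // => /eqP.
have le3 : #|D : M| * #|M : 'Phi(D)| <= p ^ 3.
  by rewrite Lagrange_index // ?Phi_D_sub // index_Phi_le.
have e2 : #|'Phi(E2) : M| = p.
  apply/eqP; rewrite eqn_leq (pgroup_index_gt p_pr (pgroupS (subset_trans sP2D sDS) pS)) ?andbT.
    rewrite -(leq_pmul2l (m:=p ^ 2)) ?expn_gt0 ?prime_gt0 // -{1}i2D Lagrange_index //.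
    rewrite -expnSr; apply: leq_trans le3; rewrite leq_pmulr //.
  by rewrite properEneq sM2 andbT; apply: contra nP => /eqP <-.
have iM : #|D : M| = (p ^ 3)%N by rewrite -(Lagrange_index sP2D sM2) i2D e2 -expnSr.
split=> //; last first.
  by have /eqP := Lagrange sM1; rewrite cP -(Lagrange sM2) e2 eqn_pmul2l // => /eqP.
apply/eqP; rewrite eqEsubset Phi_D_sub /= -indexg_eq1 eqn_leq indexg_gt0 andbT.
by rewrite iM -{2}[(p ^ 3)%N]muln1 leq_pmul2l ?expn_gt0 ?prime_gt0 // in le3.
Qed.

(** The part of [D] centralised by [E1] modulo [Phi(D)] is [A1]-invariant and contains [Phi(E1)] and
    [Phi(E2)], each of index [p] over [Phi(D)]. As these differ, irreducibility of [D / Phi(E1)]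
    makes it all of [D]. *)
Lemma pair_BB_cent t1 : typeB p S E1 A1 D t1 -> #|D : 'Phi(E2)| = (p ^ 2)%N ->
  [~: D, E1] \subset 'Phi(D).
Proof.
case=> iAD [_ iD] irr nc _ i2D; have [eM iM1 iM2 nP] := Phi_D_eq iD i2D nc.
have nMS : 'Phi(D)%G <| S by rewrite /= eM normalI.
have nM := normal_norm nMS; have sD := subset_trans sDS nM; have sE := subset_trans s1 nM.
have cP (X : {group gT}) : X <| S -> 'Phi(D) \subset X -> #|X : 'Phi(D)| = p -> X \subset D ->
    X \subset cent_mod D 'Phi(D)%G E1.
  move=> nX sMX iX sXD; have cX : [~: X, S] \subset 'Phi(D).
    by apply: (pgroup_comm_index p_pr pS nMS nX sMX); rewrite iX.
  apply/subsetP=> x Xx; apply/(cent_modP _ sD sE); split; first exact: (subsetP sXD).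
  by move=> e Ee; apply: (subsetP cX); apply: mem_commg => //; apply: (subsetP s1).
have sC1 : 'Phi(E1) \subset cent_mod D 'Phi(D)%G E1 by apply: (cP 'Phi(E1)%G); rewrite ?eM ?subsetIl.
have sC2 : 'Phi(E2) \subset cent_mod D 'Phi(D)%G E1 by apply: (cP 'Phi(E2)%G); rewrite ?eM ?subsetIr.
have iC : inv_under A1 (cent_mod D 'Phi(D)%G E1).
  exact: cent_mod_inv sA1 sD1 sE iAD (inv_char sA1 sD1 iAD (Phi_char D)).
have [e|e] := irr _ iC sC1 (cent_mod_sub _ _ _).
  by case/negP: nP; rewrite -e.
rewrite gen_subG; apply/subsetP=> _ /imset2P[d e0 Dd Ee ->].
by move: Dd; rewrite -{1}e => /(cent_modP _ sD sE)[_]; apply.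
Qed.

(** Both subgroups contain [[D, S]] and [Phi(E2)], which generate [Y2], and both have index [p] in
    [D]. *)
Lemma pair_NA_eq K1 t1 Y2 : t1 \in B -> typeN p S E1 A1 D K1 t1 -> typeA p S E2 A2 D Y2 ->
  K1 :=: Y2.
Proof.
move=> B1 N1 [iP2 _ [nY2 sPY sYD iDY iYP] [nE2 ncD]]; have sPK := typeN_Phi B1 N1.
have [[_ sK1 nK1 iK1] _ _] := N1.
have cK : [~: D, S] \subset K1 by apply: (pgroup_comm_index p_pr pS nK1 nDS sK1); rewrite iK1.
have cY : [~: D, S] \subset Y2 by apply: (pgroup_comm_index p_pr pS nY2 nDS sYD); rewrite iDY.
have [||e|e] := prime_index_sub p_pr iYP (X := (K1 :&: Y2)%G); rewrite ?subsetI ?subsetIr ?sPK //.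
  by case/negP: ncD; rewrite -e subsetI cK.
have sYK : Y2 \subset K1 by rewrite -e subsetIl.
have [//|e'] := prime_index_sub p_pr iDY sYK sK1.
by move: (index_p_neq iK1); rewrite e' subxx.
Qed.

(** For the invariance, let [J] be the intersection of the Frattini subgroups. The elements of [A1]
    trivial on [K1 / J] form a normal subgroup containing [Aut_S(E1)]; by the Frattini argument it
    and the normaliser of [Aut_S(E1)] have product [A1]. The former preserves every subgroup between
    [J] and [K1], and elements of the latter extend to [S], hence preserve [Phi(E2)]. *)
Lemma pair_NA K1 t1 Y2 : t1 \in B -> typeN p S E1 A1 D K1 t1 -> typeA p S E2 A2 D Y2 ->
  inv_under A1 'Phi(E2)%G /\ exists x, [/\ x \in S, x \notin E2 & x ^+ p \in 'Phi(E2)].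
Proof.
move=> B1 N1 TA; have eK := pair_NA_eq B1 N1 TA.
have [iP2 _ [nY2 sPY sYD iDY iYP] [nE2 ncD]] := TA.
have [[sPK1 sK1 nK1 iK1] [iv1 irr1 nc1 cK1] [ng1 tr1 c1]] := N1.
have K1Y x : (x \in K1) = (x \in Y2) by rewrite eK.
have cD : [~: D, S] \subset Y2 by apply: (pgroup_comm_index p_pr pS nY2 nDS sYD); rewrite iDY.
have cY : [~: Y2, S] \subset 'Phi(E2).
  by apply: (pgroup_comm_index p_pr pS nP2 nY2 sPY); rewrite iYP.
have sD1' := subsetP sD1; have sD2' := subsetP sD2; have sS1 := subsetP s1.
have sDS' := subsetP sDS; have sYD' := subsetP sYD.
have c22 a b : a \in E2 -> b \in E2 -> [~ a, b] \in 'Phi(E2).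
  by move=> Ea Eb; apply: (subsetP (comm_sub_Phi p2)); apply: mem_commg.
have cYS a b : a \in Y2 -> b \in S -> [~ a, b] \in 'Phi(E2).
  by move=> Ya Sb; apply: (subsetP cY); apply: mem_commg.
have iP x : x \in 'Phi(E2) -> t1 x \in 'Phi(E2).
  by apply: (res2 (inv_Phi sA2)); rewrite ?Phi_sub.
have iY x : x \in Y2 -> t1 x \in Y2.
  by rewrite -!K1Y; apply: (res1 iv1) => //; apply: subset_trans sD1.
have ng x : x \in E1 -> x * t1 x \in Y2 by move=> Ex; rewrite -K1Y; apply: ng1.
(* Both entries of [[x, d]] are inverted modulo [Y2], so the signs cancel. *)
have tY : triv_on Y2 'Phi(E2)%G t1.
  have [x [d Dd [Ex xd]]] : exists x, exists2 d, d \in D & x \in E1 /\ [~ x, d] \notin 'Phi(E2).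
    apply: (witness nP2 sDS _ ncD); apply: subset_trans (comm_sub_Phi p2); exact: commSg.
  apply: (triv_coset nY2 nP2 iY).
  have tx : t1 x = sgn true x * (x * t1 x) by rewrite mulKg.
  have td : t1 d = sgn true d * (d * t1 d) by rewrite mulKg.
  have Yu := ng _ Ex; have Yv := ng _ (sD1' _ Dd).
  have [Sx Sd] := (sS1 _ Ex, sDS' _ Dd).
  have Yxd : [~ x, d] \in Y2.
    by apply: (subsetP cD); rewrite commGC mem_commg.
  apply: (sign_prime p_pr (BAut B1) nY2 nP2 sPY iYP iP iY Yxd xd).
  rewrite (act_comm_sgn (BAut B1) nP2 Sx Sd _ _ tx td) ?(sDS' _ (sYD' _ _)) //.
  - by apply: c22; apply: sD2' => //; apply: sYD'.
  - by apply: c22; apply: sD2' => //; apply: sYD'.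
  - by rewrite -groupV invg_comm cYS.
  - by move=> w Sw; apply: cYS.
have nP := subsetP (normal_norm nP2).
(* [t1 x] is [x^-1] times an element of [Y2], whose [p]-th power is in [Phi(E2)]. So [t1] inverts
   [x ^+ p], which it also fixes by [tY]. *)
have xp x : x \in E1 -> x ^+ p \in 'Phi(E2).
  move=> Ex; have Sx := sS1 _ Ex; have Yu := ng _ Ex; have Su := sDS' _ (sYD' _ Yu).
  have Yxp : x ^+ p \in Y2 by rewrite -K1Y (subsetP sPK1) // pow_in_Phi.
  have Nx := nP _ Sx; have Nu := nP _ Su.
  apply: (sqr_mem p_odd pS); first exact: groupX.
  have U1 : coset 'Phi(E2) (x * t1 x) ^+ p = 1.
    rewrite -(morphX (coset_morphism _) p Nu) /=; apply: coset_id.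
    by apply: pow_in_Phi => //; apply: sD2'; apply: sYD'.
  have Ntx : t1 x \in 'N('Phi(E2)%G) by rewrite nP // sS1 // E1_stable.
  have e : coset 'Phi(E2) (t1 (x ^+ p)) = coset 'Phi(E2) x ^- p.
    rewrite (AutX _ (BAut B1)) // -(mulKg x (t1 x)) (morphX (coset_morphism _)) ?groupM ?groupV //=.
    rewrite (morphM (coset_morphism _)) ?groupV //= (morphV (coset_morphism _)) //=.
    rewrite expgMn; last first.
      by apply: commute_sym; apply: commuteV; apply: coset_comm1 => //; apply: cYS.
    by rewrite U1 mulg1 expgVn.
  have Px : x ^+ p * t1 (x ^+ p) \in 'Phi(E2).
    have Nxp := groupX p Nx; have Ntxp : t1 (x ^+ p) \in 'N('Phi(E2)%G).
      by rewrite nP // sDS' // sYD' // iY.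
    apply: coset_idr; first by rewrite groupM.
    by rewrite (morphM (coset_morphism _)) //= e -(morphX (coset_morphism _) p Nx) /= mulgV.
  have -> : x ^+ p * x ^+ p = x ^+ p * t1 (x ^+ p) * ((x ^+ p)^-1 * t1 (x ^+ p))^-1.
    by rewrite invMg invgK mulgA mulgK.
  by rewrite groupM ?groupV //; apply: tY.
have nPP : ~~ ('Phi(E1) \subset 'Phi(E2)).
  by apply/negP=> sPP; have := Phi_neq sP2D ncD nP2 sPP; rewrite subxx.
(* [J1] is [A1]-invariant by construction. It turns out to equal [J], because its index in [Phi(E1)]
   is at most [p] and [Phi(E1)] is not inside [Phi(E2)]. *)
pose J := ('Phi(E1) :&: 'Phi(E2))%G; pose J1 := ('Mho^1(E1) <*> [~: K1, E1])%G.
have sKE1 := subset_trans sK1 sD1.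
have cJ s x : s \in S -> x \in K1 -> [~ x, s] \in J.
  move=> Ss Kx; rewrite inE (subsetP cK1) ?mem_commg //=; apply: cYS => //.
  by rewrite -K1Y.
have sM1 : 'Mho^1(E1) \subset E1 := Mho_sub 1 E1.
have sR1 : [~: K1, E1] \subset E1.
  by rewrite commg_subr (subset_trans sKE1 (normG E1)).
have xJ1 x : x \in E1 -> x ^+ p \in J1.
  move=> Ex; rewrite mem_gen // inE -[p]expn1 Mho_p_elt //; exact: mem_p_elt p1 Ex.
have sJ1J : J1 \subset J.
  rewrite join_subG (MhoE _ p1) !gen_subG; apply/andP; split; apply/subsetP=> y.
    by case/imsetP=> x Ex ->; rewrite expn1 inE xp // pow_in_Phi.
  by case/imset2P=> x e Kx Ee ->; apply: cJ => //; apply: sS1.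
have iJ1 : inv_under A1 J1.
  apply: (inv_joing sA1) => //.
    by apply: inv_char sA1 (subxx _) (inv_E sA1) (Mho_char 1 E1).
  by apply: inv_commg sA1 _ _ iv1 (inv_E sA1).
have nJ1E : J1 <| E1 by apply: normalS (inv_normal n1 syl1 iJ1 _); rewrite ?join_subG ?sM1.
have sJ1K : J1 \subset K1.
  by apply: subset_trans sJ1J _; apply: subset_trans sPK1; apply: subsetIl.
have leJ : #|'Phi(E1) : J1| <= p.
  apply: (index_Phi_over_le p_pr p1 nJ1E sJ1K sKE1) => //; first exact: joing_subr.
  by rewrite -(Lagrange_index sD1 sK1) i1 iK1 mulnn.
have eJ : J1 :=: J.
  have sJP : J \subset 'Phi(E1) := subsetIl _ _.
  apply/eqP; rewrite eqEsubset sJ1J /= -indexg_eq1 eqn_leq indexg_gt0 andbT.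
  rewrite -(leq_pmul2l (prime_gt0 p_pr)) muln1; apply: leq_trans leJ.
  rewrite -(Lagrange_index sJP sJ1J) leq_mul2r; apply/orP; right.
  apply: (pgroup_index_gt p_pr (pgroupS (Phi_sub E1) p1)).
  by rewrite properEneq sJP andbT; apply: contra nPP => /eqP <-; apply: subsetIr.
split; last first.
  have [x Ex nDx] := subsetPn (index_p_neq i1); exists x; split; [exact: sS1| |exact: xp].
  by apply: contra nDx => x2; rewrite -eD inE Ex.
pose N := [set a in A1 | [forall x in K1, x^-1 * a x \in J]].
have memN a : reflect (a \in A1 /\ triv_on K1 J a) (a \in N).
  by rewrite inE; apply: (iffP andP) => [[Aa /forall_inP]|[Aa ta]]; split=> //; apply/forall_inP.
have gN : group_set N.
  apply/group_setP; split; first by apply/memN; split; [exact: group1|exact: triv_on1].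
  move=> a b /memN[Aa ta] /memN[Ab tb]; apply/memN; split; first exact: groupM.
  by apply: triv_onM => // x Kx; apply: iv1.
pose NG := Group gN.
have iJ : inv_under A1 J by move=> a x Aa; rewrite /= -!eJ; apply: iJ1.
have sJK : J \subset K1 by apply: subset_trans sPK1; apply: subsetIl.
have nN : NG <| A1.
  apply/andP; split; first by apply/subsetP=> a /memN[].
  apply/subsetP=> b Ab; rewrite inE; apply/subsetP=> _ /imsetP[a /memN[Aa ta] ->].
  by apply/memN; split; [exact: groupJ | exact: (triv_onJ sA1)].
have sPN : conj_aut E1 @* S \subset NG.
  apply/subsetP=> _ /morphimP[s Ns Ss ->]; apply/memN; split.
    exact: (conj_aut_mem n1 syl1).
  move=> x Kx; rewrite (conj_autS n1) // ?(subsetP sKE1) // -commgEl; exact: cJ.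
have sylN : p.-Sylow(NG) (conj_aut E1 @* S) := pHall_subl sPN (normal_sub nN) syl1.
have fr := Frattini_arg nN sylN.
have sP2K : 'Phi(E2) \subset K1 by rewrite eK.
move=> a y; rewrite -fr => /mulsgP[n z /memN[An tn] /setIP[Az nz] ->] Py.
have [t Bt tz] := ext1 Az nz; have Ky := subsetP sP2K _ Py.
rewrite permM -tz ?(subsetP sKE1) ?iv1 //.
apply: (res2 (inv_Phi sA2) (Phi_sub E2) Bt).
by rewrite -(mulKVg y (n y)) groupM //; apply: (subsetP (subsetIr 'Phi(E1) 'Phi(E2))); apply: tn.
Qed.

Lemma maximal_index_normal (G H : {group gT}) : p.-group G -> H \subset G -> #|G : H| = p -> H <| G.
Proof. by move=> pG sHG iH; apply: (p_maximal_normal pG); apply: p_index_maximal; rewrite ?iH. Qed.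

(* If the [p]-th powers of [E1] vanished modulo [R := lowerp E1 2], then [M / R] would have order at
   most [p], so any [q] in [Phi(E2)] outside [Phi(E1)] would have a centraliser of index [p] in
   [E1 / R].  That centraliser is abelian; it is not [A1]-invariant, so two of its conjugates meet
   in a central subgroup of index [p ^ 2], against irreducibility. *)
Lemma pair_AA_power Y1 Y2 : typeA p S E1 A1 D Y1 -> typeA p S E2 A2 D Y2 ->
  {in E1, forall x, (x ^+ p \in lowerp E1 2) = (x \in 'Phi(E1))}.
Proof.
case=> iP1 irr [nY1 sPY1 sY1D iD1 iY1] [nE1 ncD1].
case=> iP2 irr2 [nY2 sPY2 sY2D iD2 iY2] [nE2 ncD2].
have iDP1 : #|D : 'Phi(E1)| = (p ^ 2)%N by rewrite -(Lagrange_index sY1D sPY1) iD1 iY1 mulnn.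
have iDP2 : #|D : 'Phi(E2)| = (p ^ 2)%N by rewrite -(Lagrange_index sY2D sPY2) iD2 iY2 mulnn.
have [eM iM1 iM2 nP] := Phi_D_eq iDP1 iDP2 ncD1.
have eL1 : lowerp E1 1 :=: 'Phi(E1).
  by apply/eqP; rewrite eqEsubset lowerpS join_subG subxx joing_subl (comm_sub_Phi p1).
pose R := lowerp E1 2.
have nRE : R <| E1 := char_normal (lowerp_char E1 2).
have nRS : R <| S by apply: char_normal_trans (lowerp_char E1 2) n1.
have nR := subsetP (normal_norm nRS); have nRE' := normal_norm nRE.
have nMS : 'Phi(D)%G <| S by rewrite /= eM normalI.
have cM (X : {group gT}) : X <| S -> 'Phi(D) \subset X -> #|X : 'Phi(D)| = p -> [~: X, S] \subset 'Phi(D).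
  by move=> nX sMX iX; apply: (pgroup_comm_index p_pr pS nMS nX sMX); rewrite iX.
have cM1 : [~: 'Phi(E1), S] \subset 'Phi(D) by apply: (cM 'Phi(E1)%G); rewrite ?eM ?subsetIl.
have cM2 : [~: 'Phi(E2), S] \subset 'Phi(D) by apply: (cM 'Phi(E2)%G); rewrite ?eM ?subsetIr.
have sRM : R \subset 'Phi(D).
  rewrite /R lowerpS join_subG /= eL1 (subset_trans (commgS _ s1) cM1) andbT.
  by apply: PhiS => //; apply: pgroupS sDS pS.
have sMP : 'Phi(D) \subset 'Phi(E1) by rewrite eM subsetIl.
have iR : inv_under A1 R := inv_char sA1 (subxx _) (inv_E sA1) (lowerp_char E1 2).
have [K sKE kerP] : exists2 K : {group gT}, K \subset E1 &
    {in E1, forall x, (x \in K) = (x ^+ p \in R)}.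
  pose f x := coset R (x ^+ p).
  have fM : {in E1 &, {morph f : x y / x * y}} by move=> x y; apply: (lowerp_powM p_pr p_odd p1 (k := 0)).
  exists ('ker (Morphism fM))%G; first exact: subsetIl.
  move=> x Ex; have -> : (x \in 'ker (Morphism fM)) = (f x == 1) by rewrite !inE Ex.
  have Nx : x ^+ p \in 'N(R) by rewrite groupX ?(subsetP nRE').
  by apply/eqP/idP=> [/(coset_idr Nx)|/coset_id].
have iK : inv_under A1 K.
  move=> a x Aa Kx; have Ex := subsetP sKE _ Kx.
  have AutA := subsetP sA1 _ Aa; rewrite kerP // in Kx; rewrite kerP ?(Aut_closed AutA) //.
  by rewrite -(AutX _ AutA) // iR.
have sPK : 'Phi(E1) \subset K.
  apply/subsetP=> x Px; rewrite kerP ?(subsetP (Phi_sub E1)) // (lowerp_pow p1) // eL1 //.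
have [e|e] := irr _ iK sPK sKE; first by move=> x Ex; rewrite -kerP // e.
have xpR x : x \in E1 -> x ^+ p \in R by move=> Ex; rewrite -kerP ?e.
have sPE1 := Phi_sub E1.
have cPR x y : x \in 'Phi(E1) -> y \in E1 -> [~ x, y] \in R.
  by move=> Px Ey; apply: lowerp_comm; rewrite ?eL1.
have leMR : #|'Phi(D) : R| <= p.
  apply: (index_Phi_over_le p_pr (pgroupS sDS pS) _ (Z := 'Phi(E1)%G)) => //.
  - by apply: normalS nRS; [apply: subset_trans sRM (Phi_sub D)|].
  - exact: subset_trans sRM sMP.
  - rewrite gen_subG; apply/subsetP=> _ /imset2P[x y Px Dy ->]; apply: cPR => //.
    exact: (subsetP sD1).
  - by move=> x Dx; apply: xpR; apply: (subsetP sD1).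
have [q Pq nPq] := subsetPn nP; have Dq := subsetP sP2D _ Pq; have Eq := subsetP sD1 _ Dq.
pose Zc := cent_mod E1 R E1.
have iZc : inv_under A1 Zc := cent_mod_inv sA1 (subxx _) nRE' (inv_E sA1) iR.
have sPZ : 'Phi(E1) \subset Zc.
  apply/subsetP=> x Px; apply/(cent_modP _ nRE' nRE'); split; first exact: (subsetP sPE1).
  by move=> y Ey; apply: cPR.
(* Otherwise [E1 / R] would be abelian of exponent [p], so [Phi(E1)] would lie in [R], hence in
   [Phi(E2)]. *)
have eZ : Zc :=: 'Phi(E1).
  have [//|eZ] := irr _ iZc sPZ (cent_mod_sub _ _ _).
  have : 'Phi(E1) \subset R.
    rewrite (Phi_joing p1) join_subG (MhoE _ p1) !gen_subG; apply/andP; split.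
      apply/subsetP=> _ /imset2P[x y Ex Ey ->]; move: Ex; rewrite -{1}eZ.
      by case/(cent_modP _ nRE' nRE')=> _; apply.
    by apply/subsetP=> _ /imsetP[x Ex ->]; rewrite expn1 xpR.
  by move/subset_trans/(_ sRM); rewrite eM => /negP[]; apply/negP; apply: index_p_neq iM1.
have pER : p.-group (E1 / R) := quotient_pgroup R p1.
have Nq : q \in 'N(R) := subsetP nRE' _ Eq.
pose C := (E1 :&: coset R @*^-1 'C[coset R q])%G.
have CP x : reflect (x \in E1 /\ [~ x, q] \in R) (x \in C).
  apply: (iffP setIP) => [] [Ex cx]; split=> //; have Nx := subsetP nRE' _ Ex.
    have cxq : commute (coset R x) (coset R q).
      by case/morphpreP: cx => _ /cent1P.
    apply: coset_idr; first by rewrite groupR.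
    by rewrite (morphR (coset_morphism R)) //=; apply/eqP/commgP.
  apply: mem_morphpre => //; apply/cent1P; exact: coset_comm1.
have sCE : C \subset E1 := subsetIl _ _.
have Cq : q \in C by apply/CP; rewrite commgg group1.
have sPC : 'Phi(E1) \subset C by apply/subsetP=> x Px; apply/CP; split; [exact: (subsetP sPE1)|exact: cPR].
have sRC : R \subset C := subset_trans (subset_trans sRM sMP) sPC.
have CR : C / R = 'C_(E1 / R)[coset R q].
  apply/setP=> z; apply/idP/setIP=> [/morphimP[x Nx Cx ->]|[/morphimP[x Nx Ex ->] cz]].
    by have /setIP[Ex /morphpreP[_ cx]] := Cx; rewrite mem_quotient.
  by apply: mem_quotient; rewrite inE Ex mem_morphpre.
(* All commutators [[q, y]] with [y] in [E1] lie in [Phi(D)], since [S] centralises [Phi(E2)] modulo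
   [Phi(D)]. *)
have leC : #|E1 : C| <= p.
  rewrite -(index_quotient_eq (H := R)) //; last by rewrite subIset // sRC orbT.
  rewrite CR index_cent1; apply: leq_trans leMR.
  rewrite -card_quotient; last by apply: subset_trans (normal_norm nRS); apply: subset_trans (Phi_sub _) sDS.
  rewrite -(card_lcoset ('Phi(D) / R) (coset R q)); apply: subset_leq_card.
  apply/subsetP=> _ /imsetP[_ /morphimP[y Ny Ey ->] ->].
  rewrite mem_lcoset -commgEl -(morphR (coset_morphism R)) //= mem_quotient //.
  by apply: (subsetP cM2); rewrite mem_commg // (subsetP s1).
have iC : #|E1 : C| = p.
  have [e1|//] := pgroup_indexP p_pr p1 sCE leC.
  have sEC : E1 \subset C by rewrite -indexg_eq1 e1.
  case/negP: nPq; rewrite -eZ; apply/(cent_modP _ nRE' nRE'); split=> // y Ey.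
  by rewrite -groupV invg_comm; have /CP[] := subsetP sEC _ Ey.
have nRC : C \subset 'N(R) := subset_trans sCE nRE'.
have iCP : #|C : 'Phi(E1)| = (p ^ 2)%N.
  apply/eqP; rewrite -(eqn_pmul2l (prime_gt0 p_pr)) -{1}iC Lagrange_index //.
  by rewrite iP1 -expnS.
have pCR : p.-group (C / R) := quotient_pgroup R (pgroupS sCE p1).
(* Its centre contains the images of [Phi(E1)] and [q], which leaves a cyclic quotient. *)
have abC : abelian (C / R).
  have sPZC : 'Phi(E1) / R \subset 'Z(C / R).
    rewrite subsetI quotientS //= quotient_cents2 ?(subset_trans sPE1) //.
    by rewrite gen_subG; apply/subsetP=> _ /imset2P[x y Px /(subsetP sCE) Ey ->]; apply: cPR.
  have Zq : coset R q \in 'Z(C / R).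
    apply/setIP; split; first exact: mem_quotient.
    apply/centP=> _ /morphimP[x Nx /CP[Ex xq] ->]; apply: commute_sym; exact: coset_comm1.
  have sRP1 := subset_trans sRM sMP.
  have ltPZ : 'Phi(E1) / R \proper 'Z(C / R).
    rewrite properE sPZC; apply/subsetPn; exists (coset R q) => //.
    apply: contra nPq => /morphimP[x Nx Px /(rcoset_kercosetP Nq Nx)].
    by rewrite mem_rcoset => /(subsetP sRP1); rewrite groupMr ?groupV.
  have leZ : #|C / R : 'Z(C / R)| <= p.
    have := Lagrange_index (center_sub (C / R)) sPZC.
    rewrite (index_quotient_eq (H := R) (G := C)) ?iCP //; last by rewrite subIset // sRP1 orbT.
    have := pgroup_index_gt p_pr (pgroupS (center_sub _) pCR) ltPZ.
    by move=> l e2; rewrite -(leq_pmul2r (prime_gt0 p_pr)) mulnn -e2 leq_mul2l l orbT.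
  apply: cyclic_center_factor_abelian.
  have [e1|e1] := pgroup_indexP p_pr pCR (center_sub _) leZ.
    by apply: cyclicS (cyclic1 _); rewrite subG1 trivg_card1 card_quotient ?gFnorm // e1.
  by apply: prime_cyclic; rewrite card_quotient ?gFnorm // e1.
have cC x y : x \in C -> y \in C -> [~ x, y] \in R.
  move=> Cx Cy; have Nx := subsetP nRC _ Cx; have Ny := subsetP nRC _ Cy.
  apply: coset_idr; first by rewrite groupR.
  rewrite (morphR (coset_morphism R)) //=; apply/eqP/commgP.
  by apply: (centsP abC); apply: mem_quotient.
have [/'forall_in_forall_inP iC1|] := boolP [forall a in A1, forall x in C, a x \in C].
  have [|eC|eC] := irr _ _ sPC sCE; first by move=> a x Aa Cx; apply: iC1.
    by move: iP1; rewrite -eC iC => /eqP; rewrite -{1}[p]expn1 eqn_exp2l ?prime_gt1.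
  by move: (index_p_neq iC); rewrite eC subxx.
rewrite negb_forall_in => /exists_inP[a Aa]; rewrite negb_forall_in => /exists_inP[x0 Cx0 nCx0].
have AutA := subsetP sA1 _ Aa; pose aC := (autm AutA @* C)%G.
have saC : aC \subset E1.
  exact: subset_trans (morphimS _ sCE) (inv_morphim AutA Aa (inv_E sA1)).
have caC : #|aC| = #|C| by rewrite card_injm ?injm_autm.
have naC : ~~ (aC \subset C).
  by apply/subsetPn; exists (a x0) => //; rewrite -(autmE AutA) mem_morphim // (subsetP sCE).
have eE : aC * C = E1 := prime_index_mul p_pr (maximal_index_normal p1 sCE iC) iC saC naC.
have sIP : aC :&: C \subset 'Phi(E1).
  rewrite -eZ; apply/subsetP=> x /setIP[aCx Cx]; have Ex := subsetP sCE _ Cx.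
  apply/(cent_modP _ nRE' nRE'); split=> // y; rewrite -eE => /mulsgP[u v aCu Cv ->].
  have Rxu : [~ x, u] \in R.
    case/morphimP: aCx => x' Ex' Cx' ->; case/morphimP: aCu => u' Eu' Cu' ->.
    rewrite (_ : [~ _, _] = a [~ x', u']); last by rewrite (AutR AutA).
    by rewrite iR // cC.
  rewrite commgMJ groupM ?cC // memJ_norm //; exact: (subsetP nRC).
have := mul_cardG aC C; rewrite eE caC => eCard.
have le1 : #|aC :&: C| <= #|'Phi(E1)| := subset_leq_card sIP.
have : (#|'Phi(E1)| * p ^ 3) * p <= #|'Phi(E1)| * p ^ 3.
  rewrite -iP1 Lagrange // -(leq_pmul2l (cardG_gt0 E1)).
  have eC : #|E1| = (#|C| * p)%N by rewrite -iC Lagrange.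
  rewrite {1 2}eC; rewrite (_ : #|C| * p * (#|C| * p * p) = #|C| * #|C| * p ^ 3)%N; last first.
    by rewrite !expnS expn0 muln1 mulnACA !mulnA.
  by rewrite eCard -mulnA leq_pmul2l // -[X in _ <= X](Lagrange sPE1) iP1 leq_pmul2r // expn_gt0 prime_gt0.
by rewrite -{2}[(_ * p ^ 3)%N]muln1 leq_pmul2l ?muln_gt0 ?cardG_gt0 ?expn_gt0 ?prime_gt0 // leqNgt prime_gt1.
Qed.

(** By [pair_AA_power] the power map embeds [E1 / Phi(E1)], of order [p ^ 3], in [Phi(E1) / R]. The
    rank bound for [Phi(E1)] makes the target no larger, so the map is onto, as [uniform_exponent]
    requires. *)
Lemma pair_AA_exponent Y1 Y2 : typeA p S E1 A1 D Y1 -> typeA p S E2 A2 D Y2 ->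
  exists m, {in E1, forall x, (x ^+ (p ^ m) == 1) = (x \in 'Phi(E1))}.
Proof.
move=> T1 T2; have xpR := pair_AA_power T1 T2.
have [iP1 irr _ _] := T1; have sPE1 := Phi_sub E1.
have eL1 : lowerp E1 1 :=: 'Phi(E1).
  by apply/eqP; rewrite eqEsubset lowerpS join_subG subxx joing_subl (comm_sub_Phi p1).
pose R := lowerp E1 2; have nR : E1 \subset 'N(R) := char_norm (lowerp_char E1 2).
have P0 : pow_onto p E1 0.
  pose f x := coset R (x ^+ p).
  have fM : {in E1 &, {morph f : x y / x * y}} by move=> x y; apply: (lowerp_powM p_pr p_odd p1 (k := 0)).
  have kerE : 'ker (Morphism fM) = 'Phi(E1).
    apply/setP=> x; have [Ex|nEx] := boolP (x \in E1); last first.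
      rewrite inE (negPf nEx) /=; apply/esym/negbTE; apply: contra nEx; exact: (subsetP sPE1).
    rewrite -xpR //; have -> : (x \in 'ker (Morphism fM)) = (f x == 1) by rewrite !inE Ex.
    have Nx : x ^+ p \in 'N(R) by rewrite groupX ?(subsetP nR).
    by apply/eqP/idP=> [/(coset_idr Nx)|/coset_id].
  have cf : #|Morphism fM @* E1| = (p ^ 3)%N.
    by rewrite -(card_isog (first_isog (Morphism fM))) kerE card_quotient ?gFnorm.
  have sfP : Morphism fM @* E1 \subset 'Phi(E1) / R.
    by apply/subsetP=> _ /morphimP[x _ Ex ->]; apply: mem_quotient; apply: pow_in_Phi.
  have sRP : 'Phi('Phi(E1)) \subset R by rewrite /R lowerpS /= eL1 joing_subl.
  have sRP1 : R \subset 'Phi(E1) by rewrite -eL1; apply: lowerp_sub.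
  have leP : #|'Phi(E1) / R| <= p ^ 3.
    rewrite card_quotient ?(subset_trans sPE1) //.
    apply: leq_trans (index_Phi_le (subset_trans sPE1 s1)).
    by rewrite -(Lagrange_index sRP1 sRP) leq_pmulr.
  have ef : Morphism fM @* E1 = 'Phi(E1) / R.
    by apply/eqP; rewrite eqEcard sfP cf.
  move=> y; rewrite eL1 => Py; have : coset R y \in 'Phi(E1) / R by apply: mem_quotient.
  by rewrite -ef => /morphimP[x _ Ex e]; exists x.
have ntE : E1 :!=: 1.
  apply: contraTneq (prime_gt1 p_pr) => e; have := dvdn_indexg E1 D.
  by rewrite i1 e cards1 dvdn1 => /eqP ->.
have [|m mP] := uniform_exponent p_pr p_odd p1 sA1 ntE _ P0.
  by move=> X iX; rewrite eL1; apply: irr.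
by exists m => x Ex; rewrite mP // eL1.
Qed.

End Pair.

Section PairBB.
Local Open Scope group_scope.
Variables (p : nat) (gT : finGroupType).
Hypotheses (p_pr : prime p) (p_odd : odd p).
Variables (S E1 E2 : {group gT}) (A1 A2 : {group {perm gT}}) (B : {set {perm gT}}).
Variable D : {group gT}.
Hypothesis ctx : pair_context p S E1 E2 A1 A2 B D.
Hypothesis rkS : forall H : {group gT}, H \subset S -> 'm(H) <= 3.

(** Applied on both sides, [pair_BB_cent] makes [S] centralise [D] modulo [Phi(D)], hence modulo
    [Phi(E1)]. *)
Lemma pair_BB t1 t2 : typeB p S E1 A1 D t1 -> typeB p S E2 A2 D t2 -> False.
Proof.
move=> B1 B2; have [_ [sP1 i1] _ nc _] := B1; have [_ [_ i2] _ _ _] := B2.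
have c1 := pair_BB_cent p_pr ctx rkS B1 i2.
have c2 := pair_BB_cent p_pr (pair_sym ctx) rkS B2 i1.
have [[pS _] [nDS eD] eS [[n1 _] _ _ _ _] _] := ctx.
have nM : S \subset 'N('Phi(D)) := char_norm_trans (Phi_char D) (normal_norm nDS).
have sDE : D \subset E1 by rewrite -eD subsetIl.
have sDN := subset_trans (normal_sub nDS) nM; case/negP: nc.
apply: subset_trans (PhiS (pgroupS (normal_sub n1) pS) sDE).
rewrite -quotient_cents2 // -eS quotientMl; last by apply: subset_trans nM; rewrite normal_sub.
rewrite centM subsetI !quotient_cents2 ?c1 ?c2 //; apply: subset_trans nM; first by rewrite -eS mulG_subr.
exact: normal_sub.
Qed.

(** The smaller of the two exponents puts its Frattini subgroup inside the other one, whereas both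
    have index [p] over their intersection. *)
Lemma pair_AA Y1 Y2 : typeA p S E1 A1 D Y1 -> typeA p S E2 A2 D Y2 -> False.
Proof.
move=> T1 T2; have [_ _ [nY1 sPY1 sY1D iD1 iY1] [nE1 ncD1]] := T1.
have [_ _ [nY2 sPY2 sY2D iD2 iY2] _] := T2.
have [m1 m1P] := pair_AA_exponent p_pr p_odd ctx rkS T1 T2.
have [m2 m2P] := pair_AA_exponent p_pr p_odd (pair_sym ctx) rkS T2 T1.
have [_ [nDS eD] _ _ _] := ctx.
have sDE1 : D \subset E1 by rewrite -eD subsetIl.
have sDE2 : D \subset E2 by rewrite -eD subsetIr.
have iDP1 : #|D : 'Phi(E1)| = (p ^ 2)%N by rewrite -(Lagrange_index sY1D sPY1) iD1 iY1 mulnn.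
have iDP2 : #|D : 'Phi(E2)| = (p ^ 2)%N by rewrite -(Lagrange_index sY2D sPY2) iD2 iY2 mulnn.
have [eM i1 i2 nP] := Phi_D_eq p_pr ctx rkS iDP1 iDP2 ncD1.
have sP1 := subset_trans sPY1 sY1D; have sP2 := subset_trans sPY2 sY2D.
have pow_le j k (x : gT) : j <= k -> x ^+ (p ^ j) = 1 -> x ^+ (p ^ k) = 1.
  by move=> le xj; rewrite -(subnKC le) expnD expgM xj expg1n.
have [le|/ltnW le] := leqP m1 m2.
  have nP1 : ~~ ('Phi(E1) \subset 'Phi(E2)).
    apply: contra (index_p_neq p_pr i1) => sP; by rewrite subsetI subxx.
  case/negP: nP1; apply/subsetP=> x Px; have Dx := subsetP sP1 _ Px.
  rewrite -m2P ?(subsetP sDE2) //; apply/eqP; apply: (pow_le _ _ _ le).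
  by apply/eqP; rewrite m1P ?(subsetP sDE1).
case/negP: nP; apply/subsetP=> x Px; have Dx := subsetP sP2 _ Px.
rewrite -m1P ?(subsetP sDE1) //; apply/eqP; apply: (pow_le _ _ _ le).
by apply/eqP; rewrite m2P ?(subsetP sDE2).
Qed.

End PairBB.

(** * A Sylow p-subgroup of Sp4(p) *)

Section JordanGroups.
Local Open Scope group_scope.
Variable p : nat.
Hypothesis p_pr : prime p.

(** Relations for a cyclic group of order [p] acting on an elementary abelian group of rank three by
    one Jordan block. They only bound the order; [jordan_isog] adds the equality. *)
Definition jordan3 (gT : finGroupType) (v1 v2 v3 x : gT) :=
  [/\ [/\ commute v1 v2, commute v1 v3 & commute v2 v3],
      [/\ v1 ^+ p = 1, v2 ^+ p = 1, v3 ^+ p = 1 & x ^+ p = 1]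
    & [/\ v1 ^ x = v1 * v2, v2 ^ x = v2 * v3 & v3 ^ x = v3]].

Definition jordan_gen (gT : finGroupType) (v1 v2 v3 x : gT) : {group gT} :=
  <<[set v1; v2; v3; x]>>%G.

Lemma card_joing_le (gT : finGroupType) (A B : {group gT}) (m n : nat) :
  B \subset 'N(A) -> #|A| <= m -> #|B| <= n -> #|A <*> B| <= m * n.
Proof.
move=> nAB lA lB; rewrite norm_joinEr //; apply: leq_trans (leq_mul lA lB).
by rewrite mul_cardG leq_pmulr // cardG_gt0.
Qed.

Lemma card_cycle_le (gT : finGroupType) (v : gT) : v ^+ p = 1 -> #|<[v]>| <= p.
Proof.
by move=> vp; rewrite -orderE dvdn_leq ?prime_gt0 // order_dvdn vp.
Qed.

Lemma card_jordan_gen (gT : finGroupType) (v1 v2 v3 x : gT) : jordan3 v1 v2 v3 x ->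
  #|jordan_gen v1 v2 v3 x| <= p ^ 4.
Proof.
case=> [[c12 c13 c23] [o1 o2 o3 ox] [e1 e2 e3]].
pose U := (<[v1]> <*> <[v2]> <*> <[v3]>)%G.
have [U1 U2 U3] : [/\ v1 \in U, v2 \in U & v3 \in U].
  split; rewrite -cycle_subG ?joing_subr //; apply: subset_trans (joing_subl _ _).
    exact: joing_subl.
  exact: joing_subr.
have n2 : <[v2]> \subset 'N(<[v1]>).
  by apply: cents_norm; rewrite cent_cycle cycle_subG; apply/cent1P.
have n3 : <[v3]> \subset 'N(<[v1]> <*> <[v2]>).
  apply: cents_norm; rewrite centsC join_subG; apply/andP.
  by split; rewrite cycle_subG /= cent_cycle; apply/cent1P.
have nx : <[x]> \subset 'N(U).
  by rewrite cycle_subG inE /= !conjYg -!cycleJ e1 e2 e3 !join_subG !cycle_subG !groupM.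
have lU : #|U| <= p * p * p by rewrite !card_joing_le ?card_cycle_le.
have -> : jordan_gen v1 v2 v3 x :=: U <*> <[x]>.
  have sx := subsetP (joing_subr U <[x]>) _ (cycle_id x).
  have sU := subsetP (joing_subl U <[x]>).
  apply/eqP; rewrite eqEsubset gen_subG !subUset !sub1set sx !sU //=.
  by rewrite !join_subG !cycle_subG !mem_gen // !inE eqxx ?orbT.
apply: leq_trans (card_joing_le nx lU (card_cycle_le ox)) _.
by rewrite !expnS expn0 muln1 !mulnA.
Qed.

Lemma isog_leq_card (aT rT : finGroupType) (D G : {group aT}) (f : {morphism D >-> rT}) :
  G \subset D -> #|G| <= #|f @* G| -> G \isog f @* G.
Proof.
move=> sGD le; rewrite -(im_restrm sGD f); apply: sub_isog => //.
by rewrite -card_im_injm im_restrm eqn_leq le leq_morphim.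
Qed.

(** The pairs of generators satisfy the same relations, so they generate a group of order at most
    [p ^ 4]. This is the order of both images, so both projections are injective. *)
Lemma jordan_isog (gT hT : finGroupType) (v1 v2 v3 x : gT) (w1 w2 w3 y : hT) :
  jordan3 v1 v2 v3 x -> jordan3 w1 w2 w3 y ->
  #|jordan_gen v1 v2 v3 x| = (p ^ 4)%N -> #|jordan_gen w1 w2 w3 y| = (p ^ 4)%N ->
  jordan_gen v1 v2 v3 x \isog jordan_gen w1 w2 w3 y.
Proof.
move=> jv jw cv cw.
(* The diagonal subgroup of the product projects onto both groups. *)
pose D := jordan_gen (v1, w1) (v2, w2) (v3, w3) (x, y).
have jD : jordan3 (v1, w1) (v2, w2) (v3, w3) (x, y).
  case: jv => [[c12 c13 c23] [o1 o2 o3 ox] [e1 e2 e3]].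
  case: jw => [[d12 d13 d23] [q1 q2 q3 qx] [f1 f2 f3]].
  have Xp (i : nat) (a : gT) (b : hT) : (a, b) ^+ i = (a ^+ i, b ^+ i).
    by elim: i => // i IH; rewrite !expgS IH.
  split; split; rewrite /commute ?Xp; apply/eqP; rewrite xpair_eqE; apply/andP; split; apply/eqP=> //=.
have lD := card_jordan_gen jD.
have im (rT : finGroupType) (f : {morphism [set: (gT * hT)%type] >-> rT}) :
    f @* D = jordan_gen (f (v1, w1)) (f (v2, w2)) (f (v3, w3)) (f (x, y)).
  by rewrite morphim_gen ?subsetT // !morphimU !morphim_set1 ?inE.
have iso (rT : finGroupType) (f : {morphism [set: (gT * hT)%type] >-> rT}) :
    #|jordan_gen (f (v1, w1)) (f (v2, w2)) (f (v3, w3)) (f (x, y))| = (p ^ 4)%N ->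
    D \isog jordan_gen (f (v1, w1)) (f (v2, w2)) (f (v3, w3)) (f (x, y)).
  by move=> c; rewrite -im; apply: isog_leq_card; rewrite ?subsetT ?im ?c.
have i1 := iso _ (fst_morphism gT hT) cv; have i2 := iso _ (snd_morphism gT hT) cw.
by rewrite isog_sym in i1; apply: isog_trans i1 i2.
Qed.

End JordanGroups.

(** * Two by two matrices and their block matrices *)

Section Matrices22.
Import GRing.Theory.
Local Open Scope ring_scope.
Variable F : comNzRingType.
Implicit Types a b c d k : F.

Definition mx2 a b c d : 'M[F]_2 :=
  \matrix_(i < 2, j < 2) (if i == 0 then if j == 0 then a else b else if j == 0 then c else d).

Lemma mx2_eta (A : 'M[F]_2) : A = mx2 (A 0 0) (A 0 1) (A 1 0) (A 1 1).
Proof.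
apply/matrixP=> i j; rewrite mxE.
have o2 (k : 'I_2) : k = 0 \/ k = 1.
  by case: k => [[|[|//]] h]; [left|right]; apply: val_inj.
by case: (o2 i) => ->; case: (o2 j) => ->.
Qed.

Lemma mx2_inj a b c d a' b' c' d' : mx2 a b c d = mx2 a' b' c' d' ->
  [/\ a = a', b = b', c = c' & d = d'].
Proof.
by move=> e; split; [have := congr1 (fun A : 'M_2 => A 0 0) e | have := congr1 (fun A : 'M_2 => A 0 1) e
  | have := congr1 (fun A : 'M_2 => A 1 0) e | have := congr1 (fun A : 'M_2 => A 1 1) e]; rewrite !mxE.
Qed.

Lemma mul_mx2 a b c d a' b' c' d' : mx2 a b c d *m mx2 a' b' c' d' =
  mx2 (a * a' + b * c') (a * b' + b * d') (c * a' + d * c') (c * b' + d * d').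
Proof.
apply/matrixP=> i j; rewrite !mxE !big_ord_recl big_ord0 !mxE /= addr0.
by case: (i == 0); case: (j == 0).
Qed.

Lemma add_mx2 a b c d a' b' c' d' : mx2 a b c d + mx2 a' b' c' d' =
  mx2 (a + a') (b + b') (c + c') (d + d').
Proof. by apply/matrixP=> i j; rewrite !mxE; case: (i == 0); case: (j == 0). Qed.

Lemma tr_mx2 a b c d : (mx2 a b c d)^T = mx2 a c b d.
Proof. by apply/matrixP=> i j; rewrite !mxE; case: (i == 0); case: (j == 0). Qed.

Lemma mx2_1 : 1%:M = mx2 1 0 0 1.
Proof. by rewrite [1%:M]mx2_eta !mxE. Qed.

Lemma mx2_0 : 0 = mx2 0 0 0 0.
Proof. by rewrite [0]mx2_eta !mxE. Qed.

Definition mx2E := (mul_mx2, add_mx2, tr_mx2).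

Definition Umx k := mx2 1 k 0 1.
(** The inverse transpose of [Umx k], the lower diagonal block that the symplectic form forces. *)
Definition Wmx k := mx2 1 0 (- k) 1.
Definition symx a b c := mx2 a b b c.

Definition blk (A B C D : 'M[F]_2) : 'M[F]_4 := block_mx A B C D.

Lemma mul_blk A B C D A' B' C' D' : blk A B C D *m blk A' B' C' D' =
  blk (A *m A' + B *m C') (A *m B' + B *m D') (C *m A' + D *m C') (C *m B' + D *m D').
Proof. exact: (mulmx_block A B C D A' B' C' D'). Qed.

Lemma tr_blk A B C D : (blk A B C D)^T = blk A^T C^T B^T D^T.
Proof. exact: (tr_block_mx A B C D). Qed.

Lemma blk_inj A B C D A' B' C' D' : blk A B C D = blk A' B' C' D' ->
  [/\ A = A', B = B', C = C' & D = D'].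
Proof. exact: (@eq_block_mx _ 2 2 2 2). Qed.

Lemma blk1 : 1%:M = blk 1%:M 0 0 1%:M.
Proof. exact: (@scalar_mx_block _ 2 2 1). Qed.

Lemma blk_eta (M : 'M[F]_4) : exists A B C D, M = blk A B C D.
Proof.
pose M' : 'M_(2 + 2) := M.
by exists (ulsubmx M'), (ursubmx M'), (dlsubmx M'), (drsubmx M'); rewrite /blk submxK.
Qed.

(* [jmx k X] is the matrix of [x ^+ k * n(X)], where x = diag(u, u^-T) with u = [[1,1],[0,1]]
   and n(X) = [[1,X],[0,1]]. *)
Definition jmx k (X : 'M[F]_2) := blk (Umx k) (Umx k *m X) 0 (Wmx k).

Lemma jmx_mul k l X Y : jmx k X *m jmx l Y =
  jmx (k + l) (Umx (- l) *m X *m Wmx l + Y).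
Proof.
rewrite /jmx mul_blk !mulmx0 !mul0mx !addr0 !add0r.
have eU : Umx (k + l) = Umx k *m Umx l.
  by rewrite /Umx !mx2E; congr mx2; ring.
have eW : Wmx (k + l) = Wmx k *m Wmx l.
  by rewrite /Wmx !mx2E; congr mx2; ring.
have eUV : Umx l *m Umx (- l) = 1%:M.
  by rewrite mx2_1 /Umx !mx2E; congr mx2; ring.
by rewrite eU eW mulmxDr !mulmxA -(mulmxA (Umx k) (Umx l) (Umx (- l))) eUV mulmx1 addrC.
Qed.

Lemma Jform_cond (A B D : 'M[F]_2) :
  blk A B 0 D *m blk 0 1%:M (- 1%:M) 0 *m (blk A B 0 D)^T =
  blk (A *m B^T - B *m A^T) (A *m D^T) (- (D *m A^T)) 0.
Proof.
rewrite tr_blk !mul_blk trmx0 !(mulmx0, mul0mx, mulmx1, mulmxN, addr0, add0r) !mulNmx.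
by rewrite addrC.
Qed.

Lemma Umx_inv k : Umx k *m Umx (- k) = 1%:M.
Proof. by rewrite mx2_1 /Umx !mx2E; congr mx2; ring. Qed.

Lemma tr_Wmx k : (Wmx k)^T = Umx (- k).
Proof. by rewrite /Wmx /Umx mx2E. Qed.

Lemma symx_tr (X : 'M[F]_2) : X^T = X -> exists a b c, X = symx a b c.
Proof.
rewrite [X]mx2_eta tr_mx2 => /mx2_inj[_ e _ _].
by exists (X 0 0), (X 0 1), (X 1 1); rewrite /symx e.
Qed.

(* The lower blocks of a matrix that normalises the group of all [jmx k X], X symmetric. *)
Lemma normalizer_blocks (C D : 'M[F]_2) :
  (forall a b c, exists k, C *m symx a b c + D = Wmx k *m D) ->
  (exists k, D *m Wmx 1 = Wmx k *m D) -> C = 0 /\ exists d f g, D = mx2 d 0 f g.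
Proof.
rewrite (mx2_eta C) (mx2_eta D); move: (C 0 0) (C 0 1) (C 1 0) (C 1 1) => c0 c1 c2 c3.
move: (D 0 0) (D 0 1) (D 1 0) (D 1 1) => d0 d1 d2 d3 hX [k].
have simp := (mul1r, mulr1, mul0r, mulr0, addr0, add0r, mulrN, mulNr, oppr0).
have addl (x y : F) : x + y = y -> x = 0 by move=> e; apply: (addIr y); rewrite add0r.
rewrite /Wmx !mx2E !simp addrC => /mx2_inj[/addl/eqP e1 _ _ _].
have d1_0 : d1 = 0 by apply/eqP; rewrite -oppr_eq0.
have [k1] := hX 1 0 0; rewrite /Wmx /symx !mx2E d1_0 !simp => /mx2_inj[/addl f1 _ _ _].
have [k2] := hX 0 0 1; rewrite /Wmx /symx !mx2E d1_0 !simp => /mx2_inj[_ f2 _ /addl f3].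
have [k3] := hX 0 1 0; rewrite /Wmx /symx !mx2E d1_0 !simp => /mx2_inj[_ _ _ /addl f4].
rewrite f1 f2 f3 f4.
by rewrite mx2_0; split=> //; exists d0, d2, d3.
Qed.

End Matrices22.

(** * The unipotent group inside the symplectic group *)

Section SylowSp4.
Import GRing.Theory.
Local Open Scope group_scope.
Local Open Scope ring_scope.
Variable p : nat.
Hypotheses (p_pr : prime p) (p_odd : odd p).
Local Notation F := 'F_p.
Implicit Types (k : F) (X : 'M[F]_2).

Lemma Jform_blk : Jform p = blk 0 1%:M (- 1%:M) 0.
Proof.
apply/matrixP=> i j; rewrite /blk.
case: (@split_ordP 2 2 i) => i' ->; case: (@split_ordP 2 2 j) => j' ->.
- refine (etrans _ (esym (@block_mxEul _ 2 2 2 2 _ _ _ _ i' j'))); rewrite !mxE /=; case: i' j' => [[|[|//]] ?] [[|[|//]] ?] //=; rewrite ?oppr0 //.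
- refine (etrans _ (esym (@block_mxEur _ 2 2 2 2 _ _ _ _ i' j'))); rewrite !mxE /=; case: i' j' => [[|[|//]] ?] [[|[|//]] ?] //=; rewrite ?oppr0 //.
- refine (etrans _ (esym (@block_mxEdl _ 2 2 2 2 _ _ _ _ i' j'))); rewrite !mxE /=; case: i' j' => [[|[|//]] ?] [[|[|//]] ?] //=; rewrite ?oppr0 //.
- refine (etrans _ (esym (@block_mxEdr _ 2 2 2 2 _ _ _ _ i' j'))); rewrite !mxE /=; case: i' j' => [[|[|//]] ?] [[|[|//]] ?] //=; rewrite ?oppr0 //.
Qed.

Lemma jmx_unit k X : jmx k X \in unitmx.
Proof.
suff e : jmx k X *m jmx (- k) (- (Umx k *m X *m Wmx (- k))) = 1%:M.
  exact: (mulmx1_unit e).1.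
rewrite jmx_mul opprK subrr subrr /jmx mulmx0 blk1.
by congr blk; rewrite mx2_1 /Umx /Wmx ?oppr0.
Qed.

Definition GL4 : finGroupType := {'GL_4['F_p]}.

Lemma GL4_M (g h : GL4) : GLval (g * h)%g = GLval g *m GLval h.
Proof. by []. Qed.

Lemma GL4_1 : GLval (1%g : GL4) = 1%:M.
Proof. by []. Qed.

Definition jel k X : GL4 := locked (FinRing.unit _ (jmx_unit k X)).

Lemma jelE k X : GLval (jel k X) = jmx k X.
Proof. by rewrite /jel -lock. Qed.

Lemma GL_inj (g h : GL4) : GLval g = GLval h -> g = h.
Proof. exact: val_inj. Qed.

Lemma jel_mul k l X Y : (jel k X * jel l Y)%g = jel (k + l) (Umx (- l) *m X *m Wmx l + Y).
Proof. by apply: GL_inj; rewrite GL4_M !jelE jmx_mul. Qed.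

Lemma jel_inj k l X Y : jel k X = jel l Y -> k = l /\ X = Y.
Proof.
move/(congr1 GLval); rewrite !jelE => /blk_inj[eU eX _ _].
have [_ ekl _ _] := mx2_inj eU; split=> //; move: eX; rewrite ekl => eX.
have e : Umx (- l) *m Umx l = 1%:M by rewrite mx2_1 /Umx !mx2E; congr mx2; ring.
by rewrite -[X]mul1mx -[Y]mul1mx -e -!mulmxA eX.
Qed.

Lemma jel1 : jel 0 0 = 1%g.
Proof.
apply: GL_inj; rewrite jelE GL4_1 /jmx mulmx0 blk1; congr blk; by rewrite mx2_1 /Umx /Wmx ?oppr0.
Qed.

Lemma symx_add a b c a' b' c' : symx a b c + symx a' b' c' = symx (a + a') (b + b') (c + c') :> 'M[F]_2.
Proof. by rewrite /symx mx2E. Qed.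

Lemma symx0 : symx 0 0 0 = 0 :> 'M[F]_2.
Proof. by rewrite mx2_0. Qed.

Lemma WU0 X : Umx 0 *m X *m Wmx 0 = X.
Proof. by rewrite /Umx /Wmx oppr0 -mx2_1 mul1mx mulmx1. Qed.

Lemma jel_mul0 X Y : (jel 0 X * jel 0 Y)%g = jel 0 (X + Y).
Proof. by rewrite jel_mul oppr0 WU0 addr0. Qed.

Lemma jel_X X n : (jel 0 X ^+ n)%g = jel 0 (X *+ n).
Proof. by elim: n => [|n IH]; rewrite ?jel1 // expgS IH jel_mul0 -mulrS. Qed.

Lemma jel_Xk n : (jel 1%R 0 ^+ n)%g = jel n%:R 0.
Proof.
elim: n => [|n IH]; first by rewrite jel1.
rewrite expgS IH jel_mul mulmx0 mul0mx addr0.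
by rewrite nat1r.
Qed.

Lemma jel_split k X : jel k X = (jel k 0 * jel 0 X)%g.
Proof. by rewrite jel_mul addr0 mulmx0 mul0mx add0r. Qed.

(** Conjugation by [jx] sends [X] to [Umx (-1) *m X *m Wmx 1]. Starting from this diagonal unit,
    [jv2] and [jv3] are the successive differences. The entry 2 in [jv3] is invertible for odd [p],
    which makes the Jordan block full. *)
Definition jv1 := jel 0 (symx 0 0 1).
Definition jv2 := jel 0 (symx 1 (- 1) 0).
Definition jv3 := jel 0 (symx 2%:R 0 0).
Definition jx := jel 1 0.

Lemma natFp0 : p%:R = 0 :> F.
Proof. by have /andP[_ /eqP] := pchar_Fp p_pr. Qed.

Lemma jel_p X : (jel 0 X ^+ p)%g = 1%g.
Proof. by rewrite jel_X -scaler_nat natFp0 scale0r jel1. Qed.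

Lemma jel_conj X Y : Umx (- 1) *m X *m Wmx 1 = Y -> (jel 0 X ^ jx)%g = jel 0 Y.
Proof.
move=> e; rewrite conjgE /jx jel_mul add0r e addr0 (jel_split 1 Y).
by rewrite mulKg.
Qed.

Lemma jordan_matrices : jordan3 p jv1 jv2 jv3 jx.
Proof.
have cc X Y : commute (jel 0 X) (jel 0 Y) by rewrite /commute !jel_mul0 addrC.
split; [by split; apply: cc | | ].
  by split; [exact: jel_p | exact: jel_p | exact: jel_p | rewrite jel_Xk natFp0 jel1].
by split; rewrite /jv1 /jv2 /jv3 ?jel_mul0 ?symx_add; apply: jel_conj;
   rewrite /Umx /Wmx /symx !mx2E; congr mx2; ring.
Qed.

Definition jgrp := jordan_gen jv1 jv2 jv3 jx.

Lemma jel_in_jgrp k a b c : jel k (symx a b c) \in jgrp.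
Proof.
have two0 : 2%:R != 0 :> F.
  rewrite -(dvdn_pcharf (pchar_Fp p_pr)); apply: contraL p_odd => d2.
  have -> : p = 2%N by apply/eqP; rewrite eqn_leq (dvdn_leq _ d2) // prime_gt1.
  by [].
have nF (z : F) : (z : nat)%:R = z by exact: natr_Zp.
have gen z : z \in [set jv1; jv2; jv3; jx] -> z \in jgrp by apply: mem_gen.
have [g1 g2 g3 gx] : [/\ jv1 \in jgrp, jv2 \in jgrp, jv3 \in jgrp & jx \in jgrp].
  by split; apply: gen; rewrite !inE eqxx ?orbT.
rewrite jel_split groupM //; first by rewrite -(nF k) -jel_Xk groupX.
have -> : symx a b c = symx 0 0 1 *+ (c : nat) + symx 1 (- 1) 0 *+ ((- b)%R : F)
    + symx 2%:R 0 0 *+ ((a + b) / 2%:R : F).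
  have mulS (u v w : F) (z : F) : symx u v w *+ (z : nat) = symx (u * z) (v * z) (w * z).
    rewrite -{2 3 4}(nF z); elim: (z : nat) => [|n IH]; first by rewrite !mulr0 symx0.
    by rewrite mulrS IH symx_add !mulrS !mulrDr !mulr1.
  rewrite !mulS !symx_add; congr symx; field => //.
by rewrite -!jel_mul0 -!jel_X !groupM ?groupX.
Qed.

Definition jparam (u : F * (F * (F * F))) := jel u.1 (symx u.2.1 u.2.2.1 u.2.2.2).

(** The [p ^ 4] parameters give distinct elements of [jgrp], and the Jordan relations allow no
    more. *)
Lemma jgrpE : jgrp = [set jparam u | u : F * (F * (F * F))] :> {set _}.
Proof.
apply/esym/eqP; rewrite eqEcard; apply/andP; split.
  by apply/subsetP=> _ /imsetP[u _ ->]; apply: jel_in_jgrp.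
rewrite card_imset; last first.
  move=> [k [a [b c]]] [k' [a' [b' c']]] /jel_inj /= [-> /mx2_inj[-> -> _ ->]] //.
rewrite !card_prod card_Fp // (_ : p * (p * (p * p)) = p ^ 4)%N; last by rewrite !expnS expn0 muln1.
exact: (card_jordan_gen p_pr jordan_matrices).
Qed.

Lemma card_jgrp : #|jgrp| = (p ^ 4)%N.
Proof.
rewrite jgrpE card_imset; first by rewrite !card_prod card_Fp // !expnS expn0 muln1.
by move=> [k [a [b c]]] [k' [a' [b' c']]] /jel_inj /= [-> /mx2_inj[-> -> _ ->]].
Qed.

Lemma jgrpP g : reflect (exists k a b c, g = jel k (symx a b c)) (g \in jgrp).
Proof.
rewrite jgrpE; apply: (iffP imsetP) => [[[k [a [b c]]] _ ->]|[k [a [b [c ->]]]]].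
  by exists k, a, b, c.
by exists (k, (a, (b, c))).
Qed.

Lemma Sp4_blk (g : GL4) A B' D : GLval g = blk A B' 0 D ->
  (g \in Sp4 p) = (A *m D^T == 1%:M) && (A *m B'^T == B' *m A^T).
Proof.
move=> e; rewrite inE e Jform_blk Jform_cond; apply/eqP/andP=> [/blk_inj[e1 e2 _ _]|[/eqP e1 /eqP e2]].
  by split; apply/eqP => //; apply/eqP; rewrite -subr_eq0 e1.
have e3 : D *m A^T = 1%:M by apply: trmx_inj; rewrite trmx_mul trmxK trmx1.
by rewrite e1 e2 e3 subrr.
Qed.

Lemma Sp4_group : group_set (Sp4 p : {set GL4}).
Proof.
apply/group_setP; split=> [|g h]; first by rewrite inE GL4_1 trmx1 mul1mx mulmx1.
rewrite inE => /eqP eg; rewrite inE => /eqP eh; rewrite inE GL4_M trmx_mul.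
by rewrite -{2}eg -{2}eh !mulmxA.
Qed.

Lemma jgrp_sub_Sp4 : jgrp \subset Sp4 p.
Proof.
apply/subsetP=> _ /jgrpP[k [a [b [c ->]]]]; rewrite (Sp4_blk (jelE _ _)) tr_Wmx Umx_inv eqxx /=.
by rewrite trmx_mul mulmxA /symx tr_mx2.
Qed.

Lemma Fp_expp (z : F) n : z ^+ (p ^ n) = z.
Proof.
elim: n => [|n IH]; first by rewrite expn0 expr1.
by rewrite expnS exprM -[p in z ^+ p](card_Fp p_pr) expf_card IH.
Qed.

(** The order of the symplectic group is not computed. A larger [p]-subgroup would contain some [g]
    outside [jgrp] normalising it, and the blocks of such a [g] show that it belongs to [jgrp]. *)
Lemma jgrp_Sylow : p.-Sylow(Sp4 p) jgrp.
Proof.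
pose G := Group Sp4_group; have pP : p.-group jgrp by rewrite /pgroup card_jgrp pnatX pnat_id.
have [Q sylQ sPQ] := @Sylow_superset p _ G jgrp jgrp_sub_Sp4 pP.
suff -> : jgrp = Q by [].
apply/val_inj/eqP; rewrite /= eqEproper sPQ /=; apply/negP=> ltPQ.
have pQ := pHall_pgroup sylQ; have sQG := pHall_sub sylQ.
have /properP[_ [g /setIP[Qg nPg] /negP[]]] := nilpotent_proper_norm (pgroup_nil pQ) ltPQ.
have [A [B' [C [D eg]]]] := blk_eta (GLval g).
have conj h' : h' \in jgrp -> exists2 h, h \in jgrp & (g * h' = h * g)%g.
  move=> Ph'; exists (h' ^ g^-1)%g; first by rewrite memJ_norm ?groupV.
  by rewrite conjgE invgK mulgA mulgKV.
have low k X : jel k X \in jgrp -> exists l,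
    C *m (Umx k *m X) + D *m Wmx k = Wmx l *m D.
  case/conj=> _ /jgrpP[l [a [b [c ->]]]] /(congr1 GLval).
  rewrite !GL4_M eg !jelE !mul_blk => /blk_inj[_ _ _ e].
  by exists l; rewrite e mul0mx add0r.
have [C0 [d [f [d' eD]]]] : C = 0 /\ exists d f d', D = mx2 d 0 f d'.
  apply: normalizer_blocks => [a b c|].
    have [l e] := low _ _ (jel_in_jgrp 0 a b c); exists l.
    by move: e; rewrite /Umx /Wmx oppr0 -mx2_1 mul1mx mulmx1.
  have [l e] := low _ _ (jel_in_jgrp 1 0 0 0); exists l.
  by move: e; rewrite symx0 !mulmx0 add0r.
rewrite {}C0 {}eD in eg low.
(* Evaluated at the order of [g], a power of [p], this gives [d = d' = 1], since Frobenius fixes the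
   prime field. *)
have pow m : exists A' B'' f', GLval (g ^+ m)%g = blk A' B'' 0 (mx2 (d ^+ m) 0 f' (d' ^+ m)).
  elim: m => [|m [A1 [B1 [f1 e]]]].
    by exists 1%:M, 0, 0; rewrite expg0 GL4_1 blk1 !expr0 -mx2_1.
  exists (A *m A1), (A *m B1 + B' *m mx2 (d ^+ m) 0 f1 (d' ^+ m)), (f * d ^+ m + d' * f1).
  rewrite expgS GL4_M eg e mul_blk !mul0mx !mulmx0 !add0r !addr0 mul_mx2 !exprS.
  by congr blk; congr mx2; ring.
have [n on] := p_natP (mem_p_elt pQ Qg).
have [A1 [B1 [f1]]] := pow #[g]; rewrite expg_order on !Fp_expp GL4_1 blk1 => /blk_inj[_ _ _].
rewrite mx2_1 => /mx2_inj[d1 _ _ d1']; rewrite -{}d1 -{}d1' in eg.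
have := subsetP sQG _ Qg; rewrite (Sp4_blk eg) => /andP[/eqP e1 /eqP e2].
have eD : mx2 1 0 f 1 = Wmx (- f) by rewrite /Wmx opprK.
rewrite eD tr_Wmx opprK in e1.
have eA : A = Umx (- f) by rewrite -[LHS]mulmx1 -(Umx_inv f) mulmxA e1 mul1mx.
have UA : Umx f *m A = 1%:M by rewrite eA Umx_inv.
have /symx_tr[a [b [c eX]]] : (Umx f *m B')^T = Umx f *m B'.
  have := congr1 (fun Z => Umx f *m Z *m (Umx f)^T) e2.
  rewrite !mulmxA UA mul1mx -!trmx_mul -(mulmxA _ A^T) -trmx_mul UA trmx1 mulmx1 //.
apply/jgrpP; exists (- f), a, b, c; apply: GL_inj; rewrite jelE eg eD -eX eA /jmx.
have UU : Umx (- f) *m Umx f = 1%:M by have := Umx_inv (- f); rewrite opprK.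
by rewrite mulmxA UU mul1mx.
Qed.

End SylowSp4.

(** * Assembly *)

Section CoreQuotient.
Local Open Scope group_scope.
Variables (p : nat) (gT : finGroupType).
Hypotheses (p_pr : prime p) (p_odd : odd p).
Variables (S E1 E2 : {group gT}) (A1 A2 : {group {perm gT}}) (B : {set {perm gT}}).
Variable D : {group gT}.
Hypothesis ctx : pair_context p S E1 E2 A1 A2 B D.
Variable T : {group gT}.
Hypotheses (sTD : T \subset D) (invT1 : inv_under A1 T) (invT2 : inv_under A2 T).
Hypothesis maxT : forall X : {group gT}, X \subset D -> inv_under A1 X -> inv_under A2 X -> X \subset T.

Lemma index_S_E : #|S : E2| = p.
Proof.
have [_ [_ eD] eS [[_ i1] _ _ _ _] [[n2 _] _ _ _ _]] := ctx.
have sD1 : D \subset E1 by rewrite -eD subsetIl.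
apply/eqP; rewrite -(eqn_pmul2l (cardG_gt0 E2)) Lagrange ?(normal_sub n2) //.
rewrite -(eqn_pmul2r (cardG_gt0 D)) -{2}eD.
have := mul_cardG E1 E2; rewrite eS eD => <-.
by rewrite -(Lagrange sD1) i1 mulnC (mulnC #|D|) mulnA.
Qed.

(** [K1 = K2] is invariant on both sides, so it lies in [T], and irreducibility of [E1 / K1] gives
    equality. The quotient is a nonabelian product of two groups of exponent [p]; it has class two,
    so for odd [p] it has exponent [p] as well. *)
Lemma core_NN K1 t1 K2 t2 : t1 \in B -> t2 \in B ->
  typeN p S E1 A1 D K1 t1 -> typeN p S E2 A2 D K2 t2 -> (S / T) \isog p^{1+2}.
Proof.
move=> B1 B2 N1 N2; have eK := pair_NN p_pr p_odd ctx B1 B2 N1 N2.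
have [[pS _] [nDS eD] eS [[n1 i1] _ _ _ _] [[n2 i2] _ _ _ _]] := ctx.
have [[sP1 sK1 nK1 iK1] [iv1 irr1 nc1 _] _] := N1.
have [[sP2 sK2 nK2 iK2] [iv2 _ _ _] _] := N2.
have sD1 : D \subset E1 by rewrite -eD subsetIl.
have sD2 : D \subset E2 by rewrite -eD subsetIr.
have sE1 := normal_sub n1; have sE2 := normal_sub n2.
have eT : T = K1.
  have sKT : K1 \subset T by apply: maxT => // a x Aa; rewrite /= eK; apply: iv2.
  have [e|e] := irr1 _ invT1 sKT (subset_trans sTD sD1); first exact: val_inj.
  by case/negP: (index_p_neq p_pr i1); rewrite -e.
rewrite eT; have pQ : p.-group (S / K1) := quotient_pgroup K1 pS.
have nK := normal_norm nK1.
have card3 : #|S / K1| = (p ^ 3)%N.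
  rewrite card_quotient // -(Lagrange_index (subset_trans sD2 sE2) sK1) iK1.
  by rewrite -(Lagrange_index sE2 sD2) index_S_E i2 !expnS expn0 muln1 mulnA.
have cD : [~: D, S] \subset K1 by apply: (pgroup_comm_index p_pr pS nK1 nDS sK1); rewrite iK1.
apply: (isog_pX1p2 p_pr _ _ card3).
  apply: (p3group_extraspecial pQ); last by rewrite card3 pfactorK.
  apply: contra nc1 => abQ; rewrite -quotient_cents2 ?(subset_trans sE1) //.
  by apply: subset_trans (quotientS _ sE1) abQ.
apply/exponentP=> _ /morphimP[s Ns Ss ->]; rewrite -(morphX (coset_morphism K1)) //=.
have: s \in E1 * E2 by rewrite eS.
case/mulsgP=> a b Ea Eb ->; have Sa := subsetP sE1 _ Ea; have Sb := subsetP sE2 _ Eb.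
have Na := subsetP nK _ Sa; have Nb := subsetP nK _ Sb.
have Dc : [~ b, a] \in D.
  by apply: (subsetP (comm_E_D p_pr pS n2 nDS sD2 i2)); rewrite mem_commg.
have cc z : z \in S -> commute (coset K1 z) [~ coset K1 b, coset K1 a].
  move=> Sz; rewrite -(morphR (coset_morphism K1)) //=; apply: commute_sym.
  apply: coset_comm1; [by rewrite groupR | exact: (subsetP nK) |].
  by apply: (subsetP cD); rewrite mem_commg.
have inK z : z \in E1 -> coset K1 z ^+ p = 1.
  move=> Ez; rewrite -(morphX (coset_morphism K1)) ?(subsetP nK) ?(subsetP sE1) //=.
  by rewrite coset_id // (subsetP sP1) // pow_in_Phi // (pgroupS sE1).
rewrite (morphX (coset_morphism K1)) ?groupM //= (morphM (coset_morphism K1)) //=.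
rewrite (expMg_class2 p_pr p_odd (cc _ Sb) (cc _ Sa)); last first.
  by rewrite -(morphR (coset_morphism K1)) //=; apply: inK; apply: (subsetP sD1).
rewrite inK // mul1g -(morphX (coset_morphism K1)) //= coset_id // eK (subsetP sP2) //.
by rewrite pow_in_Phi // (pgroupS sE2).
Qed.

(** [T = Phi(E2)] by [pair_NA] and irreducibility. The element [x] makes the extension by [E2 / T]
    split, and a [v1] with [[v1, x]] outside [Y2] starts a Jordan basis. *)
Lemma core_NA K1 t1 Y2 : t1 \in B ->
  typeN p S E1 A1 D K1 t1 -> typeA p S E2 A2 D Y2 ->
  exists P : {group {'GL_4['F_p]}}, p.-Sylow(Sp4 p) P /\ (S / T) \isog P.
Proof.
move=> B1 N1 TA; have [ivP [x [Sx nEx xp]]] := pair_NA p_pr p_odd ctx B1 N1 TA.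
have [[pS _] [nDS eD] eS [[n1 i1] _ _ _ _] [[n2 i2] sA2 syl2 _ _]] := ctx.
have [iP2 irr2 [nY2 sPY sYD iDY iYP] [nE2 ncD]] := TA.
have sD1 : D \subset E1 by rewrite -eD subsetIl.
have sD2 : D \subset E2 by rewrite -eD subsetIr.
have sE2 := normal_sub n2; have p2 := pgroupS sE2 pS.
have eT : T = 'Phi(E2)%G.
  have sPT : 'Phi(E2) \subset T.
    apply: (maxT (X := 'Phi(E2)%G)) => //; first exact: subset_trans sPY sYD.
    exact: inv_Phi.
  have [e|e] := irr2 _ invT2 sPT (subset_trans sTD sD2); first exact: val_inj.
  by case/negP: (index_p_neq p_pr i2); rewrite -e.
rewrite eT; have nP : 'Phi(E2)%G <| S by apply: (inv_normal n2 syl2 (inv_Phi sA2)); apply: Phi_sub.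
have nPS := normal_norm nP.
have cD : [~: D, S] \subset Y2 by apply: (pgroup_comm_index p_pr pS nY2 nDS sYD); rewrite iDY.
have cE : [~: E2, S] \subset D by apply: (comm_E_D p_pr pS n2 nDS sD2 i2).
have cY : [~: Y2, S] \subset 'Phi(E2).
  by apply: (pgroup_comm_index p_pr pS nP nY2 sPY); rewrite iYP.
have xE : <[x]> * E2 = S.
  by apply: (prime_index_mul p_pr n2 index_S_E); rewrite cycle_subG.
(* [S] is generated by [x] and [E2], and [E2] is abelian modulo [Phi(E2)], so commutators with [x]
   decide. *)
have wit (X N : {group gT}) : N <| S -> X \subset E2 -> 'Phi(E2) \subset N ->
    {in X, forall y, [~ y, x] \in N} -> [~: X, S] \subset N.
  move=> nN sX sPN cx; have nNS := normal_norm nN; have sXS := subset_trans sX sE2.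
  rewrite -quotient_cents2 ?(subset_trans sXS) // -xE quotientMl ?cycle_subG ?(subsetP nNS) //.
  rewrite centM subsetI /= quotient_cycle ?(subsetP nNS) // cent_cycle; apply/andP; split.
    apply/subsetP=> _ /morphimP[y Ny Xy ->]; apply/cent1P; apply: coset_comm1 => //.
      by rewrite (subsetP nNS).
    exact: cx.
  rewrite quotient_cents2 ?(subset_trans sXS) ?(subset_trans sE2) //.
  exact: subset_trans (subset_trans (commSg _ sX) (comm_sub_Phi p2)) sPN.
have [v1 Ev1 nv2] : exists2 v, v \in E2 & [~ v, x] \notin Y2.
  apply/exists_inP; move: nE2; apply: contraR => /exists_inPn h.
  by apply: wit => // y Ey; apply/negPn; apply: h.
pose v2 := [~ v1, x]; pose v3 := [~ v2, x].
have Dv2 : v2 \in D by apply: (subsetP cE); rewrite mem_commg.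
have Yv3 : v3 \in Y2 by apply: (subsetP cD); rewrite mem_commg.
have nYD : Y2 <| D := normalS sYD (normal_sub nDS) nY2.
have eD2 : <[v2]> * Y2 = D by apply: (prime_index_mul p_pr nYD iDY); rewrite cycle_subG.
(* Otherwise [x] would centralise [v2] and [Y2], hence [D], modulo [Phi(E2)]. *)
have nPv3 : v3 \notin 'Phi(E2).
  apply: contra ncD => Pv3; apply: (wit D 'Phi(E2)%G) => // d Dd.
  have Nx := subsetP nPS _ Sx; have Nd := subsetP nPS _ (subsetP sE2 _ (subsetP sD2 _ Dd)).
  have cdx : coset 'Phi(E2) d \in 'C[coset 'Phi(E2) x].
    have sv2 : <[v2]> \subset 'N('Phi(E2)%G).
      by rewrite cycle_subG (subsetP nPS) // (subsetP sE2) // (subsetP sD2).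
    have : coset 'Phi(E2) d \in D / 'Phi(E2) by apply: mem_quotient.
    apply: subsetP; rewrite -eD2 quotientMl // mul_subG //.
      rewrite quotient_cycle -?cycle_subG // cycle_subG; apply/cent1P; apply: coset_comm1 => //.
      by rewrite -cycle_subG.
    apply/subsetP=> _ /morphimP[y Ny Yy ->]; apply/cent1P; apply: coset_comm1 => //.
    by apply: (subsetP cY); rewrite mem_commg.
  apply: coset_idr; first by rewrite groupR.
  by rewrite (morphR (coset_morphism _)) //=; apply/eqP/commgP/cent1P.
have nv1 : v1 \notin D by apply: contra nv2 => Dv1; apply: (subsetP cD); rewrite mem_commg.
have nDE : D <| E2 := normalS sD2 sE2 nDS.
have eE2 : <[v1]> * D = E2 by apply: (prime_index_mul p_pr nDE i2); rewrite cycle_subG.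
have nPY : 'Phi(E2)%G <| Y2 := normalS sPY (normal_sub nY2) nP.
have eY : <[v3]> * 'Phi(E2) = Y2 by apply: (prime_index_mul p_pr nPY iYP); rewrite cycle_subG.
have [Ev2 Ev3] : v2 \in E2 /\ v3 \in E2.
  by split; apply: (subsetP sD2) => //; apply: (subsetP sYD).
have inN y : y \in E2 -> y \in 'N('Phi(E2)%G) by move=> Ey; rewrite (subsetP nPS) ?(subsetP sE2).
have Nx := subsetP nPS _ Sx.
pose q := coset 'Phi(E2).
have jS : jordan3 p (q v1) (q v2) (q v3) (q x).
  have cc a b : a \in E2 -> b \in E2 -> commute (q a) (q b).
    move=> Ea Eb; apply: coset_comm1; rewrite ?inN //.
    by apply: (subsetP (comm_sub_Phi p2)); rewrite mem_commg.
  have qp a : a \in E2 -> q a ^+ p = 1.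
    by move=> Ea; rewrite -(morphX (coset_morphism _)) ?inN //= coset_id ?pow_in_Phi.
  have qJ a : a \in E2 -> q a ^ q x = q a * q [~ a, x].
    move=> Ea; have Nax : [~ a, x] \in 'N('Phi(E2)%G) by apply: groupR; first exact: inN.
    have -> : q a ^ q x = q (a ^ x) by exact: (esym (morphJ (coset_morphism _) (inN _ Ea) Nx)).
    rewrite conjg_mulR; exact: (morphM (coset_morphism _) (inN _ Ea) Nax).
  split; split; rewrite ?qJ //; try by [apply: cc | apply: qp].
    by rewrite -(morphX (coset_morphism _)) //= coset_id.
  rewrite [X in _ * X]coset_id ?mulg1 //.
  by apply: (subsetP cY); rewrite mem_commg.
pose H := jordan_gen (q v1) (q v2) (q v3) (q x).
have eH : H :=: S / 'Phi(E2).
  have gH z : z \in [set q v1; q v2; q v3; q x] -> z \in H by apply: mem_gen.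
  have [h1 h2 h3 hx] : [/\ q v1 \in H, q v2 \in H, q v3 \in H & q x \in H].
    by split; apply: gH; rewrite !inE eqxx ?orbT.
  apply/eqP; rewrite eqEsubset; apply/andP; split.
    by rewrite gen_subG !subUset !sub1set !mem_quotient // (subsetP sE2).
  pose G := (coset 'Phi(E2) @*^-1 H)%G.
  have inG y : y \in S -> q y \in H -> y \in G.
    by move=> Sy; apply: mem_morphpre; rewrite (subsetP nPS).
  have sPG : 'Phi(E2) \subset G.
    apply/subsetP=> y Py; apply: inG; last by rewrite /q coset_id.
    exact: (subsetP (normal_sub nP)).
  have sSG : S \subset G.
    rewrite -xE mul_subG ?cycle_subG ?inG // -eE2 mul_subG ?cycle_subG ?inG ?(subsetP sE2) //.
    rewrite -eD2 mul_subG ?cycle_subG ?inG ?(subsetP sE2) //.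
    by rewrite -eY mul_subG ?cycle_subG ?inG ?(subsetP sE2).
  by apply/subsetP=> _ /morphimP[y Ny Sy ->]; have /morphpreP[] := subsetP sSG _ Sy.
have cS : #|S / 'Phi(E2)| = (p ^ 4)%N.
  by rewrite card_quotient // -(Lagrange_index sE2 (Phi_sub E2)) index_S_E iP2 -expnS.
exists (jgrp p); split; first exact: jgrp_Sylow.
rewrite -eH; apply: (jordan_isog p_pr jS (jordan_matrices p_pr)).
  by rewrite -/H eH.
exact: card_jgrp.
Qed.

End CoreQuotient.

(** * Back to the fusion system *)

Section Assembly.
Local Open Scope group_scope.
Variables (p : nat) (gT : finGroupType) (S : {group gT}).
Variable F : {set gT} -> (gT -> gT) -> Prop.
Hypotheses (p_pr : prime p) (p_odd : odd p) (pS : p.-group S).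
Hypothesis rkS : forall H : {group gT}, H \subset S -> 'm(H) <= 3.
Hypothesis satF : saturated S F p.

Definition AutF_group (E : {group gT}) (sES : E \subset S) : {group {perm gT}} :=
  Group (AutF_group_set satF sES).

(** [E] is F-conjugate to itself, through conjugation by 1. *)
Lemma essential_cent (E : {group gT}) : essential S F p E -> 'C_S(E) \subset E.
Proof.
case=> sES cE _ _; apply: cE; exists (fun x => x ^ 1); split.
  by apply: (fusion_conj satF).
by apply/setP=> x; apply/idP/imsetP=> [Ex|[y Ey ->]]; [exists x | ]; rewrite ?conjg1.
Qed.

Lemma essential_index (E : {group gT}) (sES : E \subset S) : essential S F p E ->
  F_characteristic S F E -> #|S : E| = p /\
  (split_action p S E (AutF_group sES) \/ irreducible_action p S E (AutF_group sES)).
Proof.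
move=> esE chE; have nES := Fchar_normal satF sES chE.
have [_ _ _ spe] := esE; rewrite /OutF Inn_conj in spe.
apply: (essential_structure p_pr p_odd pS nES (essential_cent esE)) => //.
- exact: sub_Aut.
- exact: (AutS_Sylow pS satF sES chE).
- exact: rkS.
Qed.

Lemma essential_side (E D : {group gT}) (sES : E \subset S) : F_characteristic S F E ->
  #|E : D| = p -> side p S E (AutF_group sES) (AutF F S) D.
Proof.
move=> chE iD; split.
- by split=> //; apply: (Fchar_normal satF sES chE).
- exact: sub_Aut.
- exact: (AutS_Sylow pS satF sES chE).
- exact: (AutF_extend pS satF sES chE).
- move=> X iX sXE t x Bt Xx; have [a Aa at_] := AutF_restrict satF sES chE Bt.
  by rewrite -at_ ?(subsetP sXE) //; apply: iX.
Qed.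

Lemma essential_type (E E' : {group gT}) (sES : E \subset S) (D : {group gT}) :
  essential S F p E -> F_characteristic S F E -> F_characteristic S F E' ->
  D <| S -> E :&: E' = D -> #|E : D| = p ->
  [\/ exists K t, t \in AutF F S /\ typeN p S E (AutF_group sES) D K t,
      exists2 t, t \in AutF F S & typeB p S E (AutF_group sES) D t
    | exists Y, typeA p S E (AutF_group sES) D Y].
Proof.
move=> esE chE chE' nDS eD iD; have [_ str] := essential_index sES esE chE.
have nES := Fchar_normal satF sES chE; have cES := essential_cent esE.
have [_ sA syl ext _] := essential_side sES chE iD.
have sB : AutF F S \subset Aut S := sub_Aut F S.
have sDE : D \subset E by rewrite -eD subsetIl.
have invE : {in AutF F S & E, forall (t : {perm gT}) x, t x \in E}.
  by move=> t x Bt Ex; apply: (AutF_char_sub chE).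
have invD : {in AutF F S & D, forall (t : {perm gT}) x, t x \in D}.
  move=> t x Bt; rewrite -eD => /setIP[Ex Ex']; rewrite inE invE //.
  exact: (AutF_char_sub chE').
case: str => [sp|irr].
  have [h|h] := classify_split p_pr p_odd pS nES cES sA syl sB ext nDS sDE iD invD invE sp.
    by constructor 1.
  by constructor 2.
by constructor 3; apply: (classify_irreducible p_pr pS nES sA syl nDS sDE iD).
Qed.

End Assembly.

Unset Implicit Arguments.
Local Open Scope group_scope.

Theorem theorem4p3 (p : nat) (gT : finGroupType) (S : {group gT})
    (F : {set gT} -> (gT -> gT) -> Prop) (E1 E2 T : {group gT}) :
  prime p -> odd p -> p.-group S -> sectional_rank S 3 ->
  saturated S F p ->
  essential S F p E1 -> essential S F p E2 -> E1 :!=: E2 ->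
  F_characteristic S F E1 -> F_characteristic S F E2 ->
  is_core S F E1 E2 T ->
  (S / T) \isog p^{1+2} \/
  (exists P : {group {'GL_4['F_p]}}, p.-Sylow(Sp4 p) P /\ (S / T) \isog P).
Proof.
move=> p_pr p_odd pS [rkS _] satF es1 es2 ne ch1 ch2 [[sTI nT1 nT2 nTS] maxT].
have [sE1 _ _ _] := es1; have [sE2 _ _ _] := es2.
have [i1 _] := essential_index p_pr p_odd pS rkS satF sE1 es1 ch1.
have [i2 _] := essential_index p_pr p_odd pS rkS satF sE2 es2 ch2.
have n1 := Fchar_normal satF sE1 ch1; have n2 := Fchar_normal satF sE2 ch2.
pose D := (E1 :&: E2)%G; have nDS : D <| S by apply: normalI.
have n12 : ~~ (E1 \subset E2).
  apply: contra ne => s12; rewrite eqEcard s12 /= -(leq_pmul2r (prime_gt0 p_pr)).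
  by rewrite -{1}i2 -i1 !Lagrange.
have eS : E1 * E2 = S := prime_index_mul p_pr n2 i2 sE1 n12.
have eC := mul_cardG E1 E2; rewrite eS in eC.
have iD1 : #|E1 : D| = p.
  apply/eqP; rewrite -(eqn_pmul2l (cardG_gt0 E2)) -(eqn_pmul2l (cardG_gt0 D)).
  rewrite mulnCA Lagrange ?subsetIl // mulnC eC -(Lagrange sE2) i2.
  by rewrite mulnC.
have iD2 : #|E2 : D| = p.
  apply/eqP; rewrite -(eqn_pmul2l (cardG_gt0 E1)) -(eqn_pmul2l (cardG_gt0 D)).
  rewrite mulnCA Lagrange ?subsetIr // eC -(Lagrange sE1) i1.
  by rewrite mulnC.
pose A1 := AutF_group satF sE1; pose A2 := AutF_group satF sE2.
have ctx : pair_context p S E1 E2 A1 A2 (AutF F S) D.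
  split=> //; first by split=> //; apply: sub_Aut.
    exact: essential_side.
  exact: essential_side.
have inv_of (P : {set gT}) (A : {group {perm gT}}) (X : {group gT}) :
    A :=: AutF F P -> normalized_by_AutF F P X -> inv_under A X.
  by move=> eA nX a x; rewrite eA => Aa Xx; apply: (subsetP (nX a Aa)); apply: imset_f.
have of_inv (P : {set gT}) (A : {group {perm gT}}) (X : {group gT}) :
    A :=: AutF F P -> inv_under A X -> normalized_by_AutF F P X.
  by move=> eA iX a Aa; apply/subsetP=> _ /imsetP[x Xx ->]; apply: iX; rewrite ?eA.
have iT1 : inv_under A1 T by apply: inv_of nT1.
have iT2 : inv_under A2 T by apply: inv_of nT2.
(* The core also has to be normalised by [Aut_F(S)]; this follows from invariance under [Aut_F(E1)]
   by restriction. *)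
have mT (X : {group gT}) : X \subset D -> inv_under A1 X -> inv_under A2 X -> X \subset T.
  move=> sX iX1 iX2; apply: maxT; split=> //; [exact: of_inv iX1 | exact: of_inv iX2 |].
  have [_ _ _ [_ _ _ _ res] _] := ctx.
  move=> t Bt; apply/subsetP=> _ /imsetP[x Xx ->].
  by apply: res => //; apply: subset_trans sX (subsetIl _ _).
have sTD : T \subset D by [].
have ty1 := essential_type p_pr p_odd pS rkS satF sE1 es1 ch1 ch2 nDS (erefl _) iD1.
have ty2 := essential_type p_pr p_odd pS rkS satF sE2 es2 ch2 ch1 nDS (setIC _ _) iD2.
have ctx' := pair_sym ctx.
have mT' (X : {group gT}) : X \subset D -> inv_under A2 X -> inv_under A1 X -> X \subset T.
  by move=> sX i2X i1X; apply: mT.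
(* Of the nine pairs of types, NN gives the extraspecial quotient and N with A, in either order, the
   symplectic one; the others are contradictory. *)
case: ty1 => [[K1 [t1 [B1 N1]]]|[t1 B1 T1]|[Y1 T1]];
  case: ty2 => [[K2 [t2 [B2 N2]]]|[t2 B2 T2]|[Y2 T2]].
- by left; apply: (core_NN p_pr p_odd ctx sTD iT1 mT B1 B2 N1 N2).
- by case: (pair_BN p_pr p_odd ctx' B2 B1 T2 N1).
- by right; apply: (core_NA p_pr p_odd ctx sTD iT2 mT B1 N1 T2).
- by case: (pair_BN p_pr p_odd ctx B1 B2 T1 N2).
- by case: (pair_BB p_pr ctx rkS T1 T2).
- by case: (pair_BA p_pr p_odd ctx rkS B1 T1 T2).
- by right; apply: (core_NA p_pr p_odd ctx' sTD iT1 mT' B2 N2 T1).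
- by case: (pair_BA p_pr p_odd ctx' rkS B2 T2 T1).
- by case: (pair_AA p_pr p_odd ctx rkS T1 T2).
Qed.
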